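(* Let $A$ and $B$ be Hopf algebras over an algebraically closed field $k$ that have equivalent linear tensor categories of comodules, $\mathcal M^A \simeq^{\otimes} \mathcal M^B$. If $A$ and $B$ are smooth and have bijective antipode, then $\mathrm{cd}(A)=\mathrm{cd}(B)$.
   Context: $\mathcal M^A$ denotes the $k$-linear monoidal category of right $A$-comodules; $\mathcal M^A\simeq^\otimes\mathcal M^B$ means that there is a $k$-linear monoidal equivalence (not assumed compatible with the forgetful functors to vector spaces). For an algebra $A$, $\mathrm{cd}(A)\in\mathbb N\cup\{\infty\}$ is the Hochschild cohomological dimension, i.e. the projective dimension of $A$ in the category of $A$-bimodules; for a Hopf algebra it equals the (left or right) global dimension and the projective dimension of the trivial (left or right) $A$-module. An algebra is (homologically) smooth if it has, as a bimodule over itself, a finite-length resolution by finitely generated projective bimodules; for a Hopf algebra this is equivalent to the trivial left or right module having a finite-length resolution by finitely generated projective modules. *)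

(* Defs.v *)
From HB Require Import structures.
From mathcomp Require Import all_boot all_algebra sesquilinear boolp.

Set Implicit Arguments.
Unset Strict Implicit.
Unset Printing Implicit Defensive.

Import GRing.Theory.
Local Open Scope ring_scope.
Local Open Scope quotient_scope.

Section Tensor.
Variables (k : fieldType) (V W : lmodType k).

Definition tens_sum (U : lmodType k) (f : V -> W -> U) (s : seq (V * W)) : U :=
  \sum_(p <- s) f p.1 p.2.

(* An element of the tensor product is a finite sum of pure tensors; two such
   sums are identified when no bilinear map separates them, so the universal
   property (tlift, tlift_tprod, tens_ext below) holds by construction. *)
Definition tens_eqv (s t : seq (V * W)) : bool :=
  `[< forall (U : lmodType k) (f : {bilinear V -> W -> U}),
        tens_sum f s = tens_sum f t >].

Lemma tens_eqv_refl : reflexive tens_eqv.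
Proof. by move=> s; apply/asboolP. Qed.

Lemma tens_eqv_sym : symmetric tens_eqv.
Proof. by move=> s t; apply/asboolP/asboolP => st U f; rewrite st. Qed.

Lemma tens_eqv_trans : transitive tens_eqv.
Proof.
by move=> t s u /asboolP st /asboolP tu; apply/asboolP => U f; rewrite st tu.
Qed.

Canonical tens_equiv :=
  EquivRel tens_eqv tens_eqv_refl tens_eqv_sym tens_eqv_trans.

Definition tens : Type := {eq_quot tens_equiv}.

HB.instance Definition _ := Choice.on tens.
HB.instance Definition _ := EqQuotient.on tens.

(* Total in f for convenience; only meaningful, and linear, for bilinear f. *)
Definition tlift (U : lmodType k) (f : V -> W -> U) (x : tens) : U :=
  tens_sum f (repr x).

Lemma tlift_pi (U : lmodType k) (f : {bilinear V -> W -> U}) s :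
  tlift f (\pi_tens s) = tens_sum f s.
Proof.
have /eqmodP/asboolP : \pi_tens (repr (\pi_tens s)) = \pi_tens s by rewrite reprK.
exact.
Qed.

Lemma tlift_inj (x y : tens) :
  (forall (U : lmodType k) (f : {bilinear V -> W -> U}), tlift f x = tlift f y) ->
  x = y.
Proof.
move=> xy; rewrite -[x]reprK -[y]reprK; apply/eqmodP/asboolP => U f.
exact: xy.
Qed.

Definition tens_zero : tens := \pi_tens [::].
Definition tens_add (x y : tens) : tens := \pi_tens (repr x ++ repr y).
Definition tens_scale (a : k) (x : tens) : tens :=
  \pi_tens [seq (a *: p.1, p.2) | p <- repr x].
Definition tens_opp := tens_scale (-1).

Section Eval.
Variables (U : lmodType k) (f : {bilinear V -> W -> U}).

Lemma tlift0 : tlift f tens_zero = 0.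
Proof. by rewrite tlift_pi /tens_sum big_nil. Qed.

Lemma tliftD x y : tlift f (tens_add x y) = tlift f x + tlift f y.
Proof. by rewrite tlift_pi /tens_sum big_cat. Qed.

Lemma tliftZ a x : tlift f (tens_scale a x) = a *: tlift f x.
Proof.
rewrite tlift_pi /tens_sum big_map scaler_sumr.
by apply: eq_bigr => p _; rewrite linearZl_LR.
Qed.

End Eval.

Lemma tens_addA : associative tens_add.
Proof. by move=> x y z; apply: tlift_inj => U f; rewrite !tliftD addrA. Qed.
Lemma tens_addC : commutative tens_add.
Proof. by move=> x y; apply: tlift_inj => U f; rewrite !tliftD addrC. Qed.
Lemma tens_add0 : left_id tens_zero tens_add.
Proof. by move=> x; apply: tlift_inj => U f; rewrite tliftD tlift0 add0r. Qed.
Lemma tens_addN : left_inverse tens_zero tens_opp tens_add.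
Proof.
move=> x; apply: tlift_inj => U f.
by rewrite tliftD tliftZ scaleN1r addNr tlift0.
Qed.

HB.instance Definition _ :=
  GRing.isZmodule.Build tens tens_addA tens_addC tens_add0 tens_addN.

Lemma tens_scaleA a b x : tens_scale a (tens_scale b x) = tens_scale (a * b) x.
Proof. by apply: tlift_inj => U f; rewrite !tliftZ scalerA. Qed.
Lemma tens_scale1 : left_id 1 tens_scale.
Proof. by move=> x; apply: tlift_inj => U f; rewrite !tliftZ scale1r. Qed.
Lemma tens_scaleDr : right_distributive tens_scale +%R.
Proof.
by move=> a x y; apply: tlift_inj => U f; rewrite !(tliftZ, tliftD) scalerDr.
Qed.
Lemma tens_scaleDl x : {morph tens_scale^~ x : a b / a + b}.
Proof.
by move=> a b; apply: tlift_inj => U f; rewrite !(tliftZ, tliftD) scalerDl.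
Qed.

HB.instance Definition _ := GRing.Zmodule_isLmodule.Build k tens
  tens_scaleA tens_scale1 tens_scaleDr tens_scaleDl.

Definition tprod (v : V) (w : W) : tens := \pi_tens [:: (v, w)].

Lemma tlift_tprod (U : lmodType k) (f : {bilinear V -> W -> U}) v w :
  tlift f (tprod v w) = f v w.
Proof. by rewrite tlift_pi /tens_sum big_seq1. Qed.

Lemma tlift_is_linear (U : lmodType k) (f : {bilinear V -> W -> U}) :
  linear (tlift f).
Proof. by move=> a x y; rewrite tliftD tliftZ. Qed.

HB.instance Definition _ (U : lmodType k) (f : {bilinear V -> W -> U}) :=
  GRing.isLinear.Build k tens U *:%R (tlift f) (tlift_is_linear f).

Lemma tprod_is_bilinear : bilinear_for *:%R *:%R tprod.
Proof.
split=> [w a u v|v a w w'] /=; apply: tlift_inj => U f;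
  by rewrite [RHS](linearP (tlift f)) /= !tlift_tprod (linearPl, linearPr).
Qed.

HB.instance Definition _ :=
  bilinear_isBilinear.Build k V W tens *:%R *:%R tprod tprod_is_bilinear.

Lemma tens_ind (P : tens -> Prop) :
  (forall v w, P (tprod v w)) -> (forall x y, P x -> P y -> P (x + y)) ->
  forall x, P x.
Proof.
move=> Pp PD x; rewrite -[x]reprK; elim: (repr x) => [|[v w] s IHs].
  suff -> : \pi_tens [::] = tprod 0 0 by [].
  by apply: tlift_inj => U f; rewrite tlift_tprod tlift_pi linear0r /tens_sum big_nil.
suff -> : \pi_tens ((v, w) :: s) = tprod v w + \pi_tens s by apply: PD.
apply: tlift_inj => U f.
by rewrite linearD /= tlift_tprod !tlift_pi /tens_sum big_cons.
Qed.

Lemma tens_ext (U : lmodType k) (f g : {linear tens -> U}) :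
  (forall v w, f (tprod v w) = g (tprod v w)) -> f =1 g.
Proof.
by move=> fg; elim/tens_ind => // x y fx fy; rewrite !linearD /= fx fy.
Qed.

Lemma tens_ext_lin (U : lmodType k) a (f g h : {linear tens -> U}) :
  (forall v w, f (tprod v w) = a *: g (tprod v w) + h (tprod v w)) ->
  forall x, f x = a *: g x + h x.
Proof.
move=> fgh; elim/tens_ind => // x y fx fy.
by rewrite !linearD /= fx fy addrACA.
Qed.

End Tensor.

Notation "V \ox W" := (tens V W) (at level 40, left associativity) : type_scope.
Notation "v \ot w" := (tprod v w) (at level 40, left associativity) : ring_scope.

Definition mk_bilinear (k : fieldType) (V W U : lmodType k) (f : V -> W -> U)
    (f_bilin : bilinear_for *:%R *:%R f) : {bilinear V -> W -> U} :=
  HB.pack f (bilinear_isBilinear.Build k V W U *:%R *:%R f f_bilin).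

Section TensorMaps.
Variable k : fieldType.
Implicit Types U V W X Y : lmodType k.

Section Map.
Variables (V V' W W' : lmodType k).
Variables (f : {linear V -> V'}) (g : {linear W -> W'}).

Lemma tmap_bilinear : bilinear_for *:%R *:%R (fun v w => f v \ot g w).
Proof.
by split=> [w a u v|v a w w'] /=; rewrite linearP (linearPl, linearPr).
Qed.

Definition tmap : V \ox W -> V' \ox W' :=
  tlift (mk_bilinear tmap_bilinear).

HB.instance Definition _ := GRing.Linear.copy tmap (tlift (mk_bilinear tmap_bilinear)).

Lemma tmapE v w : tmap (v \ot w) = f v \ot g w.
Proof. exact: tlift_tprod. Qed.

End Map.

Definition ltprod V W (v : V) : W -> V \ox W := tprod v.
HB.instance Definition _ V W v :=
  GRing.isLinear.Build k W _ *:%R (@ltprod V W v) ((tprod_is_bilinear V W).2 v).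

Definition rtprod V W (w : W) : V -> V \ox W := fun v => tprod v w.
HB.instance Definition _ V W w :=
  GRing.isLinear.Build k V _ *:%R (@rtprod V W w) ((tprod_is_bilinear V W).1 w).

Arguments ltprod [V] W v _ /.
Arguments rtprod V [W] w _ /.

Section Assoc.
Variables U V W : lmodType k.

Lemma tassoc_bilinear : bilinear_for *:%R *:%R
  (fun (x : U \ox V) (w : W) => tmap (@idfun U) (rtprod V w) x).
Proof.
split=> [w a x y|x a w w'] /=; first by rewrite linearP.
by apply: tens_ext_lin x => u v; rewrite /= !tmapE /= !linearPr.
Qed.

Definition tassoc : (U \ox V) \ox W -> U \ox (V \ox W) :=
  tlift (mk_bilinear tassoc_bilinear).

HB.instance Definition _ := GRing.Linear.copy tassoc (tlift (mk_bilinear tassoc_bilinear)).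

Lemma tassocE u v w : tassoc ((u \ot v) \ot w) = u \ot (v \ot w).
Proof. by rewrite [LHS]tlift_tprod /= tmapE. Qed.

Lemma tassoc_inv_bilinear : bilinear_for *:%R *:%R
  (fun (u : U) (y : V \ox W) => tmap (ltprod V u) (@idfun W) y).
Proof.
split=> [y a u u'|u a x y] /=; last by rewrite linearP.
by apply: tens_ext_lin y => v w; rewrite /= !tmapE /= !linearPl.
Qed.

Definition tassoc_inv : U \ox (V \ox W) -> (U \ox V) \ox W :=
  tlift (mk_bilinear tassoc_inv_bilinear).

HB.instance Definition _ := GRing.Linear.copy tassoc_inv (tlift (mk_bilinear tassoc_inv_bilinear)).

Lemma tassoc_invE u v w : tassoc_inv (u \ot (v \ot w)) = (u \ot v) \ot w.
Proof. by rewrite [LHS]tlift_tprod /= tmapE. Qed.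

End Assoc.

Section Unit.
Variable V : lmodType k.

Lemma tlunit_bilinear :
  bilinear_for *:%R *:%R (fun (c : k^o) (v : V) => (c : k) *: v).
Proof.
split=> [v a c d|c a v w] /=; first by rewrite scalerDl scalerA.
by rewrite scalerDr !scalerA mulrC.
Qed.

Definition tlunit : k^o \ox V -> V :=
  tlift (mk_bilinear tlunit_bilinear).

HB.instance Definition _ := GRing.Linear.copy tlunit (tlift (mk_bilinear tlunit_bilinear)).

Lemma tlunitE c v : tlunit (c \ot v) = c *: v.
Proof. exact: tlift_tprod. Qed.

Lemma trunit_bilinear :
  bilinear_for *:%R *:%R (fun (v : V) (c : k^o) => (c : k) *: v).
Proof.
split=> [c a v w|v a c d] /=; last by rewrite scalerDl scalerA.
by rewrite scalerDr !scalerA mulrC.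
Qed.

Definition trunit : V \ox k^o -> V :=
  tlift (mk_bilinear trunit_bilinear).

HB.instance Definition _ := GRing.Linear.copy trunit (tlift (mk_bilinear trunit_bilinear)).

Lemma trunitE v c : trunit (v \ot c) = c *: v.
Proof. exact: tlift_tprod. Qed.

End Unit.

Section Interchange.
Variables U V W X : lmodType k.

Lemma tinter_bilinear1 (y : W \ox X) : bilinear_for *:%R *:%R
  (fun (u : U) (v : V) => tmap (ltprod W u) (ltprod X v) y).
Proof.
split=> [v a u u'|u a v v'] /=;
  by apply: tens_ext_lin y => w x; rewrite /= !tmapE /= (linearPl, linearPr)
    (linearPl, linearPr).
Qed.

Definition tinter1 (y : W \ox X) : U \ox V -> (U \ox W) \ox (V \ox X) :=
  tlift (mk_bilinear (tinter_bilinear1 y)).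

HB.instance Definition _ y :=
  GRing.Linear.copy (tinter1 y) (tlift (mk_bilinear (tinter_bilinear1 y))).

Lemma tinter1E u v y : tinter1 y (u \ot v) = tmap (ltprod W u) (ltprod X v) y.
Proof. exact: tlift_tprod. Qed.

Lemma tinter_bilinear : bilinear_for *:%R *:%R (fun x y => tinter1 y x).
Proof.
split=> [y a x x'|x a y y'] /=; first by rewrite linearP.
by apply: tens_ext_lin x => u v; rewrite /= !tinter1E /= linearP.
Qed.

Definition tinter : (U \ox V) \ox (W \ox X) -> (U \ox W) \ox (V \ox X) :=
  tlift (mk_bilinear tinter_bilinear).

HB.instance Definition _ := GRing.Linear.copy tinter (tlift (mk_bilinear tinter_bilinear)).

Lemma tinterE u v w x :
  tinter ((u \ot v) \ot (w \ot x)) = (u \ot w) \ot (v \ot x).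
Proof. by rewrite [LHS]tlift_tprod /= tinter1E tmapE. Qed.

End Interchange.

Section Algebra.
Variable A : algType k.

Lemma amul_bilinear : bilinear_for *:%R *:%R (fun a b : A => a * b).
Proof.
split=> [b c a a'|a c b b'] /=; first by rewrite mulrDl -scalerAl.
by rewrite mulrDr -scalerAr.
Qed.

Definition amul : A \ox A -> A :=
  tlift (mk_bilinear amul_bilinear).

HB.instance Definition _ := GRing.Linear.copy amul (tlift (mk_bilinear amul_bilinear)).

Lemma amulE a b : amul (a \ot b) = a * b.
Proof. exact: tlift_tprod. Qed.

(* The product of the algebra A \ox A. *)
Definition tmul (x y : A \ox A) : A \ox A := tmap amul amul (tinter (x \ot y)).

Lemma tmulE a b c d : tmul (a \ot b) (c \ot d) = (a * c) \ot (b * d).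
Proof. by rewrite /tmul tinterE tmapE /= !amulE. Qed.

End Algebra.
End TensorMaps.

Arguments ltprod {k V} W v _ /.
Arguments rtprod {k} V {W} w _ /.

Record hopfAlg (k : fieldType) := HopfAlg {
  hopf_alg :> algType k;
  comul : {linear hopf_alg -> hopf_alg \ox hopf_alg};
  counit : {linear hopf_alg -> k^o};
  antipode : {linear hopf_alg -> hopf_alg};
  comulA : forall a, tassoc (tmap comul idfun (comul a))
                     = tmap idfun comul (comul a);
  counitl : forall a, tlunit (tmap counit idfun (comul a)) = a;
  counitr : forall a, trunit (tmap idfun counit (comul a)) = a;
  comulM : forall a b, comul (a * b) = tmul (comul a) (comul b);
  comul1 : comul 1 = 1 \ot 1;
  counitM : forall a b, counit (a * b) = (counit a : k) * counit b;
  counit1 : counit 1 = (1 : k);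
  antipodel : forall a,
    amul (tmap antipode idfun (comul a)) = (counit a : k) *: 1;
  antipoder : forall a,
    amul (tmap idfun antipode (comul a)) = (counit a : k) *: 1
}.

Record linCat (k : fieldType) := LinCat {
  cat_ob :> Type;
  hom : cat_ob -> cat_ob -> lmodType k;
  idm : forall X, hom X X;
  compm : forall X Y Z, hom Y Z -> hom X Y -> hom X Z;
  compmA : forall W X Y Z (f : hom Y Z) (g : hom X Y) (h : hom W X),
    compm f (compm g h) = compm (compm f g) h;
  comp1m : forall X Y (f : hom X Y), compm (idm Y) f = f;
  compm1 : forall X Y (f : hom X Y), compm f (idm X) = f;
  comp_linl : forall X Y Z (g : hom X Y), linear (fun f : hom Y Z => compm f g);
  comp_linr : forall X Y Z (f : hom Y Z), linear (fun g : hom X Y => compm f g)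
}.

Arguments hom {k l} X Y.
Arguments idm {k l} X.
Arguments compm {k l X Y Z} f g.

Notation "f \cc g" := (compm f g) (at level 50, left associativity) : ring_scope.

Definition is_iso (k : fieldType) (C : linCat k) (X Y : C) (f : hom X Y) : Prop :=
  exists g : hom Y X, g \cc f = idm X /\ f \cc g = idm Y.

Record linFunctor (k : fieldType) (C D : linCat k) := LinFunctor {
  fun_ob :> C -> D;
  fun_hom : forall X Y : C, hom X Y -> hom (fun_ob X) (fun_ob Y);
  fun_lin : forall X Y : C, linear (@fun_hom X Y);
  fun_id : forall X : C, fun_hom (idm X) = idm (fun_ob X);
  fun_comp : forall (X Y Z : C) (f : hom Y Z) (g : hom X Y),
    fun_hom (f \cc g) = fun_hom f \cc fun_hom g
}.

Arguments fun_hom {k C D} l {X Y} f.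

Section Functors.
Variable k : fieldType.

Definition id_functor (C : linCat k) : linFunctor C C.
Proof. by exists id (fun X Y => id). Defined.

Definition comp_functor (C D E : linCat k)
  (G : linFunctor D E) (F : linFunctor C D) : linFunctor C E.
Proof.
exists (fun X => G (F X)) (fun X Y f => fun_hom G (fun_hom F f)).
- by move=> X Y a f g; rewrite !fun_lin.
- by move=> X; rewrite !fun_id.
- by move=> X Y Z f g; rewrite !fun_comp.
Defined.

Definition nat_iso (C D : linCat k) (F G : linFunctor C D) : Prop :=
  exists t : forall X : C, hom (F X) (G X),
    (forall X, is_iso (t X)) /\
    (forall (X Y : C) (f : hom X Y), fun_hom G f \cc t X = t Y \cc fun_hom F f).

Definition is_equivalence (C D : linCat k) (F : linFunctor C D) : Prop :=
  exists G : linFunctor D C,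
    nat_iso (comp_functor G F) (id_functor C) /\
    nat_iso (comp_functor F G) (id_functor D).

End Functors.

Record linMonCat (k : fieldType) := LinMonCat {
  moncat_cat :> linCat k;
  tob : moncat_cat -> moncat_cat -> moncat_cat;
  thom : forall X X' Y Y' : moncat_cat,
    hom X X' -> hom Y Y' -> hom (tob X Y) (tob X' Y');
  uob : moncat_cat;
  assoc : forall X Y Z, hom (tob (tob X Y) Z) (tob X (tob Y Z));
  lunit : forall X, hom (tob uob X) X;
  runit : forall X, hom (tob X uob) X;
  thom1 : forall X Y, thom (idm X) (idm Y) = idm (tob X Y);
  thom_comp : forall (X X' X'' Y Y' Y'' : moncat_cat)
      (f' : hom X' X'') (f : hom X X') (g' : hom Y' Y'') (g : hom Y Y'),
    thom (f' \cc f) (g' \cc g) = thom f' g' \cc thom f g;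
  thom_linl : forall (X X' Y Y' : moncat_cat) (g : hom Y Y'),
    linear (fun f : hom X X' => thom f g);
  thom_linr : forall (X X' Y Y' : moncat_cat) (f : hom X X'),
    linear (fun g : hom Y Y' => thom f g);
  assoc_iso : forall X Y Z, is_iso (assoc X Y Z);
  lunit_iso : forall X, is_iso (lunit X);
  runit_iso : forall X, is_iso (runit X);
  assoc_nat : forall (X X' Y Y' Z Z' : moncat_cat)
      (f : hom X X') (g : hom Y Y') (h : hom Z Z'),
    assoc X' Y' Z' \cc thom (thom f g) h = thom f (thom g h) \cc assoc X Y Z;
  lunit_nat : forall (X X' : moncat_cat) (f : hom X X'),
    lunit X' \cc thom (idm uob) f = f \cc lunit X;
  runit_nat : forall (X X' : moncat_cat) (f : hom X X'),
    runit X' \cc thom f (idm uob) = f \cc runit X;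
  pentagon : forall W X Y Z : moncat_cat,
    assoc W X (tob Y Z) \cc assoc (tob W X) Y Z =
    thom (idm W) (assoc X Y Z) \cc assoc W (tob X Y) Z \cc
      thom (assoc W X Y) (idm Z);
  triangle : forall X Y : moncat_cat,
    thom (idm X) (lunit Y) \cc assoc X uob Y = thom (runit X) (idm Y)
}.

Arguments tob {k l} X Y.
Arguments thom {k l X X' Y Y'} f g.
Arguments uob {k l}.
Arguments assoc {k l} X Y Z.
Arguments lunit {k l} X.
Arguments runit {k l} X.

Record monFunctor (k : fieldType) (C D : linMonCat k) := MonFunctor {
  monfun_fun :> linFunctor C D;
  phi2 : forall X Y : C,
    hom (tob (monfun_fun X) (monfun_fun Y)) (monfun_fun (tob X Y));
  phi0 : hom uob (monfun_fun uob);
  phi2_iso : forall X Y, is_iso (phi2 X Y);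
  phi0_iso : is_iso phi0;
  phi2_nat : forall (X X' Y Y' : C) (f : hom X X') (g : hom Y Y'),
    fun_hom monfun_fun (thom f g) \cc phi2 X Y =
    phi2 X' Y' \cc thom (fun_hom monfun_fun f) (fun_hom monfun_fun g);
  phi2_assoc : forall X Y Z : C,
    fun_hom monfun_fun (assoc X Y Z) \cc phi2 (tob X Y) Z \cc
      thom (phi2 X Y) (idm (monfun_fun Z)) =
    phi2 X (tob Y Z) \cc thom (idm (monfun_fun X)) (phi2 Y Z) \cc
      assoc (monfun_fun X) (monfun_fun Y) (monfun_fun Z);
  phi_lunit : forall X : C,
    fun_hom monfun_fun (lunit X) \cc phi2 uob X \cc
      thom phi0 (idm (monfun_fun X)) = lunit (monfun_fun X);
  phi_runit : forall X : C,
    fun_hom monfun_fun (runit X) \cc phi2 X uob \cc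
      thom (idm (monfun_fun X)) phi0 = runit (monfun_fun X)
}.

Definition mon_equivalent (k : fieldType) (C D : linMonCat k) : Prop :=
  exists F : monFunctor C D, is_equivalence F.

Section Comodules.
Variables (k : fieldType) (H : hopfAlg k).

(* Right comodules. *)
Record comod := Comod {
  comod_sort :> lmodType k;
  coact : {linear comod_sort -> comod_sort \ox H};
  coactA : forall v,
    tassoc (tmap coact idfun (coact v)) = tmap idfun (@comul k H) (coact v);
  coactu : forall v, trunit (tmap idfun (@counit k H) (coact v)) = v
}.

Record comod_hom (V W : comod) := ComodHom {
  comod_lin :> {linear V -> W};
  comod_homP : forall v, coact W (comod_lin v) = tmap comod_lin idfun (coact V v)
}.

HB.instance Definition _ V W := gen_eqMixin (comod_hom V W).
HB.instance Definition _ V W := gen_choiceMixin (comod_hom V W).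

Lemma linear_ext (V W : lmodType k) (f g : {linear V -> W}) : f =1 g -> f = g.
Proof.
case: f g => [f [[f1] [f2]]] [g [[g1] [g2]]] /= /funext fg; subst g.
by congr (GRing.Linear.Pack (GRing.Linear.Class _ _));
  congr (_ _); apply: Prop_irrelevance.
Qed.

Lemma comod_hom_ext V W (f g : comod_hom V W) : f =1 g -> f = g.
Proof.
case: f g => [f fP] [g gP] /= /linear_ext fg; subst g.
by congr ComodHom; apply: Prop_irrelevance.
Qed.

Section HomModule.
Variables V W : comod.
Implicit Types f g h : comod_hom V W.

Lemma comod_hom0P (v : V) :
  coact W ((\0 : V -> W) v) = tmap (\0 : V -> W) idfun (coact V v).
Proof.
rewrite /= linear0; elim/tens_ind: (coact V v) => [u a|x y IHx IHy].
  by rewrite tmapE linear0l.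
by rewrite linearD /= -IHx -IHy addr0.
Qed.
Definition comod_hom0 := ComodHom comod_hom0P.

Lemma comod_homDP f g (v : V) :
  coact W ((f \+ g) v) = tmap (f \+ g) idfun (coact V v).
Proof.
rewrite /= linearD /= !comod_homP.
elim/tens_ind: (coact V v) => [u a|x y IHx IHy].
  by rewrite !tmapE linearDl.
by rewrite !linearD /= -IHx -IHy addrACA.
Qed.
Definition comod_homD f g := ComodHom (comod_homDP f g).

Lemma comod_homZP (c : k) f (v : V) :
  coact W ((c \*: f) v) = tmap (c \*: f) idfun (coact V v).
Proof.
rewrite /= linearZ /= comod_homP.
elim/tens_ind: (coact V v) => [u a|x y IHx IHy].
  by rewrite !tmapE linearZl_LR.
by rewrite !linearD /= -IHx -IHy.
Qed.
Definition comod_homZ c f := ComodHom (comod_homZP c f).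
Definition comod_homN f := comod_homZ (-1) f.

Lemma comod_homDA : associative comod_homD.
Proof. by move=> f g h; apply: comod_hom_ext => v; apply: addrA. Qed.
Lemma comod_homDC : commutative comod_homD.
Proof. by move=> f g; apply: comod_hom_ext => v; apply: addrC. Qed.
Lemma comod_hom0D : left_id comod_hom0 comod_homD.
Proof. by move=> f; apply: comod_hom_ext => v; apply: add0r. Qed.
Lemma comod_homND : left_inverse comod_hom0 comod_homN comod_homD.
Proof.
by move=> f; apply: comod_hom_ext => v; rewrite /= scaleN1r addNr.
Qed.

HB.instance Definition _ := GRing.isZmodule.Build (comod_hom V W)
  comod_homDA comod_homDC comod_hom0D comod_homND.

Lemma comod_homZA a b f : comod_homZ a (comod_homZ b f) = comod_homZ (a * b) f.
Proof. by apply: comod_hom_ext => v; apply: scalerA. Qed.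
Lemma comod_hom1Z : left_id 1 comod_homZ.
Proof. by move=> f; apply: comod_hom_ext => v; apply: scale1r. Qed.
Lemma comod_homZDr : right_distributive comod_homZ +%R.
Proof. by move=> a f g; apply: comod_hom_ext => v; apply: scalerDr. Qed.
Lemma comod_homZDl f : {morph comod_homZ^~ f : a b / a + b}.
Proof. by move=> a b; apply: comod_hom_ext => v; apply: scalerDl. Qed.

HB.instance Definition _ := GRing.Zmodule_isLmodule.Build k (comod_hom V W)
  comod_homZA comod_hom1Z comod_homZDr comod_homZDl.

End HomModule.

Lemma tmap_id (V W : lmodType k) (x : V \ox W) : tmap idfun idfun x = x.
Proof. by move: x; apply: (tens_ext (g := idfun)) => v w; rewrite /= tmapE. Qed.

Lemma tmap_comp (V V' V'' W W' W'' : lmodType k)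
    (f' : {linear V' -> V''}) (f : {linear V -> V'}) (f'' : {linear V -> V''})
    (g' : {linear W' -> W''}) (g : {linear W -> W'}) (g'' : {linear W -> W''})
    (ff : f'' =1 f' \o f) (gg : g'' =1 g' \o g) (x : V \ox W) :
  tmap f'' g'' x = tmap f' g' (tmap f g x).
Proof.
move: x; apply: (tens_ext (g := tmap f' g' \o tmap f g)) => v w.
by rewrite /= !tmapE ff gg.
Qed.

Lemma comod_idP (V : comod) (v : V) :
  coact V (@idfun V v) = tmap (@idfun V) idfun (coact V v).
Proof. by rewrite tmap_id. Qed.
Definition comod_id V : comod_hom V V := ComodHom (@comod_idP V).

Lemma comod_compP (U V W : comod) (f : comod_hom V W) (g : comod_hom U V) (u : U) :
  coact W ((f \o g) u) = tmap (f \o g) idfun (coact U u).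
Proof. by rewrite /= !comod_homP; apply/esym/tmap_comp. Qed.
Definition comod_comp U V W (f : comod_hom V W) (g : comod_hom U V) :
  comod_hom U W := ComodHom (comod_compP f g).

Definition comod_cat : linCat k.
Proof.
refine (@LinCat k comod (fun V W => comod_hom V W : lmodType k)
  comod_id comod_comp _ _ _ _ _).
- by move=> W X Y Z f g h; apply: comod_hom_ext.
- by move=> X Y f; apply: comod_hom_ext.
- by move=> X Y f; apply: comod_hom_ext.
- by move=> X Y Z g a f f'; apply: comod_hom_ext.
- by move=> X Y Z f a g g'; apply: comod_hom_ext => x /=; rewrite linearP.
Defined.

End Comodules.

Section TensorComodule.
Variables (k : fieldType) (H : hopfAlg k).
Implicit Types U V W X : comod H.

Lemma tens_ext2 (U V V' W W' : lmodType k)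
    (f g : {linear (V \ox V') \ox (W \ox W') -> U}) :
  (forall v v' w w',
    f ((v \ot v') \ot (w \ot w')) = g ((v \ot v') \ot (w \ot w'))) ->
  f =1 g.
Proof.
move=> fg; apply: tens_ext => x y; elim/tens_ind: x => [v v'|x x' IH IH'].
  elim/tens_ind: y => // y y' IH IH'.
  by rewrite !linearDr !linearD /= IH IH'.
by rewrite !linearDl !linearD /= IH IH'.
Qed.

Lemma tens_ext3l (U V V' V'' : lmodType k)
    (f g : {linear (V \ox V') \ox V'' -> U}) :
  (forall v v' v'', f ((v \ot v') \ot v'') = g ((v \ot v') \ot v'')) -> f =1 g.
Proof.
move=> fg; apply: tens_ext => x y; elim/tens_ind: x => [v v'|x x' IH IH'] //.
by rewrite !linearDl !linearD /= IH IH'.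
Qed.

Lemma tens_ext3r (U V V' V'' : lmodType k)
    (f g : {linear V \ox (V' \ox V'') -> U}) :
  (forall v v' v'', f (v \ot (v' \ot v'')) = g (v \ot (v' \ot v''))) -> f =1 g.
Proof.
move=> fg; apply: tens_ext => v y; elim/tens_ind: y => [v' v''|y y' IH IH'] //.
by rewrite !linearDr !linearD /= IH IH'.
Qed.

Lemma tens_ext4l (U V V' V'' V3 : lmodType k)
    (f g : {linear ((V \ox V') \ox V'') \ox V3 -> U}) :
  (forall v v' v'' w, f (((v \ot v') \ot v'') \ot w)
     = g (((v \ot v') \ot v'') \ot w)) -> f =1 g.
Proof.
move=> fg; apply: tens_ext3l => x y w; elim/tens_ind: x => [v v'|x x' IH IH'] //.
by rewrite !linearDl !linearD /= IH IH'.
Qed.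

Lemma tens_ext33 (U V V' W W' X X' : lmodType k)
    (f g : {linear ((V \ox V') \ox (W \ox W')) \ox (X \ox X') -> U}) :
  (forall v v' w w' x x',
    f (((v \ot v') \ot (w \ot w')) \ot (x \ot x')) =
    g (((v \ot v') \ot (w \ot w')) \ot (x \ot x'))) -> f =1 g.
Proof.
move=> fg; apply: tens_ext3l => y z t.
elim/tens_ind: y => [v v'|y y' IH IH']; last first.
  by rewrite !linearDl !linearD /= IH IH'.
elim/tens_ind: z => [w w'|z z' IH IH']; last first.
  by rewrite linearDr !linearDl !linearD /= IH IH'.
elim/tens_ind: t => // t t' IH IH'.
by rewrite !linearDr !linearD /= IH IH'.
Qed.

Section Coaction.
Variables (V W : lmodType k).
Variables (cV : {linear V -> V \ox H}) (cW : {linear W -> W \ox H}).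

(* In Sweedler notation, v \ot w |-> (v_0 \ot w_0) \ot v_1 w_1. *)
Definition tcoact : V \ox W -> (V \ox W) \ox H :=
  fun x => tmap idfun (@amul k H) (tinter (tmap cV cW x)).

HB.instance Definition _ := GRing.Linear.copy tcoact
  (tmap idfun (@amul k H) \o @tinter k V H W H \o tmap cV cW).

Lemma tcoactE v w :
  tcoact (v \ot w) = tmap idfun (@amul k H) (tinter (cV v \ot cW w)).
Proof. by rewrite /tcoact tmapE. Qed.

End Coaction.

Definition tens_tmul : (H \ox H) \ox (H \ox H) -> H \ox H :=
  fun x => tmap (@amul k H) (@amul k H) (tinter x).
HB.instance Definition _ := GRing.Linear.copy tens_tmul
  (tmap (@amul k H) (@amul k H) \o @tinter k H H H H).

Lemma tens_tmulE x y : tens_tmul (x \ot y) = tmul x y.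
Proof. by []. Qed.

Lemma tcoactA V W x :
  tassoc (tmap (tcoact (coact V) (coact W)) idfun (tcoact (coact V) (coact W) x)) =
  tmap idfun (@comul k H) (tcoact (coact V) (coact W) x).
Proof.
pose Phi := tmap (@idfun (V \ox W)) tens_tmul \o @tinter k V (H \ox H) W (H \ox H).
pose cA U := @tassoc k U H H \o tmap (coact U) (@idfun H).
have claim1 : @tassoc k (V \ox W) H H \o tmap (tcoact (coact V) (coact W)) (@idfun H) \o
    tmap idfun (@amul k H) \o @tinter k V H W H =1
    Phi \o tmap (cA V) (cA W).
  apply: tens_ext2 => v a w b.
  rewrite /= tinterE !tmapE /= !tmapE /= amulE tcoactE.
  pose L := @tassoc k (V \ox W) H H \o rtprod _ (a * b) \o
    tmap idfun (@amul k H) \o @tinter k V H W H.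
  pose R := Phi \o tmap (@tassoc k V H H \o rtprod _ a) (@tassoc k W H H \o rtprod _ b).
  suff LR : L =1 R by have := LR (coact V v \ot coact W w); rewrite /L /R /Phi /= !tmapE /=.
  apply: tens_ext2 => v' a' w' b'.
  rewrite /L /R /Phi /= !(tinterE, tmapE) /= !(tassocE, amulE).
  by rewrite tinterE tmapE /= tens_tmulE tmulE.
have claim2 : tmap idfun (@comul k H) \o
    tmap idfun (@amul k H) \o @tinter k V H W H =1
    Phi \o tmap (tmap idfun (@comul k H)) (tmap idfun (@comul k H)).
  apply: tens_ext2 => v a w b.
  rewrite /= !(tinterE, tmapE) /= !tmapE tinterE tmapE /= amulE comulM.
  by rewrite tens_tmulE.
have claim3 : tmap (cA V) (cA W) \o tmap (coact V) (coact W) =1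
    tmap (tmap idfun (@comul k H)) (tmap idfun (@comul k H)) \o
    tmap (coact V) (coact W).
  by apply: tens_ext => v w; rewrite /= !tmapE /cA /= !coactA.
have c1 := claim1 (tmap (coact V) (coact W) x).
have c2 := claim2 (tmap (coact V) (coact W) x).
have c3 := claim3 x.
move: c1 c2; rewrite /= -/(tcoact (coact V) (coact W) x) => -> ->.
by congr (tmap _ _ (tinter _)); apply: c3.
Qed.

Lemma tcoactu V W x : trunit (tmap idfun (@counit k H) (tcoact (coact V) (coact W) x)) = x.
Proof.
have claim1 : @trunit k (V \ox W) \o tmap idfun (@counit k H) \o
    tmap idfun (@amul k H) \o @tinter k V H W H =1
    tmap (@trunit k V) (@trunit k W) \o
    tmap (tmap idfun (@counit k H)) (tmap idfun (@counit k H)).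
  apply: tens_ext2 => v a w b.
  do 3!rewrite /= ?(tinterE, tmapE, trunitE, amulE) ?counitM.
  by rewrite -scalerA [RHS]linearZl_LR; congr (_ *: _); rewrite [RHS]linearZr_LR.
have := claim1 (tmap (coact V) (coact W) x); rewrite /= -/(tcoact (coact V) (coact W) x) => ->.
move: x; apply: (tens_ext (f := tmap (@trunit k V) (@trunit k W) \o
    tmap (tmap idfun (@counit k H)) (tmap idfun (@counit k H)) \o
    tmap (coact V) (coact W)) (g := idfun)) => v w.
by rewrite /= !tmapE /= !coactu.
Qed.

Definition tcomod V W : comod H := Comod (@tcoactA V W) (@tcoactu V W).

Definition ucoact : k^o -> k^o \ox H := rtprod k^o (1 : H).
HB.instance Definition _ := GRing.Linear.copy ucoact (rtprod k^o (1 : H)).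

Lemma ucoactA c : tassoc (tmap ucoact idfun (ucoact c)) =
  tmap idfun (@comul k H) (ucoact c).
Proof. by rewrite /ucoact /= !tmapE tassocE /= comul1. Qed.

Lemma ucoactu c : trunit (tmap idfun (@counit k H) (ucoact c)) = c.
Proof. by rewrite /ucoact /= tmapE counit1 trunitE scale1r. Qed.

Definition ucomod : comod H := Comod ucoactA ucoactu.

Lemma comod_tensP V V' W W' (f : comod_hom V V') (g : comod_hom W W') x :
  coact (tcomod V' W') (tmap f g x) = tmap (tmap f g) idfun (coact (tcomod V W) x).
Proof.
have claim1 : tmap idfun (@amul k H) \o @tinter k V' H W' H \o
    tmap (tmap f idfun) (tmap g idfun) =1
    tmap (tmap f g) idfun \o tmap idfun (@amul k H) \o @tinter k V H W H.
  apply: tens_ext2 => v a w b.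
  by do 3!rewrite /= ?(tinterE, tmapE).
move: x; apply: (tens_ext (f := tcoact (coact V') (coact W') \o tmap f g)
  (g := tmap (tmap f g) idfun \o tcoact (coact V) (coact W))) => v w.
rewrite /= !tmapE !tcoactE !comod_homP.
by have := claim1 (coact V v \ot coact W w); rewrite /= tmapE.
Qed.

Definition comod_tens V V' W W' (f : comod_hom V V') (g : comod_hom W W') :
  comod_hom (tcomod V W) (tcomod V' W') :=
  @ComodHom k H (tcomod V W) (tcomod V' W') (tmap f g) (comod_tensP f g).

Lemma comod_assocP U V W x :
  coact (tcomod U (tcomod V W)) (tassoc x) =
  tmap (@tassoc k U V W) idfun (coact (tcomod (tcomod U V) W) x).
Proof.
pose L := tmap idfun (@amul k H) \o @tinter k U H (V \ox W) H \o
  tmap idfun (tmap idfun (@amul k H)) \o tmap idfun (@tinter k V H W H) \o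
  @tassoc k (U \ox H) (V \ox H) (W \ox H).
pose R := tmap (@tassoc k U V W) (@idfun H) \o tmap idfun (@amul k H) \o
  @tinter k (U \ox V) H W H \o tmap (tmap idfun (@amul k H)) idfun \o
  tmap (@tinter k U H V H) idfun.
have LR : L =1 R.
  apply: tens_ext33 => u a v b w c.
  rewrite /L /R; do 4!rewrite /= ?(tassocE, tinterE, tmapE, amulE).
  by rewrite mulrA.
apply: (tens_ext3l (f := tcoact (coact U) (tcoact (coact V) (coact W)) \o @tassoc k U V W)
  (g := tmap (@tassoc k U V W) idfun \o
        tcoact (tcoact (coact U) (coact V)) (coact W))) => u v w.
rewrite /= tassocE !tcoactE /= !tcoactE.
by have := LR (coact U u \ot coact V v \ot coact W w); rewrite /L /R; do 3!rewrite /= ?(tassocE, tmapE).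
Qed.

Definition comod_assoc U V W :
    comod_hom (tcomod (tcomod U V) W) (tcomod U (tcomod V W)) :=
  @ComodHom k H (tcomod (tcomod U V) W) (tcomod U (tcomod V W))
    (@tassoc k U V W) (@comod_assocP U V W).

Lemma comod_lunitP V x :
  coact V (tlunit x) = tmap (@tlunit k V) idfun (coact (tcomod ucomod V) x).
Proof.
have claim c : tmap (@tlunit k V) idfun \o tmap idfun (@amul k H) \o
    @tinter k k^o H V H \o ltprod _ (c \ot 1) =1 *:%R (c : k).
  apply: tens_ext => v a; do 3!rewrite /= ?(tinterE, tmapE, tlunitE, amulE).
  by rewrite mul1r [LHS]linearZl_LR.
move: x; apply: (tens_ext (f := coact V \o @tlunit k V)
  (g := tmap (@tlunit k V) idfun \o tcoact ucoact (coact V))) => c v.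
by rewrite /= tlunitE tcoactE linearZ; have := claim c (coact V v) => /= ->.
Qed.

Definition comod_lunit V : comod_hom (tcomod ucomod V) V :=
  @ComodHom k H (tcomod ucomod V) V (@tlunit k V) (@comod_lunitP V).

Lemma comod_runitP V x :
  coact V (trunit x) = tmap (@trunit k V) idfun (coact (tcomod V ucomod) x).
Proof.
have claim c : tmap (@trunit k V) idfun \o tmap idfun (@amul k H) \o
    @tinter k V H k^o H \o rtprod _ (c \ot 1) =1 *:%R (c : k).
  apply: tens_ext => v a; do 3!rewrite /= ?(tinterE, tmapE, trunitE, amulE).
  by rewrite mulr1 [LHS]linearZl_LR.
move: x; apply: (tens_ext (f := coact V \o @trunit k V)
  (g := tmap (@trunit k V) idfun \o tcoact (coact V) ucoact)) => v c.
by rewrite /= trunitE tcoactE linearZ; have := claim c (coact V v) => /= ->.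
Qed.

Definition comod_runit V : comod_hom (tcomod V ucomod) V :=
  @ComodHom k H (tcomod V ucomod) V (@trunit k V) (@comod_runitP V).

Lemma comod_iso V W (f : comod_hom V W) (g : {linear W -> V}) :
  cancel f g -> cancel g f -> is_iso (f : hom (V : comod_cat H) W).
Proof.
move=> fK gK.
have gP w : coact V (g w) = tmap g idfun (coact W w).
  rewrite -{2}[w]gK comod_homP -(tmap_comp (f'' := idfun) (g'' := idfun)) //.
    by rewrite tmap_id.
  by move=> v /=; rewrite fK.
by exists (ComodHom gP); split; apply: comod_hom_ext => v /=; rewrite ?fK ?gK.
Qed.

Lemma comod_assoc_iso U V W :
  is_iso (comod_assoc U V W : hom (tcomod (tcomod U V) W : comod_cat H) _).
Proof.
apply: (@comod_iso _ _ (comod_assoc U V W) (@tassoc_inv k U V W)) => x /=; move: x.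
  apply: (tens_ext3l (f := @tassoc_inv k U V W \o @tassoc k U V W) (g := idfun)).
  by move=> u v w; rewrite /= tassocE tassoc_invE.
apply: (tens_ext3r (f := @tassoc k U V W \o @tassoc_inv k U V W) (g := idfun)).
by move=> u v w; rewrite /= tassoc_invE tassocE.
Qed.

Lemma comod_lunit_iso V : is_iso (comod_lunit V : hom (tcomod ucomod V : comod_cat H) V).
Proof.
apply: (@comod_iso _ _ (comod_lunit V) (ltprod V (1 : k^o))) => x /=; last first.
  by rewrite tlunitE scale1r.
move: x; apply: (tens_ext (f := ltprod V (1 : k^o) \o @tlunit k V) (g := idfun)).
by move=> c v; rewrite /= tlunitE linearZr_LR -linearZl_LR /= [_ *: _]mulr1.
Qed.

Lemma comod_runit_iso V : is_iso (comod_runit V : hom (tcomod V ucomod : comod_cat H) V).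
Proof.
apply: (@comod_iso _ _ (comod_runit V) (rtprod V (1 : k^o))) => x /=; last first.
  by rewrite trunitE scale1r.
move: x; apply: (tens_ext (f := rtprod V (1 : k^o) \o @trunit k V) (g := idfun)).
by move=> v c; rewrite /= trunitE linearZl_LR -linearZr_LR /= [_ *: _]mulr1.
Qed.

Definition comod_moncat : linMonCat k.
Proof.
refine (@LinMonCat k (comod_cat H) tcomod comod_tens ucomod
  comod_assoc comod_lunit comod_runit _ _ _ _
  comod_assoc_iso comod_lunit_iso comod_runit_iso _ _ _ _ _).
- by move=> V W; apply: comod_hom_ext => x; apply: tmap_id.
- by move=> *; apply: comod_hom_ext => x; apply: tmap_comp.
- move=> V V' W W' g a f f'; apply: comod_hom_ext; apply: tens_ext_lin => v w.
  by rewrite /= !tmapE /= linearPl.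
- move=> V V' W W' f a g g'; apply: comod_hom_ext; apply: tens_ext_lin => v w.
  by rewrite /= !tmapE /= linearPr.
- move=> U U' V V' W W' f g h; apply: comod_hom_ext; apply: tens_ext3l => u v w.
  by do 3!rewrite /= ?(tmapE, tassocE).
- move=> V V' f; apply: comod_hom_ext; apply: tens_ext => c v.
  by rewrite /= tmapE !tlunitE linearZ.
- move=> V V' f; apply: comod_hom_ext; apply: tens_ext => v c.
  by rewrite /= tmapE !trunitE linearZ.
- move=> U V W X; apply: comod_hom_ext; apply: tens_ext4l => u v w x.
  by do 3!rewrite /= ?(tmapE, tassocE).
- move=> V W; apply: comod_hom_ext; apply: tens_ext3l => v c w.
  by do 3!rewrite /= ?(tmapE, tassocE, tlunitE, trunitE); rewrite linearZl_LR linearZr_LR.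
Defined.

End TensorComodule.

Section Bimodules.
Variables (k : fieldType) (A : algType k).

Record bimod := Bimod {
  bimod_sort :> lmodType k;
  lact : {bilinear A -> bimod_sort -> bimod_sort};
  ract : {bilinear bimod_sort -> A -> bimod_sort};
  lact1 : forall m, lact 1 m = m;
  lactM : forall a b m, lact (a * b) m = lact a (lact b m);
  ract1 : forall m, ract m 1 = m;
  ractM : forall m a b, ract m (a * b) = ract (ract m a) b;
  lractA : forall a m b, ract (lact a m) b = lact a (ract m b)
}.

Record bimod_hom (M N : bimod) := BimodHom {
  bimod_lin :> {linear M -> N};
  bimod_homl : forall a m, bimod_lin (lact M a m) = lact N a (bimod_lin m);
  bimod_homr : forall m a, bimod_lin (ract M m a) = ract N (bimod_lin m) a
}.

Definition projective (P : bimod) : Prop :=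
  forall (M N : bimod) (p : bimod_hom M N) (f : bimod_hom P N),
    (forall n, exists m, p m = n) -> exists g : bimod_hom P M, p \o g =1 f.

Definition fin_gen (M : bimod) : Prop :=
  exists s : seq M, forall m : M, exists t : seq (A * M * A),
    (forall x, x \in t -> x.1.2 \in s) /\
    m = \sum_(x <- t) ract M (lact M x.1.1 x.1.2) x.2.

Record proj_resolution (M : bimod) := ProjResolution {
  res_mod :> nat -> bimod;
  res_d : forall i, bimod_hom (res_mod i.+1) (res_mod i);
  res_aug : bimod_hom (res_mod 0%N) M;
  res_proj : forall i, projective (res_mod i);
  res_aug_surj : forall m, exists x, res_aug x = m;
  res_exact0 : forall x, res_aug x = 0 <-> exists y, res_d 0%N y = x;
  res_exact : forall i x, res_d i x = 0 <-> exists y, res_d i.+1 y = x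
}.

Definition length_le (M : bimod) (P : proj_resolution M) (n : nat) : Prop :=
  forall i, (n < i)%N -> forall x : P i, x = 0.

Definition proj_dim_le (M : bimod) (n : nat) : Prop :=
  exists P : proj_resolution M, length_le P n.

(* None stands for infinity. *)
Definition proj_dim (M : bimod) : option nat :=
  match pselect (exists n, `[< proj_dim_le M n >]) with
  | left finite_dim => Some (ex_minn finite_dim)
  | right _ => None
  end.

Definition regular_bimod : bimod.
Proof.
refine (@Bimod A (mk_bilinear (amul_bilinear A)) (mk_bilinear (amul_bilinear A))
  _ _ _ _ _) => /=.
- exact: mul1r.
- by move=> a b m; rewrite mulrA.
- exact: mulr1.
- exact: mulrA.
- by move=> a m b; rewrite mulrA.
Defined.

Definition cd : option nat := proj_dim regular_bimod.

Definition smooth : Prop :=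
  exists P : proj_resolution regular_bimod,
    (exists n, length_le P n) /\ forall i, fin_gen (P i).

End Bimodules.

(* Main.v *)
(* Write L(V) for the Yetter-Drinfeld module freely generated by a comodule V
   and C(N) for the one cofreely cogenerated by a module N.  A Yetter-Drinfeld
   structure on a comodule is the same as a half-braiding in the category of
   comodules, so a monoidal equivalence of comodule categories extends to the
   Yetter-Drinfeld modules, and it preserves the bar resolution
   ... -> L(L(k)) -> L(k) -> k up to relatively projective resolutions, i.e. those
   split by colinear maps.  Tensoring such a resolution with the Hopf algebra H
   yields a projective resolution of the bimodule H, which computes cd(H).

   If cd(A) <= n, the cocycles of degree m > n on this resolution with values in
   any A-module, hence in any C(N), are coboundaries.  When the antipode is
   bijective, L(W (x) H) and C(W (x) H) are isomorphic for every vector space W;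
   consequently C(W (x) B) is relatively projective with injective underlying
   comodule, properties which pass to its image Q over A, and conversely they
   make Q a retract of C(Q (x) A).  So the cocycles over B with values in free
   modules are coboundaries in degrees m > n.  Since B has a finite projective
   resolution, that resolution can then be truncated at n, whence cd(B) <= n. *)

Require Import Defs.
From HB Require Import structures.
From mathcomp Require Import all_boot all_algebra sesquilinear boolp classical_sets.
(* The name hom of Defs is shadowed by the one of mathcomp's vector. *)
Import Defs.

Set Implicit Arguments.
Unset Strict Implicit.
Unset Printing Implicit Defensive.

Import GRing.Theory.
Local Open Scope ring_scope.

(** * Multilinear maps on tensor products *)

(** A monoidal equivalence that ignores the forgetful functors sees neither modules nor underlying
    vector spaces, so Ext groups cannot be carried across as they stand. Everything transported is
    therefore phrased with Yetter-Drinfeld modules, their morphisms and colinear maps alone; even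
    injectivity of a map has to be re-expressed, through kernels. The image Q has no reason to be of
    the form C(N). Its embedding into C(Q) splits colinearly only; applying L turns this splitting
    into one of Yetter-Drinfeld modules L(Q) -> L(Q (x) A) -> L(Q), and L(Q (x) A) = C(Q (x) A)
    leads back to the cofree side. That isomorphism conjugates by S^2 and S^(-1), which is where the
    inverse of the antipode enters. Relative projectivity of C(N) is available for free N, so the
    coefficients that can be transported are the free modules. They suffice for the truncation
    because a projective bimodule, with its adjoint action, is a retract of a free module: the terms
    of the finite resolution serve as coefficients, and its differentials are split one by one,
    descending from the top degree. *)

Section Linearity.
Variable k : fieldType.
Implicit Types U V W X : lmodType k.

(** Linearity as a property of bare functions: Sweedler sums are nested lambda terms whose linearity
    in each variable is checked by descent through the term ([lin_tac]) and bundled only when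
    needed. *)
Definition lin U V (f : U -> V) : Prop :=
  forall c u v, f (c *: u + v) = c *: f u + f v.

Definition bil U V W (f : U -> V -> W) : Prop :=
  (forall v, lin (fun u => f u v)) /\ (forall u, lin (f u)).

Definition mk_linear U V (f : U -> V) (f_lin : lin f) : {linear U -> V} :=
  HB.pack f (GRing.isLinear.Build k U V *:%R f f_lin).

Lemma mk_linearE U V (f : U -> V) (f_lin : lin f) x : mk_linear f_lin x = f x.
Proof. by []. Qed.

Lemma linZ U V (f : U -> V) c x : lin f -> f (c *: x) = c *: f x.
Proof. by move=> fl; rewrite -[f]/(mk_linear fl : U -> V) linearZ. Qed.

Lemma bil_bilinear_for U V W (f : U -> V -> W) :
  bil f -> bilinear_for *:%R *:%R f.
Proof. by case=> fl fr; split=> [v c x y|u c x y] /=; rewrite ?fl ?fr. Qed.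

Definition mk_bil U V W (f : U -> V -> W) (f_bil : bil f) : {bilinear U -> V -> W} :=
  mk_bilinear (bil_bilinear_for f_bil).

Lemma lin_id U : lin (fun x : U => x).
Proof. by []. Qed.

Lemma lin_app U V W (g : {linear V -> W}) (f : U -> V) :
  lin f -> lin (fun x => g (f x)).
Proof. by move=> fl c x y; rewrite fl linearP. Qed.

Lemma lin_comp U V W (g : V -> W) (f : U -> V) :
  lin g -> lin f -> lin (fun x => g (f x)).
Proof. by move=> gl fl c x y; rewrite fl gl. Qed.

Lemma lin_bilinl U V W X (b : {bilinear V -> W -> X}) (f : U -> V) w :
  lin f -> lin (fun x => b (f x) w).
Proof. by move=> fl c x y; rewrite fl linearPl. Qed.

Lemma lin_bilinr U V W X (b : {bilinear V -> W -> X}) (f : U -> W) v :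
  lin f -> lin (fun x => b v (f x)).
Proof. by move=> fl c x y; rewrite fl linearPr. Qed.

Lemma lin_tprodl U V W (f : U -> V) (w : W) : lin f -> lin (fun x => f x \ot w).
Proof. by move=> fl c x y; rewrite fl linearPl. Qed.

Lemma lin_tprodr U V W (f : U -> W) (v : V) : lin f -> lin (fun x => v \ot f x).
Proof. by move=> fl c x y; rewrite fl linearPr. Qed.

Lemma lin_mull U (A : algType k) (f : U -> A) (a : A) : lin f -> lin (fun x => f x * a).
Proof. by move=> fl c x y; rewrite fl mulrDl scalerAl. Qed.

Lemma lin_mulr U (A : algType k) (f : U -> A) (a : A) : lin f -> lin (fun x => a * f x).
Proof. by move=> fl c x y; rewrite fl mulrDr scalerAr. Qed.

Lemma lin_scaler U V (f : U -> V) (a : k) : lin f -> lin (fun x => a *: f x).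
Proof. by move=> fl c x y; rewrite fl scalerDr !scalerA mulrC. Qed.

Lemma lin_scalel U V (f : U -> k^o) (v : V) : lin f -> lin (fun x => (f x : k) *: v).
Proof. by move=> fl c x y; rewrite fl scalerDl -scalerA. Qed.

Lemma lin_add U V (f g : U -> V) : lin f -> lin g -> lin (fun x => f x + g x).
Proof. by move=> fl gl c x y; rewrite fl gl scalerDr addrACA. Qed.

Lemma lin_opp U V (f : U -> V) : lin f -> lin (fun x => - f x).
Proof. by move=> fl c x y; rewrite fl opprD scalerN. Qed.

Lemma tens_repr V W (x : V \ox W) : x = \sum_(p <- repr x) p.1 \ot p.2.
Proof.
apply: tlift_inj => U f; rewrite linear_sum /= {1}/tlift /tens_sum.
by apply: eq_bigr => p _; rewrite tlift_tprod.
Qed.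

Lemma tliftE U V W (f : V -> W -> U) v w : bil f -> tlift f (v \ot w) = f v w.
Proof. by move=> fb; apply: (tlift_tprod (mk_bil fb)). Qed.

Lemma tliftP U V W (f : V -> W -> U) : bil f -> lin (tlift f).
Proof. by move=> fb; apply: (tlift_is_linear (mk_bil fb)). Qed.

Lemma eq_tlift U V W (f g : V -> W -> U) x :
  (forall v w, f v w = g v w) -> tlift f x = tlift g x.
Proof. by move=> fg; apply: eq_bigr => p _; rewrite fg. Qed.

Lemma lin_tlift_arg U V W X (f : V -> W -> U) (g : X -> V \ox W) :
  bil f -> lin g -> lin (fun x => tlift f (g x)).
Proof. by move=> fb gl; apply: lin_comp gl; apply: tliftP. Qed.

Lemma lin_tlift_body U V W X (f : X -> V -> W -> U) (t : V \ox W) :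
  (forall v w, lin (fun x => f x v w)) -> lin (fun x => tlift (f x) t).
Proof.
move=> fl c x y; rewrite /tlift /tens_sum scaler_sumr -big_split.
by apply: eq_bigr => p _; rewrite fl.
Qed.

Lemma lin_sum U V (f : U -> V) I (r : seq I) (F : I -> U) :
  lin f -> f (\sum_(i <- r) F i) = \sum_(i <- r) f (F i).
Proof. by move=> fl; rewrite -(mk_linearE fl) linear_sum. Qed.

Lemma lin_tlift U U' V W (g : U -> U') (f : V -> W -> U) x :
  lin g -> g (tlift f x) = tlift (fun v w => g (f v w)) x.
Proof. by move=> gl; rewrite /tlift /tens_sum lin_sum. Qed.

Lemma tlift_eta V W (x : V \ox W) : x = tlift (fun v w => v \ot w) x.
Proof. exact: tens_repr. Qed.

Lemma lin_tensE V W U (g : V \ox W -> U) x : lin g -> g x = tlift (fun v w => g (v \ot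
    w)) x.
Proof. by move=> gl; rewrite {1}[x]tlift_eta lin_tlift. Qed.

Lemma tens_lin_ext V W U (f g : V \ox W -> U) : lin f -> lin g ->
  (forall v w, f (v \ot w) = g (v \ot w)) -> f =1 g.
Proof. by move=> fl gl fg x; rewrite lin_tensE // [RHS]lin_tensE //; apply: eq_tlift. Qed.

(** [tlift] is a finite sum over a chosen representative of the tensor, so this is the exchange of
    two finite sums. *)
Lemma tlift_exchange U V W V' W' (f : V -> W -> V' -> W' -> U) x y :
  tlift (fun v w => tlift (fun v' w' => f v w v' w') y) x =
  tlift (fun v' w' => tlift (fun v w => f v w v' w') x) y.
Proof. exact: exchange_big. Qed.

End Linearity.

Ltac lin1 :=
  first [ assumption | exact: lin_id
  | match goal with
    | |- bil _ => split=> ? /=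
    | |- forall _, _ => move=> ? /=
    end
  | eapply lin_app | eapply lin_tprodl | eapply lin_tprodr
  | eapply lin_mull | eapply lin_mulr | eapply lin_bilinl | eapply lin_bilinr
  | eapply lin_tlift_body | eapply lin_tlift_arg
  | eapply lin_scaler | eapply lin_scalel | eapply lin_add | eapply lin_opp ].
Ltac lin_tac := repeat lin1.

Section Tlift.
Variable k : fieldType.
Implicit Types U V W X : lmodType k.

Lemma tmap_tlift V W V' W' (g : {linear V -> V'}) (h : {linear W -> W'}) x :
  tmap g h x = tlift (fun v w => g v \ot h w) x.
Proof. by rewrite [RHS]/tlift /tens_sum {1}[x]tens_repr linear_sum; apply: eq_bigr => p
    _; rewrite /= tmapE. Qed.

Lemma tinter_tlift U V W X (x : U \ox V) (y : W \ox X) :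
  tinter (x \ot y) = tlift (fun u v => tlift (fun w z => (u \ot w) \ot (v \ot z)) y) x.
Proof.
rewrite (@lin_tensE _ _ _ _ (fun x => tinter (x \ot y))); last by lin_tac.
apply: eq_tlift => u v; rewrite (@lin_tensE _ _ _ _ (fun y => tinter (_ \ot y))).
  by apply: eq_tlift => w z; rewrite tinterE.
by lin_tac.
Qed.

End Tlift.

(** * Linear algebra over a field *)

Section GeneralizedInverse.
Variables (k : fieldType) (V W : lmodType k) (f : {linear V -> W}).

(** Graphs of linear maps from a subspace of W to V that choose a preimage under [f] of every
    argument lying in the image of [f]. As relations they are closed under unions of nonempty
    chains. *)
Let rel_ok (G : set (W * V)) : Prop :=
  [/\ G (0, 0),
      forall c w v w' v', G (w, v) -> G (w', v') -> G (c *: w + w', c *: v + v'),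
      forall v, G (0, v) -> v = 0 &
      forall w v, G (w, v) -> (exists v', f v' = w) -> f v = w].

Let ok (G : set (W * V)) : Prop := G = set0 \/ rel_ok G.

Lemma rel_ok_total : exists2 G : set (W * V), rel_ok G & forall w, exists v, G (w, v).
Proof.
have okT F : (F `<=` ok)%classic -> total_on F subset -> ok (\bigcup_(X in F) X)%classic.
  move=> Fok Ftot.
  have [[G0 FG0 nG0]|noG] := pselect (exists2 G, F G & G (0, 0)); last first.
    left; rewrite -subset0 => p [G FG Gp]; have [G0|[G00 _ _ _]] := Fok _ FG.
      by rewrite -G0.
    by case: noG; exists G.
  have okF G p : F G -> G p -> rel_ok G.
    by move=> FG Gp; have [G0'|//] := Fok _ FG; move: Gp; rewrite G0'.
  right; split.
  - by exists G0.
  - move=> c w v w' v' [G FG Gp] [G' FG' Gp'].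
    have [GG'|G'G] := Ftot _ _ FG FG'.
      by exists G' => //; have [_ lG _ _] := okF _ _ FG' Gp'; apply: lG => //; apply: GG'.
    by exists G => //; have [_ lG _ _] := okF _ _ FG Gp; apply: lG => //; apply: G'G.
  - by move=> v [G FG Gp]; have [_ _ + _] := okF _ _ FG Gp; apply.
  - by move=> w v [G FG Gp]; have [_ _ _] := okF _ _ FG Gp; apply.
have [G [Gok Gmax]] := Zorn_bigcup okT.
have ok0 : rel_ok [set (0, 0)]%classic.
  split=> //=.
  - by move=> c w v w' v' [-> ->] [-> ->]; rewrite !scaler0 !addr0.
  - by move=> v [].
  - by move=> w v [-> ->] _; rewrite linear0.
case: Gok => [G0|Grel].
  case: (Gmax [set (0, 0)]%classic); last by right.
  by rewrite G0; split=> [p []|/(_ (0, 0) erefl)].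
exists G => // y0; apply: contrapT => y0G.
have [G00 Glin Gs Gf] := Grel.
have Gopp w v : G (w, v) -> G (- w, - v).
  by move=> /(Glin (-1) _ _ _ _)/(_ G00); rewrite !scaleN1r !addr0.
have GD w v w' v' : G (w, v) -> G (w', v') -> G (w + w', v + v').
  by move=> Gp Gp'; have := Glin 1 _ _ _ _ Gp Gp'; rewrite !scale1r.
have GZ c w v : G (w, v) -> G (c *: w, c *: v).
  by move=> Gp; have := Glin c _ _ _ _ Gp G00; rewrite !addr0.
(* The value at y0 is forced as soon as y0 is congruent to an element of the
   image of f modulo the domain of G; otherwise any value is admissible. *)
have [x0 x0P] : exists x0, forall y x z, G (y, x) -> f z = y + y0 -> f (x + x0) = y + y0.
  have [[y [x [z [Gyx fz]]]]|none] :=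
    pselect (exists y x z, G (y, x) /\ f z = y + y0); last first.
    by exists 0 => y x z Gyx fz; case: none; exists y, x, z.
  exists (z - x) => y' x' z' Gyx' fz'.
  have -> : x' + (z - x) = (x' - x) + z by rewrite addrCA addrC.
  rewrite linearD /= fz (Gf _ _ (GD _ _ _ _ Gyx' (Gopp _ _ Gyx))) ?addrA ?subrK//.
  by exists (z' - z); rewrite linearB /= fz fz' opprD addrACA subrr addr0.
pose G' : set (W * V) := [set p | exists c y x, G (y, x) /\ p = (y + c *: y0, x + c *:
    x0)]%classic.
case: (Gmax G'); last first.
  right; split.
  - by exists 0, 0, 0; rewrite !scale0r !addr0.
  - move=> c w v w' v' [d [y [x [Gyx [-> ->]]]]] [d' [y' [x' [Gyx' [-> ->]]]]].
    exists (c * d + d'), (c *: y + y'), (c *: x + x'); split; first exact: Glin.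
    by congr pair; rewrite scalerDr scalerDl -scalerA addrACA.
  - move=> v [d [y [x [Gyx [/esym/eqP]]]]]; rewrite addrC addr_eq0 => /eqP dy ->.
    have [d0|dn0] := eqVneq d 0.
      move: dy Gyx; rewrite d0 scale0r => /esym/eqP; rewrite oppr_eq0 => /eqP -> /Gs ->.
      by rewrite scale0r addr0.
    case: y0G; exists (- d^-1 *: x).
    have -> : y0 = - d^-1 *: y by rewrite scaleNr -scalerN -dy scalerA mulVf ?scale1r.
    exact: GZ.
  - move=> w v [d [y [x [Gyx [-> ->]]]]] [v'].
    have [->|dn0] := eqVneq d 0.
      by rewrite !scale0r !addr0 => fv'; apply: Gf Gyx _; exists v'.
    move=> fv'; have := x0P (d^-1 *: y) (d^-1 *: x) (d^-1 *: v') (GZ _ _ _ Gyx).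
    have dK : d^-1 *: (d *: y0) = y0 by rewrite scalerA mulVf ?scale1r.
    rewrite linearZ /= fv' scalerDr dK => /(_ erefl) /(congr1 ( *:%R d)).
    rewrite -linearZ /= !scalerDr !scalerA mulfV // !scale1r; apply.
split; first by move=> [y x] Gp; exists 0, y, x; rewrite !scale0r !addr0.
move=> /(_ (y0, x0)) Gp; apply: y0G; exists x0; apply: Gp.
by exists 1, 0, 0; rewrite !scale1r !add0r.
Qed.

(** One statement, in any dimension, for three later uses: a linear section of a surjection, a
    linear retraction of an injection, and the projection 1 - g f onto a kernel. *)
Lemma generalized_inverse : exists g : {linear W -> V}, forall v, f (g (f v)) = f v.
Proof.
have [G [G00 Glin Gs Gf] Gtot] := rel_ok_total.
have [g gP] := choice Gtot.
have Gfun w v v' : G (w, v) -> G (w, v') -> v = v'.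
  move=> Gv Gv'; have := Glin (-1) _ _ _ _ Gv Gv'.
  by rewrite !scaleN1r addNr => /Gs/eqP; rewrite addrC subr_eq0 => /eqP.
have glin : lin g by move=> c u v; apply: Gfun (gP _) _; apply: Glin.
by exists (mk_linear glin) => v; apply: Gf (gP _) _; exists v.
Qed.

End GeneralizedInverse.

Section Kernel.
Variables (k : fieldType) (V W : lmodType k) (f : {linear V -> W}).

Definition in_ker : pred V := fun v => f v == 0.

Lemma ker_submod_closed : submod_closed in_ker.
Proof.
split; first by rewrite unfold_in /in_ker linear0.
move=> c u v; rewrite !unfold_in /in_ker => /eqP u0 /eqP v0.
by rewrite linearP u0 v0 scaler0 addr0.
Qed.

HB.instance Definition _ := GRing.isSubmodClosed.Build k V in_ker ker_submod_closed.

Record ker : Type := Ker { ker_val : V; _ : in_ker ker_val }.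
HB.instance Definition _ := [isSub for ker_val].
HB.instance Definition _ := [Choice of ker by <:].
HB.instance Definition _ := [SubChoice_isSubLmodule of ker by <:].

Lemma ker_valP (x : ker) : f (val x) = 0.
Proof. by case: x => v /= /eqP. Qed.

Definition ker_in v (v0 : f v = 0) : ker := Ker (introT eqP v0).

Lemma ker_val_lin : lin (fun x : ker => val x).
Proof. by []. Qed.

Definition ker_incl : {linear ker -> V} := mk_linear ker_val_lin.

Lemma ker_ext (x y : ker) : ker_incl x = ker_incl y -> x = y.
Proof. exact: val_inj. Qed.

Lemma ker_lift_lin (U : lmodType k) (g : {linear U -> V}) (g0 : forall u, f (g u) = 0) :
  lin (fun u => ker_in (g0 u)).
Proof. by move=> c u v; apply: ker_ext; rewrite [RHS]linearP; apply: linearP. Qed.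

End Kernel.

(** * Projective resolutions of bimodules *)

(** Dependent choice with an invariant [good], which guarantees that each term has a successor.
    Chain maps and homotopies are built with it degree by degree. *)
Lemma dependent_sequence (T : nat -> Type) (good : forall i, T i -> Prop)
    (next : forall i, T i -> T i.+1 -> Prop) :
  (exists a, good 0 a) ->
  (forall i a, good i a -> exists2 b, good i.+1 b & next i a b) ->
  exists a : forall i, T i, forall i, good i (a i) /\ next i (a i) (a i.+1).
Proof.
move=> [a0 a0P] step.
have {}step i (a : {a : T i | good i a}) :
    exists b : {b : T i.+1 | good i.+1 b}, next i (sval a) (sval b).
  by have [b bP ab] := step i _ (svalP a); exists (exist _ b bP).
pose stepf i a := cid (step i a).
pose s := fix s i : {a : T i | good i a} :=
  match i with 0 => exist _ a0 a0P | j.+1 => sval (stepf j (s j)) end.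
exists (fun i => sval (s i)) => i; split; first exact: svalP.
exact: svalP (stepf i (s i)).
Qed.

Section BimodHoms.
Variables (k : fieldType) (A : algType k).
Implicit Types M N P Q : bimod A.

Definition bid M : bimod_hom M M.
Proof. by exists idfun. Defined.

Definition bzero M N : bimod_hom M N.
Proof.
exists (mk_linear (fun c (u v : M) => esym (etrans (addr0 _) (scaler0 N c)))).
- by move=> a m; rewrite !mk_linearE linear0r.
- by move=> a m; rewrite !mk_linearE linear0l.
Defined.

Definition bcomp M N P (g : bimod_hom N P) (f : bimod_hom M N) : bimod_hom M P.
Proof.
exists (mk_linear (lin_app g (lin_app f (@lin_id k M)))).
- by move=> a m; rewrite !mk_linearE !bimod_homl.
- by move=> a m; rewrite !mk_linearE !bimod_homr.
Defined.

Definition badd M N (f g : bimod_hom M N) : bimod_hom M N.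
Proof.
exists (mk_linear (lin_add (lin_app f (@lin_id k M)) (lin_app g (@lin_id k M)))).
- by move=> a m; rewrite !mk_linearE !bimod_homl linearDr.
- by move=> a m; rewrite !mk_linearE !bimod_homr linearDl.
Defined.

Definition bsub M N (f g : bimod_hom M N) : bimod_hom M N.
Proof.
exists (mk_linear (lin_add (lin_app f (@lin_id k M)) (lin_opp (lin_app g (@lin_id k
    M))))).
- by move=> a m; rewrite !mk_linearE !bimod_homl linearDr linearNr.
- by move=> a m; rewrite !mk_linearE !bimod_homr linearDl linearNl.
Defined.

Section Kernel.
Variables (M N : bimod A) (f : bimod_hom M N).

Lemma bker_lactP a (x : ker f) : f (lact M a (val x)) = 0.
Proof. by rewrite bimod_homl ker_valP linear0r. Qed.
Lemma bker_ractP a (x : ker f) : f (ract M (val x) a) = 0.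
Proof. by rewrite bimod_homr ker_valP linear0l. Qed.

Lemma bker_lact_bil : bil (fun a x => ker_in (bker_lactP a x)).
Proof.
by split=> [x|a] c u v; apply: ker_ext; rewrite [RHS]linearP /= (linearPl, linearPr).
Qed.
Lemma bker_ract_bil : bil (fun x a => ker_in (bker_ractP a x)).
Proof.
by split=> [x|a] c u v; apply: ker_ext; rewrite [RHS]linearP /= (linearPl, linearPr).
Qed.

Definition bker : bimod A.
Proof.
refine (@Bimod k A (ker f) (mk_bil bker_lact_bil) (mk_bil bker_ract_bil) _ _ _ _ _).
- by move=> m; apply: ker_ext; apply: lact1.
- by move=> a b m; apply: ker_ext; apply: lactM.
- by move=> m; apply: ker_ext; apply: ract1.
- by move=> m a b; apply: ker_ext; apply: ractM.
- by move=> a m b; apply: ker_ext; apply: lractA.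
Defined.

Definition bker_incl : bimod_hom bker M.
Proof. by exists (ker_incl f). Defined.

Definition bker_lift P (g : bimod_hom P M) (g0 : forall x, f (g x) = 0) : bimod_hom P
    bker.
Proof.
exists (mk_linear (ker_lift_lin g0)).
- by move=> a m; apply: ker_ext; apply: bimod_homl.
- by move=> m a; apply: ker_ext; apply: bimod_homr.
Defined.

End Kernel.

Lemma projective_lift P X Y Z (d1 : bimod_hom X Y) (d0 : bimod_hom Y Z) (g : bimod_hom P
    Y) :
  projective P -> (forall y, d0 y = 0 <-> exists x, d1 x = y) ->
  (forall x, d0 (g x) = 0) -> exists h : bimod_hom P X, forall x, d1 (h x) = g x.
Proof.
move=> projP ex g0.
have d10 x : d0 (d1 x) = 0 by apply/ex; exists x.
have [n|h hP] := projP _ _ (bker_lift d10) (bker_lift g0).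
  have /ex[x dx] := ker_valP n.
  by exists x; apply: ker_ext.
by exists h => x; have /(congr1 (@ker_incl _ _ _ d0)) := hP x.
Qed.

Lemma projective_retract P Q (i : bimod_hom P Q) (r : bimod_hom Q P) :
  cancel i r -> projective Q -> projective P.
Proof.
move=> irK projQ M N p f psurj.
have [g gP] := projQ _ _ p (bcomp f r) psurj.
by exists (bcomp g i) => x; have := gP (i x); rewrite /= irK.
Qed.

Section Cycles.
Variables (M : bimod A) (P : proj_resolution M).

(** The augmentation takes the part of the differential leaving degree 0, so that exactness reads
    the same in every degree ([cycleE]). *)
Definition cycle i : P i -> Prop :=
  match i return P i -> Prop with
  | 0 => fun x => res_aug P x = 0
  | j.+1 => fun x => res_d P j x = 0
  end.

Lemma cycleE i (x : P i) : cycle x <-> exists y, res_d P i y = x.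
Proof. by case: i x => [|i] x; [apply: res_exact0 | apply: res_exact]. Qed.

Lemma cycle_d i (x : P i.+1) : cycle (res_d P i x).
Proof. by apply/cycleE; exists x. Qed.

Lemma res_dd i (x : P i.+2) : res_d P i (res_d P i.+1 x) = 0.
Proof. exact: (cycle_d x). Qed.

Lemma lift_cycle Q i (g : bimod_hom Q (P i)) : projective Q ->
  (forall x, cycle (g x)) -> exists h : bimod_hom Q (P i.+1), forall x, res_d P i (h x) =
      g x.
Proof.
case: i g => [|i] g projQ gP.
  exact: (projective_lift projQ (@res_exact0 _ _ _ P) gP).
exact: (projective_lift projQ (@res_exact _ _ _ P i) gP).
Qed.

End Cycles.

Lemma lift_resolution M (P Q : proj_resolution M) :
  exists f : forall i, bimod_hom (P i) (Q i),
    (forall x, res_aug Q (f 0%N x) = res_aug P x) /\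
    forall i x, res_d Q i (f i.+1 x) = f i (res_d P i x).
Proof.
have [f0 f0P] := @res_proj _ _ _ P 0%N _ _ (res_aug Q) (res_aug P) (@res_aug_surj _ _ _
    Q).
(* Preservation of cycles is what makes the next lift possible. In degree 0 it follows from
   compatibility with the augmentations, which is recorded as well because the conclusion asks for
   it. *)
pose good i (f : bimod_hom (P i) (Q i)) :=
  (forall x, cycle x -> cycle (f x)) /\
  match i return bimod_hom (P i) (Q i) -> Prop with
  | 0 => fun f => forall x, res_aug Q (f x) = res_aug P x | _ => fun _ => True
  end f.
have [||f fP] := @dependent_sequence (fun i => bimod_hom (P i) (Q i)) good
    (fun i f g => forall x, res_d Q i (g x) = f (res_d P i x)).
- by exists f0; split=> // x /=; have := f0P x => /= ->.
- move=> i f [fc _].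
  have [x|g gP] := @lift_cycle _ Q _ i (bcomp f (res_d P i)) (@res_proj _ _ _ P i.+1).
    by apply: fc; apply: cycle_d.
  exists g => //; split=> // x /= x0; rewrite /cycle gP /=.
  by rewrite (_ : res_d P i x = 0) ?linear0.
by exists f; split=> [|i x]; [case: (fP 0%N) => -[] | case: (fP i)].
Qed.

(** The recursion keeps the identity d s = t on cycles. It makes t - s d cycle-valued in the next
    degree, where it lifts to the new s; the homotopy identity then restores the invariant. The
    conclusion is recorded in positive degrees, where the cocycles below live. *)
Lemma null_homotopy M (P : proj_resolution M) (t : forall i, bimod_hom (P i) (P i)) :
  (forall x, res_aug P (t 0%N x) = 0) ->
  (forall i x, res_d P i (t i.+1 x) = t i (res_d P i x)) ->
  exists s : forall i, bimod_hom (P i) (P i.+1),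
    forall i x, t i.+1 x = res_d P i.+1 (s i.+1 x) + s i (res_d P i x).
Proof.
move=> t0 td.
have [||s sP] := @dependent_sequence (fun i => bimod_hom (P i) (P i.+1))
  (fun i s => forall x, cycle x -> res_d P i (s x) = t i x)
  (fun i s s' => forall x, t i.+1 x = res_d P i.+1 (s' x) + s (res_d P i x)).
- have [//|s sP] := @lift_cycle _ P _ 0%N (t 0%N) (@res_proj _ _ _ P 0%N).
  by exists s => x _; apply: sP.
- move=> i s sP.
  have [x|s' s'P] := @lift_cycle _ P _ i.+1 (bsub (t i.+1) (bcomp s (res_d P i)))
    (@res_proj _ _ _ P i.+1).
    by rewrite /= linearB /= td sP ?subrr //; apply: cycle_d.
  exists s' => x; last by rewrite s'P /= subrK.
  by move=> /= x0; rewrite s'P /= x0 linear0 subr0.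
by exists s => i; case: (sP i).
Qed.

(** Vanishing of Ext^(m+1)(M, N) computed on [P]: the index [m] is that of the cochain sought, one
    less than that of the cocycle. *)
Definition coboundaries_at M (P : proj_resolution M) (N : bimod A) (m : nat) : Prop :=
  forall f : bimod_hom (P m.+1) N, (forall x, f (res_d P m.+1 x) = 0) ->
  exists g : bimod_hom (P m) N, forall x, f x = g (res_d P m x).

(** With comparison maps a and b and a homotopy s for 1 - b a, a cocycle f splits as f b a + f s d.
    The first summand is a coboundary because f b is one on [Q]. *)
Lemma coboundaries_at_indep M (P Q : proj_resolution M) N m :
  coboundaries_at Q N m -> coboundaries_at P N m.
Proof.
move=> cobQ f f0.
have [a [a0 ad]] := lift_resolution P Q; have [b [b0 bd]] := lift_resolution Q P.
have [||s sP] := @null_homotopy _ P (fun i => bsub (bid (P i)) (bcomp (b i) (a i))).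
- by move=> x; rewrite /= linearB /= b0 a0 subrr.
- by move=> i x; rewrite /= linearB /= bd ad.
have [x|g gP] := cobQ (bcomp f (b m.+1)); first by rewrite /= -bd f0.
exists (badd (bcomp g (a m)) (bcomp f (s m))) => x; rewrite /= -ad -[g _]gP /=.
have := congr1 f (sP m x); rewrite /= linearB linearD /= f0 add0r => <-.
by rewrite addrC subrK.
Qed.

Lemma coboundaries_above_length M (P Q : proj_resolution M) N n m :
  length_le Q n -> (n <= m)%N -> coboundaries_at P N m.
Proof.
move=> Qn nm; apply: (@coboundaries_at_indep _ _ Q) => f _.
by exists (bzero _ _) => x; rewrite (Qn m.+1 _ x) // linear0.
Qed.

(** * Truncation of a finite projective resolution *)

Section Truncation.
Variables (M : bimod A) (P : proj_resolution M) (r n : nat).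
Hypothesis Pr : length_le P r.
Hypothesis Pn : forall m, (n <= m)%N -> coboundaries_at P (P m.+1) m.

(** Descending induction on m, from the length [r] above which [P] vanishes. If d u d = d in degree
    m + 1, then 1 - d u is a cocycle with values in [P m.+1], hence of the form g d, and d g d = d
    (1 - d u) = d. *)
Lemma differential_inverse m : (n <= m)%N ->
  exists u : bimod_hom (P m) (P m.+1), forall x, res_d P m (u (res_d P m x)) = res_d P m
      x.
Proof.
move=> nm; have [j] : exists j, (r <= m + j)%N by exists r; rewrite leq_addl.
elim: j m nm => [|j IHj] m nm rm.
  exists (bzero _ _) => x; rewrite (_ : x = 0) ?linear0 //.
  by apply: Pr; rewrite ltnS -[m]addn0.
have [||u uP] := IHj m.+1; [exact: leqW | by rewrite addSnnS |].
have [x|g gP] := @Pn m nm (bsub (bid _) (bcomp (res_d P m.+1) u)).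
  by rewrite /= uP subrr.
by exists g => x; rewrite -gP /= linearB /= res_dd subr0.
Qed.

Lemma truncation : proj_dim_le M n.
Proof.
have [u0 u0P] := differential_inverse (leqnn n).
(* A family over all degrees, unconstrained away from n, so that the idempotents below are given by
   one formula. *)
have [u uP] : exists u : forall i, bimod_hom (P i) (P i.+1),
    forall x, res_d P n (u n (res_d P n x)) = res_d P n x.
  have ex i : exists v : bimod_hom (P i) (P i.+1),
      i = n -> forall x, res_d P i (v (res_d P i x)) = res_d P i x.
    have [->|ni] := pselect (i = n); last by exists (bzero _ _).
    by exists u0.
  have uP i := svalP (cid (ex i)).
  by exists (fun i => sval (cid (ex i))); apply: uP.
(* Idempotents whose images form the truncated resolution: the identity below
   degree n, a projection with kernel im d in degree n, and 0 above. *)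
pose e i : bimod_hom (P i) (P i) :=
  if (i < n)%N then bid _ else
  if i == n then bsub (bid _) (bcomp (res_d P i) (u i)) else bzero _ _.
have e_lt i x : (i < n)%N -> e i x = x by rewrite /e => ->.
have e_gt i x : (n < i)%N -> e i x = 0.
  by move=> ni; rewrite /e ltnNge (ltnW ni) /= gtn_eqF.
have e_n x : e n x = x - res_d P n (u n x) by rewrite /e ltnn eqxx.
have e_nd x : e n (res_d P n x) = 0 by rewrite e_n uP subrr.
have ee i x : e i (e i x) = e i x.
  have [ni|ni|ni] := ltngtP i n; first by rewrite !e_lt.
    by rewrite [LHS]e_gt // e_gt.
  by subst i; rewrite {1}(e_n x) linearB /= e_nd subr0.
have d_e i x : res_d P i (e i.+1 x) = if (i < n)%N then res_d P i x else 0.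
  case: ifP => ni; last by rewrite e_gt ?linear0 // ltnS leqNgt ni.
  move: ni; rewrite leq_eqVlt => /orP[/eqP ni|ni]; last by rewrite e_lt.
  have [lt_ni eq_ni] : (i.+1 < n)%N = false /\ (i.+1 == n) by rewrite ni ltnn.
  by rewrite /e lt_ni eq_ni /= linearB /= res_dd subr0.
(* The image of the idempotent [e i], realised as the kernel of 1 - [e i]; it is a retract of [P i],
   hence projective. *)
pose Q i := bker (bsub (bid _) (e i)).
pose incl i : bimod_hom (Q i) (P i) := bker_incl _.
have Qe i (x : Q i) : e i (incl i x) = incl i x.
  by have /eqP := ker_valP x; rewrite /= subr_eq0 => /eqP.
have e_ker i x : bsub (bid _) (e i) (e i x) = 0 by rewrite /= ee subrr.
pose proj i : bimod_hom (P i) (Q i) := bker_lift (e_ker i).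
have projE i x : incl i (proj i x) = e i x by [].
have inclK i : cancel (incl i) (proj i) by move=> x; apply: ker_ext; apply: Qe.
have incl_inj i (x y : Q i) : incl i x = incl i y -> x = y by apply: ker_ext.
pose d i : bimod_hom (Q i.+1) (Q i) := bcomp (proj i) (bcomp (res_d P i) (incl i.+1)).
have dE i (x : Q i.+1) : incl i (d i x) = res_d P i (incl i.+1 x).
  have -> : incl i (d i x) = e i (res_d P i (incl i.+1 x)) by [].
  rewrite -(Qe i.+1 x) d_e; case: ifP => [ni|_].
    by rewrite e_lt.
  by rewrite linear0.
have Q0 i (x : Q i) : (n < i)%N -> x = 0.
  by move=> ni; apply: incl_inj; rewrite -Qe e_gt ?linear0.
have exQ i (x : Q i) : @cycle _ P i (incl i x) <-> exists y, d i y = x.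
  split=> [/cycleE[y yx]|[y <-]]; last by rewrite dE; apply: cycle_d.
  have [ni|ni|ni] := ltngtP i n.
  - exists (proj i.+1 y); apply: incl_inj; rewrite dE projE.
    by rewrite d_e ni.
  - by exists 0; rewrite linear0 [RHS]Q0.
  (* In degree n a cycle of [P] is a boundary, and [e n] kills boundaries: the truncated complex has
     no nonzero cycle there. *)
  - exists 0; apply: incl_inj; rewrite !linear0; apply/esym.
    by rewrite -Qe -yx; subst i; rewrite e_nd.
unshelve eexists.
  apply: (@ProjResolution _ _ M Q d (bcomp (res_aug P) (incl 0%N))).
  - by move=> i; apply: projective_retract (inclK i) (@res_proj _ _ _ P i).
  - move=> m; have [x xm] := @res_aug_surj _ _ _ P m.
    exists (proj 0%N x); rewrite -[LHS]/(res_aug P (e 0%N x)).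
    have [n0|n0] := posnP n; last by rewrite e_lt.
    rewrite /e n0 ltnn eqxx /= linearB /= xm.
    have -> : res_aug P (res_d P 0%N (u 0%N x)) = 0 by apply: (cycle_d (i := 0%N)).
    by rewrite subr0.
  - by move=> x; apply: (exQ 0%N).
  - move=> i x; apply: iff_trans (exQ i.+1 x).
    rewrite -[X in _ <-> X]/(res_d P i (incl i.+1 x) = 0) -dE.
    split=> [dx|dx]; first by rewrite -[d i x]/(_ x) dx linear0.
    by apply: incl_inj; rewrite [RHS]linear0.
by move=> i ni x; apply: Q0.
Qed.

End Truncation.

End BimodHoms.

(** * Sweedler calculus *)

Definition tri (k : fieldType) (U V W X : lmodType k) (f : U -> V -> W -> X) : Prop :=
  [/\ forall v w, lin (fun u => f u v w), forall u w, lin (fun v => f u v w) &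
      forall u v, lin (f u v)].

Ltac lin_tac ::= repeat first [ lin1 | match goal with |- tri _ => split=> ? ? /= end ].

Section Sweedler.
Variables (k : fieldType) (H : hopfAlg k).
Implicit Types (a b : H) (U : lmodType k).

Notation S := (@antipode k H).
Notation e := (@counit k H).
Notation Delta := (@comul k H).

(* Sweedler sums are written with tlift: tlift F (Delta a) is the sum of the
   F a_1 a_2, and iterated coproducts are nested to the right. *)
Lemma coact_assoc (V : comod H) U (f : V -> H -> H -> U) (v : V) : tri f ->
  tlift (fun x z => tlift (fun u w => f u w z) (coact V x)) (coact V v) =
  tlift (fun x z => tlift (fun u w => f x u w) (Delta z)) (coact V v).
Proof.
case=> f1 f2 f3.
pose F (t : V \ox (H \ox H)) := tlift (fun x y => tlift (f x) y) t.
have Fl : lin F by apply: tliftP; lin_tac.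
pose G (t : (V \ox H) \ox H) := F (tassoc t).
have Gl : lin G by apply: (@lin_comp _ _ _ _ F) => //; apply: linearP.
have Fpure x y : F (x \ot y) = tlift (f x) y by rewrite /F tliftE; lin_tac.
have Gpure t z : G (t \ot z) = tlift (fun u w => f u w z) t.
  rewrite (@lin_tensE _ _ _ _ (fun t => G (t \ot z))); last first.
    by apply: (@lin_comp _ _ _ _ G) => //; lin_tac.
  by apply: eq_tlift => u w; rewrite /G tassocE Fpure tliftE; lin_tac.
have := congr1 F (coactA v); rewrite -/(G _) !tmap_tlift.
rewrite (@lin_tlift _ _ _ _ _ G) // (@lin_tlift _ _ _ _ _ F) // => E.
transitivity (tlift (fun x z => G (coact V x \ot z)) (coact V v)).
  by apply: eq_tlift => x z; rewrite Gpure.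
by rewrite E; apply: eq_tlift => x z; rewrite Fpure.
Qed.

Lemma coact_counit (V : comod H) U (f : V -> U) (v : V) : lin f ->
  tlift (fun x z => (e z : k) *: f x) (coact V v) = f v.
Proof.
move=> fl; rewrite -{2}(coactu v) tmap_tlift (@lin_tlift _ _ _ _ _ (fun t => f (trunit
    t))).
  apply: eq_tlift => x z; rewrite trunitE.
  by rewrite linZ.
by apply: lin_comp fl _; apply: linearP.
Qed.

Definition regular_comod : comod H := Comod (@comulA k H) (@counitr k H).

Lemma comul_assoc U (f : H -> H -> H -> U) a : tri f ->
  tlift (fun x z => tlift (fun u w => f u w z) (Delta x)) (Delta a) =
  tlift (fun x z => tlift (fun u w => f x u w) (Delta z)) (Delta a).
Proof. exact: (@coact_assoc regular_comod). Qed.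

Lemma comul_counitr U (f : H -> U) a : lin f ->
  tlift (fun x z => (e z : k) *: f x) (Delta a) = f a.
Proof. exact: (@coact_counit regular_comod). Qed.

Lemma comul_counitl U (f : H -> U) a : lin f ->
  tlift (fun x z => (e x : k) *: f z) (Delta a) = f a.
Proof.
move=> fl; rewrite -{2}(counitl a) tmap_tlift (@lin_tlift _ _ _ _ _ (fun t => f (tlunit
    t))).
  apply: eq_tlift => x z; rewrite tlunitE.
  by rewrite linZ.
by apply: lin_comp fl _; apply: linearP.
Qed.

Lemma antipodelE a : tlift (fun x z => S x * z) (Delta a) = (e a : k) *: 1.
Proof.
rewrite -antipodel tmap_tlift (@lin_tlift _ _ _ _ _ (@amul k H)) /=; last exact: linearP.
by apply: eq_tlift => x z; rewrite amulE.
Qed.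

Lemma antipoderE a : tlift (fun x z => x * S z) (Delta a) = (e a : k) *: 1.
Proof.
rewrite -antipoder tmap_tlift (@lin_tlift _ _ _ _ _ (@amul k H)) /=; last exact: linearP.
by apply: eq_tlift => x z; rewrite amulE.
Qed.

Lemma cancel_Sl_left U (f : H -> H -> U) a : bil f ->
  tlift (fun x z => tlift (fun u w => f (S x * u) w) (Delta z)) (Delta a) = f 1 a.
Proof.
move=> fb; have [fl fr] := fb; rewrite -(@comul_assoc _ (fun x u w => f (S x * u) w));
    last first.
  by split=> ? ? /=; [apply: lin_comp (fl _) _ | apply: lin_comp (fl _) _ | ]; lin_tac.
rewrite -[RHS](@comul_counitl _ (f 1)) //; apply: eq_tlift => x z.
rewrite -(@lin_tlift _ _ _ _ _ (fun t => f t z)) // antipodelE.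
by rewrite (@linZ _ _ _ (fun t => f t z)).
Qed.

Lemma cancel_Sr_left U (f : H -> H -> U) a : bil f ->
  tlift (fun x z => tlift (fun u w => f (x * S u) w) (Delta z)) (Delta a) = f 1 a.
Proof.
move=> fb; have [fl fr] := fb; rewrite -(@comul_assoc _ (fun x u w => f (x * S u) w));
    last first.
  by split=> ? ? /=; [apply: lin_comp (fl _) _ | apply: lin_comp (fl _) _ | ]; lin_tac.
rewrite -[RHS](@comul_counitl _ (f 1)) //; apply: eq_tlift => x z.
rewrite -(@lin_tlift _ _ _ _ _ (fun t => f t z)) // antipoderE.
by rewrite (@linZ _ _ _ (fun t => f t z)).
Qed.

Lemma cancel_Sl U (f : H -> U) a : lin f ->
  tlift (fun u w => f (S u * w)) (Delta a) = (e a : k) *: f 1.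
Proof.
move=> fl; rewrite -(@lin_tlift _ _ _ _ _ f) // antipodelE.
by rewrite linZ.
Qed.

Lemma cancel_Sr U (f : H -> U) a : lin f ->
  tlift (fun u w => f (u * S w)) (Delta a) = (e a : k) *: f 1.
Proof.
move=> fl; rewrite -(@lin_tlift _ _ _ _ _ f) // antipoderE.
by rewrite linZ.
Qed.

Lemma antipode1 : S 1 = 1.
Proof.
have := antipodelE 1; rewrite comul1 tliftE; last by lin_tac.
by rewrite mulr1 counit1 scale1r.
Qed.

Lemma comulM_tlift a b : Delta (a * b) =
  tlift (fun a1 a2 => tlift (fun b1 b2 => (a1 * b1) \ot (a2 * b2)) (Delta b)) (Delta a).
Proof.
rewrite comulM /tmul tinter_tlift lin_tlift; last exact: linearP.
apply: eq_tlift => a1 a2; rewrite lin_tlift; last exact: linearP.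
by apply: eq_tlift => b1 b2; rewrite tmapE /= !amulE.
Qed.

Lemma tlift_comulM U (f : H -> H -> U) a b : bil f -> tlift f (Delta (a * b)) =
  tlift (fun a1 a2 => tlift (fun b1 b2 => f (a1 * b1) (a2 * b2)) (Delta b)) (Delta a).
Proof.
move=> fb; rewrite comulM_tlift (@lin_tlift _ _ _ _ _ (tlift f)); last exact: tliftP.
apply: eq_tlift => a1 a2; rewrite (@lin_tlift _ _ _ _ _ (tlift f)); last exact: tliftP.
by apply: eq_tlift => b1 b2; rewrite tliftE.
Qed.

Lemma tlift_comul1 U (f : H -> H -> U) : bil f -> tlift f (Delta 1) = f 1 1.
Proof. by move=> fb; rewrite comul1 tliftE. Qed.

Lemma counit_antipode a : e (S a) = e a.
Proof.
have <- : e ((e a : k) *: 1) = e a by rewrite linearZ /= counit1 [_ *: _]mulr1.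
rewrite -antipodelE (@lin_tlift _ _ _ _ _ e); last exact: linearP.
rewrite -[LHS](@comul_counitr _ (fun x => e (S x))); last by lin_tac.
by apply: eq_tlift => x z; rewrite counitM [LHS]mulrC.
Qed.

(** Both sides are convolution inverses of the product H (x) H -> H. Concretely, [X] is the sum of
    S(a_1 b_1) a_2 b_2 S(b_3) S(a_3), which collapses to the left side from the right end and to the
    right side from the left end. *)
Lemma antipodeM a b : S (a * b) = S b * S a.
Proof.
pose X := tlift (fun a1 a' => tlift (fun a2 a3 => tlift (fun b1 b' => tlift (fun b2 b3 =>
  S (a1 * b1) * (a2 * (b2 * S b3) * S a3)) (Delta b')) (Delta b)) (Delta a')) (Delta a).
transitivity X.
  rewrite -[LHS](@comul_counitr _ (fun x => S (x * b))); last by lin_tac.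
  rewrite /X; apply: eq_tlift => a1 a'.
  rewrite -[S (a1 * b)]mulr1 -(@cancel_Sr _ (fun x => S (a1 * b) * x)); last by lin_tac.
  apply: eq_tlift => a2 a3.
  rewrite -[LHS](@comul_counitr _ (fun x => S (a1 * x) * (a2 * S a3))); last by lin_tac.
  apply: eq_tlift => b1 b'.
  rewrite (@cancel_Sr _ (fun x => S (a1 * b1) * (a2 * x * S a3))); last by lin_tac.
  by rewrite mulr1.
rewrite /X.
rewrite -(@comul_assoc _ (fun a1 a2 a3 => tlift (fun b1 b' => tlift (fun b2 b3 =>
  S (a1 * b1) * (a2 * (b2 * S b3) * S a3)) (Delta b')) (Delta b))); last by lin_tac.
rewrite -[RHS](@comul_counitl _ (fun x => S b * S x)); last by lin_tac.
apply: eq_tlift => a' a3.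
transitivity (tlift (fun a1 a2 => tlift (fun b' b3 => tlift (fun b1 b2 =>
  (S (a1 * b1) * (a2 * b2)) * (S b3 * S a3)) (Delta b')) (Delta b)) (Delta a')).
  apply: eq_tlift => a1 a2.
  rewrite -(@comul_assoc _ (fun b1 b2 b3 => S (a1 * b1) * (a2 * (b2 * S b3) * S a3)));
      last by lin_tac.
  by apply: eq_tlift => b' b3; apply: eq_tlift => b1 b2; rewrite !mulrA.
rewrite tlift_exchange.
rewrite -(@comul_counitl _ (fun x => S x * S a3) b); last by lin_tac.
rewrite (@lin_tlift _ _ _ _ _ (fun t => (e a' : k) *: t)); last by lin_tac.
apply: eq_tlift => b' b3; rewrite scalerA -counitM.
rewrite -[S b3 * S a3]mul1r -(@cancel_Sl _ (fun x => x * (S b3 * S a3))); last by lin_tac.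
rewrite tlift_comulM; lin_tac.
by do 2 apply: eq_tlift => ? ?; rewrite mul1r.
Qed.


Lemma tmul_tlift x y : tmul x y =
  tlift (fun a b => tlift (fun c d => (a * c) \ot (b * d)) y) x :> H \ox H.
Proof.
rewrite /tmul tinter_tlift lin_tlift; last exact: linearP.
apply: eq_tlift => a b; rewrite lin_tlift; last exact: linearP.
by apply: eq_tlift => c d; rewrite tmapE /= !amulE.
Qed.

Lemma tmul_bil : bil (@tmul k H).
Proof.
split=> x c u v; rewrite /tmul; first by rewrite linearPl !linearP.
by rewrite linearPr !linearP.
Qed.

Lemma lin_tmull U (f : U -> H \ox H) y : lin f -> lin (fun x => tmul (f x) y).
Proof. exact: (@lin_comp _ _ _ _ (fun t => tmul t y) f (tmul_bil.1 y)). Qed.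

Lemma lin_tmulr U (f : U -> H \ox H) y : lin f -> lin (fun x => tmul y (f x)).
Proof. exact: (@lin_comp _ _ _ _ (tmul y) f (tmul_bil.2 y)). Qed.

Lemma tmulA (x y z : H \ox H) : tmul x (tmul y z) = tmul (tmul x y) z.
Proof.
move: x; apply: tens_lin_ext => [||a a'].
- by apply: lin_tmull; apply: lin_id.
- by do 2 apply: lin_tmull; apply: lin_id.
move: y; apply: tens_lin_ext => [||b b'].
- by apply: lin_tmulr; apply: lin_tmull; apply: lin_id.
- by apply: lin_tmull; apply: lin_tmulr; apply: lin_id.
move: z; apply: tens_lin_ext => [||c c'].
- by do 2 apply: lin_tmulr; apply: lin_id.
- by apply: lin_tmulr; apply: lin_id.
by rewrite !tmulE !mulrA.
Qed.

Lemma tmul1l (x : H \ox H) : tmul (1 \ot 1) x = x.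
Proof.
move: x; apply: tens_lin_ext => [||a b]; last by rewrite tmulE !mul1r.
  by apply: lin_tmulr; apply: lin_id.
exact: lin_id.
Qed.

Lemma tmul1r (x : H \ox H) : tmul x (1 \ot 1) = x.
Proof.
move: x; apply: tens_lin_ext => [||a b]; last by rewrite tmulE !mulr1.
  by apply: lin_tmull; apply: lin_id.
exact: lin_id.
Qed.

(** Both sides are convolution inverses of [Delta] in Hom(H, H (x) H): [Delta] composed with S is a
    left inverse because [Delta] is multiplicative, and [T] is a right inverse by [invT]. *)
Lemma comul_antipode a : Delta (S a) = tlift (fun a1 a2 => S a2 \ot S a1) (Delta a).
Proof.
pose T b := tlift (fun b1 b2 => S b2 \ot S b1) (Delta b).
have Tl : lin T by rewrite /T; lin_tac.
rewrite -/(T a).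
have invT b : tlift (fun b1 b2 => tmul (Delta b1) (T b2)) (Delta b) = (e b : k) *: (1 \ot
    1).
  transitivity (tlift (fun b1 z => tlift (fun b2 z' => tlift (fun b3 b4 =>
      (b1 * S b4) \ot (b2 * S b3)) (Delta z')) (Delta z)) (Delta b)).
    rewrite -(@comul_assoc _ (fun b1 b2 z' => tlift (fun b3 b4 =>
      (b1 * S b4) \ot (b2 * S b3)) (Delta z'))); last by lin_tac.
    apply: eq_tlift => x z; rewrite tmul_tlift; apply: eq_tlift => b1 b2.
    by rewrite /T (@lin_tlift _ _ _ _ _ (tlift _)); [apply: eq_tlift => b3 b4; rewrite
        tliftE; lin_tac|lin_tac].
  rewrite -(@cancel_Sr _ (fun x => x \ot 1)); last by lin_tac.
  apply: eq_tlift => b1 z.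
  by rewrite (@cancel_Sr_left _ (fun x y => (b1 * S y) \ot x)); lin_tac.
transitivity (tlift (fun a1 a' => tlift (fun a2 a3 => tmul (Delta (S a1)) (tmul (Delta
    a2) (T a3))) (Delta a')) (Delta a)).
  rewrite -[LHS](@comul_counitr _ (fun x => Delta (S x))); last by lin_tac.
  apply: eq_tlift => a1 a'; rewrite -(@lin_tlift _ _ _ _ _ (tmul _)); last exact:
      (tmul_bil.2 _).
  by rewrite invT linZ ?tmul1r //; apply: (tmul_bil.2 _).
rewrite -(@comul_assoc _ (fun a1 a2 a3 => tmul (Delta (S a1)) (tmul (Delta a2) (T a3))));
    last first.
  split=> ? ? /=.
  - by apply: lin_tmull; lin_tac.
  - by apply: lin_tmulr; apply: lin_tmull; lin_tac.
  - by do 2 apply: lin_tmulr; lin_tac.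
rewrite -[RHS](@comul_counitl _ T) //; apply: eq_tlift => a' a3.
transitivity (tmul (Delta (tlift (fun a1 a2 => S a1 * a2) (Delta a'))) (T a3)).
  rewrite (@lin_tlift _ _ _ _ _ (fun t => tmul (Delta t) (T a3))); last by apply:
      lin_tmull; lin_tac.
  by apply: eq_tlift => a1 a2; rewrite tmulA comulM.
by rewrite antipodelE linearZ /= comul1 (@linZ _ _ _ (fun t => tmul t (T a3))) ?tmul1l
    //; apply: (tmul_bil.1 _).
Qed.

End Sweedler.

(** * Induced bimodules and adjoint modules *)

Record rmod (k : fieldType) (A : algType k) := Rmod {
  rmod_sort :> lmodType k;
  mact : {bilinear rmod_sort -> A -> rmod_sort};
  mact1 : forall m, mact m 1 = m;
  mactM : forall m a b, mact m (a * b) = mact (mact m a) b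
}.

Definition mlin (k : fieldType) (A : algType k) (M N : rmod A) (f : M -> N) : Prop :=
  forall m a, f (mact M m a) = mact N (f m) a.

Section Induction.
Variables (k : fieldType) (H : hopfAlg k).
Implicit Types (M N : rmod H).

Notation S := (@antipode k H).
Notation e := (@counit k H).
Notation Delta := (@comul k H).

Section Ad.
Variable M : bimod H.

Definition ad_act (m : M) (a : H) : M :=
  tlift (fun a1 a2 => ract M (lact M (S a1) m) a2) (Delta a).

Lemma ad_act_bil : bil ad_act.
Proof. by rewrite /ad_act; lin_tac. Qed.

Definition ad : rmod H.
Proof.
refine (@Rmod k H M (mk_bil ad_act_bil) _ _).
- move=> m; rewrite /= /ad_act tlift_comul1; last by lin_tac.
  by rewrite antipode1 lact1 ract1.
- move=> m a b; rewrite /= /ad_act tlift_comulM; last by lin_tac.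
  rewrite tlift_exchange; apply: eq_tlift => b1 b2.
  rewrite (@lin_tlift _ _ _ _ _ (fun t => ract M (lact M _ t) _)); last by lin_tac.
  by apply: eq_tlift => a1 a2; rewrite antipodeM lactM ractM -lractA.
Defined.

Lemma ad_mactE (m : ad) a : mact ad m a = ad_act m a.
Proof. by []. Qed.

(** The right action is recovered from the left action and the adjoint one, so a left-linear map
    that respects the adjoint actions is a bimodule map. *)
Lemma ract_ad (m : M) a :
  ract M m a = tlift (fun a1 a2 => lact M a1 (ad_act m a2)) (Delta a).
Proof.
transitivity (tlift (fun a1 z => tlift (fun a2 a3 => ract M (lact M (a1 * S a2) m) a3)
    (Delta z)) (Delta a)).
  by rewrite (@cancel_Sr_left _ _ _ (fun x y => ract M (lact M x m) y)) ?lact1 //;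
      lin_tac.
apply: eq_tlift => a1 z; rewrite /ad_act (@lin_tlift _ _ _ _ _ (lact M a1)); last exact:
    linearPr.
by apply: eq_tlift => a2 a3; rewrite lactM lractA.
Qed.

End Ad.

Section Ind.
Variable N : rmod H.

Definition ind_lact (b : H) (t : H \ox N) : H \ox N := tlift (fun x n => (b * x) \ot n) t.
Definition ind_ract (t : H \ox N) (c : H) : H \ox N :=
  tlift (fun x n => tlift (fun c1 c2 => (x * c1) \ot mact N n c2) (Delta c)) t.

Lemma ind_lact_bil : bil ind_lact.
Proof. by rewrite /ind_lact; lin_tac. Qed.
Lemma ind_ract_bil : bil ind_ract.
Proof. by rewrite /ind_ract; lin_tac. Qed.

Lemma ind_lactE b x n : ind_lact b (x \ot n) = (b * x) \ot n.
Proof. by rewrite /ind_lact tliftE //; lin_tac. Qed.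
Lemma ind_ractE x n c :
  ind_ract (x \ot n) c = tlift (fun c1 c2 => (x * c1) \ot mact N n c2) (Delta c).
Proof. by rewrite /ind_ract tliftE //; lin_tac. Qed.

Lemma lin_ind_lact (U : lmodType k) (f : U -> H \ox N) b : lin f -> lin (fun x =>
    ind_lact b (f x)).
Proof. exact: (@lin_comp _ _ _ _ (ind_lact b) f (ind_lact_bil.2 b)). Qed.
Lemma lin_ind_ract (U : lmodType k) (f : U -> H \ox N) b : lin f -> lin (fun x =>
    ind_ract (f x) b).
Proof. exact: (@lin_comp _ _ _ _ (fun t => ind_ract t b) f (ind_ract_bil.1 b)). Qed.

(** Left multiplication on H, diagonal action on the right. For the trivial module this is the
    regular bimodule, which is how a resolution of k becomes one of H. *)
Definition ind : bimod H.
Proof.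
refine (@Bimod k H (H \ox N) (mk_bil ind_lact_bil) (mk_bil ind_ract_bil) _ _ _ _ _) => /=.
- apply: tens_lin_ext; [exact: lin_ind_lact | exact: lin_id |] => x n.
  by rewrite ind_lactE mul1r.
- move=> a b; apply: tens_lin_ext; [exact: lin_ind_lact | by do 2 apply: lin_ind_lact |].
  by move=> x n; rewrite !ind_lactE mulrA.
- apply: tens_lin_ext; [exact: lin_ind_ract | exact: lin_id |] => x n.
  by rewrite ind_ractE tlift_comul1 ?mulr1 ?mact1 //; lin_tac.
- move=> m a b; move: m; apply: tens_lin_ext; [exact: lin_ind_ract | by do 2 apply:
    lin_ind_ract |].
  move=> x n; rewrite !ind_ractE tlift_comulM; last by lin_tac.
  rewrite (@lin_tlift _ _ _ _ _ (fun t => ind_ract t b)); last exact: lin_ind_ract.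
  apply: eq_tlift => a1 a2; rewrite ind_ractE; apply: eq_tlift => b1 b2.
  by rewrite mulrA mactM.
- move=> a m b; move: m; apply: tens_lin_ext; [by apply: lin_ind_ract; apply: lin_ind_lact
    | by apply: lin_ind_lact; apply: lin_ind_ract |].
  move=> x n; rewrite ind_lactE !ind_ractE [RHS]lin_tlift; last exact: lin_ind_lact.
  by apply: eq_tlift => b1 b2; rewrite ind_lactE mulrA.
Defined.

Lemma lact_indE b x n : lact ind b (x \ot n) = (b * x) \ot n.
Proof. exact: ind_lactE. Qed.
Lemma ract_indE x n c :
  ract ind (x \ot n) c = tlift (fun c1 c2 => (x * c1) \ot mact N n c2) (Delta c).
Proof. exact: ind_ractE. Qed.

Lemma ind_lact1 x n : lact ind x (1 \ot n : H \ox N) = x \ot n.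
Proof. by rewrite lact_indE mulr1. Qed.

(* As 1 (x) N generates ind N as a left module, bimodule maps ind N -> M thus
   amount to module maps N -> ad M. *)
Lemma ind_ad n a : ad_act (1 \ot n : ind) a = 1 \ot mact N n a.
Proof.
transitivity (tlift (fun a1 z => tlift (fun a2 a3 => (S a1 * a2) \ot mact N n a3) (Delta
    z)) (Delta a)).
  by apply: eq_tlift => a1 a2; rewrite ind_lact1 [LHS]ind_ractE.
by rewrite (@cancel_Sl_left _ _ _ (fun x y => x \ot mact N n y)); lin_tac.
Qed.

End Ind.

Lemma ind_hom_ext N (M : bimod H) (f g : bimod_hom (ind N) M) :
  (forall n : N, f (1 \ot n : ind N) = g (1 \ot n : ind N)) -> forall x, f x = g x.
Proof.
move=> fg; apply: tens_lin_ext => [||x n]; try exact: linearP.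
by rewrite -ind_lact1 !bimod_homl fg.
Qed.

Definition ind_ext_fun N (M : bimod H) (phi : {linear N -> M}) (t : H \ox N) : M :=
  tlift (fun x n => lact M x (phi n)) t.

Lemma ind_ext_lin N (M : bimod H) (phi : {linear N -> M}) : lin (ind_ext_fun phi).
Proof. by rewrite /ind_ext_fun; lin_tac. Qed.

Lemma ind_ext_funE N (M : bimod H) (phi : {linear N -> M}) x n :
  ind_ext_fun phi (x \ot n) = lact M x (phi n).
Proof. by rewrite /ind_ext_fun tliftE //; lin_tac. Qed.

Definition ind_ext N (M : bimod H) (phi : {linear N -> M})
  (phiP : forall n a, phi (mact N n a) = ad_act (phi n) a) : bimod_hom (ind N) M.
Proof.
exists (mk_linear (ind_ext_lin phi)).
- move=> a; apply: tens_lin_ext; [by lin_tac | by lin_tac |] => x n.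
  by rewrite lact_indE !mk_linearE !ind_ext_funE lactM.
- move=> m a; move: m; apply: tens_lin_ext; [by lin_tac | by lin_tac |] => x n.
  rewrite ract_indE !mk_linearE !ind_ext_funE lin_tlift; last exact: ind_ext_lin.
  rewrite lractA ract_ad [RHS](@lin_tlift _ _ _ _ _ (lact M x)); last exact: linearPr.
  by apply: eq_tlift => a1 a2; rewrite ind_ext_funE lactM phiP.
Defined.

Lemma ind_extE N (M : bimod H) (phi : {linear N -> M}) phiP (n : N) :
  @ind_ext N M phi phiP (1 \ot n : ind N) = phi n.
Proof. by rewrite [LHS]ind_ext_funE lact1. Qed.

Definition free_rmod_act (V : lmodType k) (t : V \ox H) (a : H) : V \ox H :=
  tlift (fun v x => v \ot (x * a)) t.

Lemma free_rmod_act_bil V : bil (@free_rmod_act V).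
Proof. by rewrite /free_rmod_act; lin_tac. Qed.

Lemma free_rmod_actE (V : lmodType k) (v : V) x a : free_rmod_act (v \ot x) a = v \ot (x
    * a).
Proof. by rewrite /free_rmod_act tliftE //; lin_tac. Qed.

Definition free_rmod (V : lmodType k) : rmod H.
Proof.
refine (@Rmod k H (V \ox H) (mk_bil (free_rmod_act_bil V)) _ _) => /=.
- apply: tens_lin_ext => [||v x]; [exact: (free_rmod_act_bil V).1 | exact: lin_id |].
  by rewrite free_rmod_actE mulr1.
- move=> m a b; move: m; apply: tens_lin_ext => [||v x]; [exact: (free_rmod_act_bil V).1
    | |].
    exact: (@lin_comp _ _ _ _ (fun t => free_rmod_act t b) _ ((free_rmod_act_bil V).1 b)
        ((free_rmod_act_bil V).1 a)).
  by rewrite !free_rmod_actE mulrA.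
Defined.

Lemma free_rmod_mactE (V : lmodType k) (v : V) x a :
  mact (free_rmod V) (v \ot x) a = v \ot (x * a).
Proof. exact: free_rmod_actE. Qed.

Definition free_ext_fun (V : lmodType k) N (phi : {linear V -> N}) (t : V \ox H) : N :=
  tlift (fun v x => mact N (phi v) x) t.

Lemma free_ext_lin (V : lmodType k) N (phi : {linear V -> N}) : lin (free_ext_fun phi).
Proof. by rewrite /free_ext_fun; lin_tac. Qed.

Lemma free_ext_funE (V : lmodType k) N (phi : {linear V -> N}) v x :
  free_ext_fun phi (v \ot x) = mact N (phi v) x.
Proof. by rewrite /free_ext_fun tliftE //; lin_tac. Qed.

Lemma free_ext_mlin (V : lmodType k) N (phi : {linear V -> N}) : @mlin _ _ (free_rmod V)
    N (free_ext_fun phi).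
Proof.
move=> m a; move: m; apply: tens_lin_ext => [||v x].
- apply: (@lin_comp _ _ _ _ (free_ext_fun phi)); first exact: free_ext_lin.
  exact: (free_rmod_act_bil V).1.
- by apply: lin_bilinl; apply: free_ext_lin.
- by rewrite free_rmod_mactE !free_ext_funE mactM.
Qed.

(** Bimodule maps out of [ind (free_rmod V)] amount to linear maps out of V, through the adjunction
    with [ad] and freeness. Such a map lifts along any linear section of [p]. *)
Lemma ind_free_projective (V : lmodType k) : projective (ind (free_rmod V)).
Proof.
move=> M N p f psurj; have [s sP] := generalized_inverse p.
have pK n : p (s n) = n by have [m <-] := psurj n; rewrite sP.
have philin : lin (fun v => s (f (1 \ot (v \ot 1) : ind (free_rmod V)))) by lin_tac.
pose phi : {linear V -> ad M} := mk_linear philin.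
have gP n a : mk_linear (free_ext_lin phi) (mact (free_rmod V) n a)
    = ad_act (mk_linear (free_ext_lin phi) n : M) a by apply: free_ext_mlin.
exists (ind_ext gP); apply: (ind_hom_ext (f := bcomp p (ind_ext gP))) => t.
rewrite [LHS]/= -[X in p X]/(ind_ext gP (1 \ot t : ind (free_rmod V))) ind_extE /=.
move: t; apply: tens_lin_ext => [||v x].
- by lin_tac.
- by lin_tac.
rewrite free_ext_funE ad_mactE /ad_act lin_tlift; last exact: linearP.
have <- : ad_act (1 \ot (v \ot 1) : ind (free_rmod V)) x = 1 \ot (v \ot x).
  by rewrite ind_ad free_rmod_mactE mul1r.
rewrite /ad_act [RHS]lin_tlift; last exact: linearP.
by apply: eq_tlift => x1 x2; rewrite !bimod_homr !bimod_homl pK.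
Qed.

End Induction.

(** * Threefold and fivefold coproducts *)

Section Sw3.
Variables (k : fieldType) (H : hopfAlg k).
Implicit Types U V W : lmodType k.
Notation S := (@antipode k H).
Notation e := (@counit k H).
Notation Delta := (@comul k H).

Definition sw3 U (f : H -> H -> H -> U) (a : H) : U :=
  tlift (fun x z => tlift (fun u w => f x u w) (Delta z)) (Delta a).

Lemma eq_sw3 U (f g : H -> H -> H -> U) a :
  (forall x y z, f x y z = g x y z) -> sw3 f a = sw3 g a.
Proof. by move=> fg; apply: eq_tlift => ? ?; apply: eq_tlift => ? ?. Qed.

Lemma lin_sw3 U V (g : U -> V) (f : H -> H -> H -> U) a :
  lin g -> g (sw3 f a) = sw3 (fun x y z => g (f x y z)) a.
Proof. by move=> gl; rewrite /sw3 lin_tlift //; apply: eq_tlift => ? ?; rewrite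
    lin_tlift. Qed.

Lemma sw3_tlift U V W (f : V -> W -> H -> H -> H -> U) (t : V \ox W) a :
  tlift (fun v w => sw3 (f v w) a) t = sw3 (fun x y z => tlift (fun v w => f v w x y z)
      t) a.
Proof. by rewrite tlift_exchange; apply: eq_tlift => ? ?; rewrite tlift_exchange. Qed.

Lemma lin_sw3_arg U V (f : H -> H -> H -> U) (g : V -> H) :
  tri f -> lin g -> lin (fun x => sw3 f (g x)).
Proof. by case=> f1 f2 f3 gl; apply: lin_tlift_arg => //; lin_tac. Qed.

Lemma lin_sw3_body U V (f : V -> H -> H -> H -> U) a :
  (forall x y z, lin (fun v => f v x y z)) -> lin (fun v => sw3 (f v) a).
Proof. by move=> fl; rewrite /sw3; do 2 apply: lin_tlift_body => ? ?. Qed.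

Lemma sw3_one U (f : H -> H -> H -> U) : tri f -> sw3 f 1 = f 1 1 1.
Proof.
by case=> f1 f2 f3; rewrite /sw3 tlift_comul1 ?tlift_comul1 //; lin_tac.
Qed.

Lemma sw3M U (f : H -> H -> H -> U) a b : tri f -> sw3 f (a * b) =
  sw3 (fun x y z => sw3 (fun x' y' z' => f (x * x') (y * y') (z * z')) b) a.
Proof.
case=> f1 f2 f3; rewrite /sw3 tlift_comulM; last by lin_tac.
apply: eq_tlift => a1 a'; rewrite tlift_exchange; apply: eq_tlift => b1 b'.
by rewrite tlift_comulM; lin_tac.
Qed.

Definition penta U (F : H -> H -> H -> H -> H -> U) : Prop :=
  [/\ forall x2 x3 x4 x5, lin (fun x1 => F x1 x2 x3 x4 x5),
      forall x1 x3 x4 x5, lin (fun x2 => F x1 x2 x3 x4 x5),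
      forall x1 x2 x4 x5, lin (fun x3 => F x1 x2 x3 x4 x5),
      forall x1 x2 x3 x5, lin (fun x4 => F x1 x2 x3 x4 x5) &
      forall x1 x2 x3 x4, lin (fun x5 => F x1 x2 x3 x4 x5)].

(* Both sides are the sum of the F b_1 b_2 b_3 b_4 b_5. *)
Lemma sw5 U (F : H -> H -> H -> H -> H -> U) b : penta F ->
  sw3 (fun b1 b2 b3 => sw3 (fun c1 c2 c3 => F b1 c1 c2 c3 b3) b2) b =
  sw3 (fun b1 b2 b3 =>
    tlift (fun c1 c2 => tlift (fun d1 d2 => F c1 c2 b2 d1 d2) (Delta b3)) (Delta b1)) b.
Proof.
case=> F1 F2 F3 F4 F5.
transitivity (tlift (fun x1 y1 => tlift (fun x2 y2 => tlift (fun x3 y3 => tlift (fun x4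
    x5 =>
    F x1 x2 x3 x4 x5) (Delta y3)) (Delta y2)) (Delta y1)) (Delta b)).
  apply: eq_tlift => x1 y1.
  rewrite [LHS](@comul_assoc _ _ _ (fun c1 y b3 =>
    tlift (fun c2 c3 => F x1 c1 c2 c3 b3) (Delta y))); last by lin_tac.
  apply: eq_tlift => x2 y2.
  by rewrite (@comul_assoc _ _ _ (fun c2 c3 b3 => F x1 x2 c2 c3 b3)); last by lin_tac.
rewrite -(@comul_assoc _ _ _ (fun x1 x2 y2 => tlift (fun x3 y3 => tlift (fun x4 x5 =>
    F x1 x2 x3 x4 x5) (Delta y3)) (Delta y2))); last by lin_tac.
apply: eq_tlift => b1 y2; rewrite tlift_exchange; apply: eq_tlift => x3 y3.
by rewrite tlift_exchange.
Qed.

Lemma tlift_conj U (f : H -> H -> U) a v b : bil f ->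
  tlift f (Delta (S a * v * b)) =
  tlift (fun a1 a2 => tlift (fun v1 v2 => tlift (fun b1 b2 =>
    f (S a2 * v1 * b1) (S a1 * v2 * b2)) (Delta b)) (Delta v)) (Delta a).
Proof.
move=> fb; have [fl fr] := fb; rewrite tlift_comulM //.
rewrite tlift_comulM; last first.
  by split=> ? /=; [do 1 apply: lin_tlift_body => ? ?; apply: lin_comp (fl _) _; lin_tac
                   | do 1 apply: lin_tlift_body => ? ?; apply: lin_comp (fr _) _;
                       lin_tac].
rewrite comul_antipode (@lin_tlift _ _ _ _ _ (tlift _)); last first.
  apply: tliftP; split=> ? /=; do 2 apply: lin_tlift_body => ? ?.
    by apply: lin_comp (fl _) _; lin_tac.
  by apply: lin_comp (fr _) _; lin_tac.
apply: eq_tlift => a1 a2; rewrite tliftE //.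
split=> ? /=; do 2 apply: lin_tlift_body => ? ?.
  by apply: lin_comp (fl _) _; lin_tac.
by apply: lin_comp (fr _) _; lin_tac.
Qed.

End Sw3.

Ltac lin_tac ::= repeat first [ lin1 | match goal with |- tri _ => split=> ? ? /= end
  | match goal with |- penta _ => split=> ? ? ? ? /= end
  | eapply lin_sw3_arg | eapply lin_sw3_body ].

(** * Yetter-Drinfeld modules *)

(* The compatibility reads rho(v a) = v_0 a_2 (x) S(a_1) v_1 a_3. *)
Record yd (k : fieldType) (H : hopfAlg k) := Yd {
  yd_comod :> comod H;
  yact : {bilinear yd_comod -> H -> yd_comod};
  yact1 : forall v, yact v 1 = v;
  yactM : forall v a b, yact v (a * b) = yact (yact v a) b;
  yactP : forall v a, coact yd_comod (yact v a) =
    tlift (fun v0 v1 => sw3 (fun a1 a2 a3 =>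
      yact v0 a2 \ot (@antipode k H a1 * v1 * a3)) a) (coact yd_comod v)
}.

Section YetterDrinfeld.
Variables (k : fieldType) (H : hopfAlg k).
Implicit Types (V W : comod H) (M N : yd H).
Notation S := (@antipode k H).
Notation e := (@counit k H).
Notation Delta := (@comul k H).

Definition ydlin M N (f : comod_hom M N) : Prop :=
  forall m a, f (yact M m a) = yact N (f m) a.

Definition yd_rmod M : rmod H := Rmod (@yact1 _ _ M) (@yactM _ _ M).

Lemma coact_hom V W (f : comod_hom V W) v :
  coact W (f v) = tlift (fun v0 v1 => f v0 \ot v1) (coact V v).
Proof. by rewrite comod_homP tmap_tlift. Qed.

Definition mk_comod_hom V W (f : V -> W) (f_lin : lin f)
  (fP : forall v, coact W (f v) = tlift (fun v0 v1 => f v0 \ot v1) (coact V v)) :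
      comod_hom V W.
Proof.
by exists (mk_linear f_lin) => v; rewrite mk_linearE fP tmap_tlift.
Defined.

Section Free.
Variable V : comod H.

(** The formula is forced: v (x) b is the product of v (x) 1 with b, the map v |-> v (x) 1 is to be
    colinear, and the compatibility condition determines the coaction on a product. *)
Definition free_coact (t : V \ox H) : (V \ox H) \ox H :=
  tlift (fun v b => tlift (fun v0 v1 => sw3 (fun b1 b2 b3 =>
    (v0 \ot b2) \ot (S b1 * v1 * b3)) b) (coact V v)) t.

Lemma free_coact_lin : lin free_coact.
Proof. by rewrite /free_coact; lin_tac. Qed.

Lemma free_coactE v b : free_coact (v \ot b) =
  tlift (fun v0 v1 => sw3 (fun b1 b2 b3 => (v0 \ot b2) \ot (S b1 * v1 * b3)) b) (coact V
      v).
Proof. by rewrite /free_coact tliftE //; lin_tac. Qed.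

Definition free_coactl : {linear V \ox H -> (V \ox H) \ox H} := mk_linear free_coact_lin.

(** Both sides equal the sum of v_0 (x) b_3 (x) S(b_2) v_1 b_4 (x) S(b_1) v_2 b_5; the two ways of
    reaching the fivefold coproduct of b are matched by [sw5]. *)
Lemma free_coactA t :
  tassoc (tmap free_coactl idfun (free_coactl t)) = tmap idfun Delta (free_coactl t).
Proof.
move: t; apply: tens_lin_ext; [by lin_tac | by lin_tac |] => v b.
rewrite mk_linearE free_coactE.
rewrite (@lin_tlift _ _ _ _ _ (fun t => tassoc (tmap free_coactl idfun t))); last by
    lin_tac.
rewrite [RHS](@lin_tlift _ _ _ _ _ (tmap idfun Delta)); last by lin_tac.
pose F v0 v1 v2 x1 x2 x3 x4 x5 : (V \ox H) \ox (H \ox H) :=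
  (v0 \ot x3) \ot ((S x2 * v1 * x4) \ot (S x1 * v2 * x5)).
transitivity (tlift (fun v0 z => tlift (fun v1 v2 => sw3 (fun b1 b2 b3 => sw3 (fun c1 c2
    c3 =>
    F v0 v1 v2 b1 c1 c2 c3 b3) b2) b) (Delta z)) (coact V v)); last first.
  apply: eq_tlift => v0 z.
  rewrite [RHS]lin_sw3; last by lin_tac.
  rewrite sw3_tlift.
  transitivity (sw3 (fun b1 b2 b3 => tlift (fun c1 c2 => tlift (fun v1 v2 => tlift (fun
      d1 d2 =>
     F v0 v1 v2 c1 c2 b2 d1 d2) (Delta b3)) (Delta z)) (Delta b1)) b).
    rewrite -sw3_tlift.
    under eq_tlift => v1 v2 do (rewrite (@sw5 _ _ _ (fun x1 x2 x3 x4 x5 => F v0 v1 v2 x1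
        x2 x3 x4 x5)); last by rewrite /F; lin_tac).
    rewrite sw3_tlift; apply: eq_sw3 => b1 b2 b3.
    by rewrite tlift_exchange.
  apply: eq_sw3 => b1 b2 b3; rewrite tmapE [Delta (_ * _)]tlift_eta tlift_conj; last by
      lin_tac.
  rewrite (@lin_tlift _ _ _ _ _ (fun t => idfun (v0 \ot b2) \ot t)); last by lin_tac.
  apply: eq_tlift => c1 c2; rewrite (@lin_tlift _ _ _ _ _ (fun t => idfun (v0 \ot b2) \ot
      t)); last by lin_tac.
  apply: eq_tlift => v1 v2; rewrite (@lin_tlift _ _ _ _ _ (fun t => idfun (v0 \ot b2) \ot
      t)); last by lin_tac.
  by apply: eq_tlift => d1 d2.
rewrite -(@coact_assoc _ _ _ _ (fun v0 v1 v2 => sw3 (fun b1 b2 b3 => sw3 (fun c1 c2 c3 =>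
    F v0 v1 v2 b1 c1 c2 c3 b3) b2) b)); last by rewrite /F; lin_tac.
apply: eq_tlift => x z.
rewrite (@lin_sw3 _ _ _ _ (fun t => tassoc (tmap free_coactl idfun t))); last by lin_tac.
rewrite sw3_tlift; apply: eq_sw3 => b1 b2 b3.
rewrite tmapE mk_linearE free_coactE /=.
rewrite (@lin_tlift _ _ _ _ _ (fun t => tassoc (t \ot _))); last by lin_tac.
apply: eq_tlift => v0 v1; rewrite (@lin_sw3 _ _ _ _ (fun t => tassoc (t \ot _))); last by
    lin_tac.
by apply: eq_sw3 => c1 c2 c3; rewrite tassocE.
Qed.

Lemma free_coactu t : trunit (tmap idfun e (free_coactl t)) = t.
Proof.
move: t; apply: tens_lin_ext; [by lin_tac | exact: lin_id |] => v b.
rewrite mk_linearE free_coactE.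
rewrite (@lin_tlift _ _ _ _ _ (fun t => trunit (tmap idfun e t))); last by lin_tac.
rewrite -[RHS](@coact_counit _ _ V _ (fun v => v \ot b)); last by lin_tac.
apply: eq_tlift => v0 v1.
rewrite (@lin_sw3 _ _ _ _ (fun t => trunit (tmap idfun e t))); last by lin_tac.
rewrite -[in RHS](@comul_counitl _ _ _ (fun x => v0 \ot x)); last by lin_tac.
rewrite [RHS](@lin_tlift _ _ _ _ _ (fun t => (e v1 : k) *: t)); last by lin_tac.
apply: eq_tlift => b1 z.
rewrite -[in RHS](@comul_counitr _ _ _ (fun x => v0 \ot x)); last by lin_tac.
rewrite [RHS](@lin_tlift _ _ _ _ _ (fun t => (e v1 : k) *: ((e b1 : k) *: t))); last by
    lin_tac.
apply: eq_tlift => b2 b3.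
by rewrite tmapE trunitE !counitM counit_antipode !scalerA [(e v1 : k) * _]mulrC.
Qed.

Definition free_comod : comod H := @Comod k H (V \ox H) free_coactl free_coactA
    free_coactu.

Lemma free_ydP (t : free_comod) a : coact free_comod (mact (free_rmod H V) t a) =
  tlift (fun t0 t1 => sw3 (fun a1 a2 a3 =>
    mact (free_rmod H V) t0 a2 \ot (S a1 * t1 * a3)) a) (coact free_comod t).
Proof.
move: t; apply: tens_lin_ext; [by lin_tac | by lin_tac |] => v b.
rewrite free_rmod_mactE [coact _ _]free_coactE [coact free_comod _]free_coactE.
rewrite [RHS](@lin_tlift _ _ _ _ _ (tlift _)); last by lin_tac; apply: tliftP; lin_tac.
apply: eq_tlift => v0 v1; rewrite sw3M; last by lin_tac.
rewrite [RHS](@lin_sw3 _ _ _ _ (tlift _)); last by apply: tliftP; lin_tac.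
apply: eq_sw3 => b1 b2 b3; rewrite tliftE; last by lin_tac.
by apply: eq_sw3 => a1 a2 a3; rewrite free_rmod_mactE antipodeM !mulrA.
Qed.

Definition free_yd : yd H :=
  @Yd k H free_comod (mact (free_rmod H V)) (@mact1 _ _ (free_rmod H V))
    (@mactM _ _ (free_rmod H V)) free_ydP.

Lemma coact_freeE v b : coact free_yd (v \ot b : free_yd) =
  tlift (fun v0 v1 => sw3 (fun b1 b2 b3 => (v0 \ot b2) \ot (S b1 * v1 * b3)) b) (coact V
      v).
Proof. exact: free_coactE. Qed.

Lemma yact_freeE v b a : yact free_yd (v \ot b : free_yd) a = v \ot (b * a).
Proof. exact: free_rmod_actE. Qed.

End Free.
End YetterDrinfeld.

(** * Universal property of free modules; cofree modules and their comparison with free ones *)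

Section Cofree.
Variables (k : fieldType) (H : hopfAlg k).
Implicit Types (V : comod H) (M : yd H) (N : rmod H).
Notation S := (@antipode k H).
Notation e := (@counit k H).
Notation Delta := (@comul k H).

Section FreeExtension.
Variables (V : comod H) (M : yd H) (f : comod_hom V M).

Lemma free_yd_ext_colin (t : free_yd V) :
  coact M (free_ext_fun (N := yd_rmod M) f t) =
  tlift (fun v0 v1 => free_ext_fun (N := yd_rmod M) f v0 \ot v1) (coact (free_yd V) t).
Proof.
move: t; apply: tens_lin_ext => [||v b].
- by lin_tac.
- by lin_tac.
rewrite free_ext_funE [LHS]yactP coact_hom.
rewrite [LHS](@lin_tlift _ _ _ _ _ (tlift _)); last by apply: tliftP; lin_tac.
rewrite coact_freeE [RHS](@lin_tlift _ _ _ _ _ (tlift _)); last by apply: tliftP; lin_tac.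
apply: eq_tlift => v0 v1; rewrite tliftE; last by lin_tac.
rewrite [RHS](@lin_sw3 _ _ _ _ (tlift _)); last by apply: tliftP; lin_tac.
apply: eq_sw3 => b1 b2 b3; rewrite tliftE ?free_ext_funE //.
by lin_tac.
Qed.

Definition free_yd_ext : comod_hom (free_yd V) M :=
  @mk_comod_hom k H (free_yd V) M _ (@free_ext_lin k H V (yd_rmod M) f) free_yd_ext_colin.

Lemma free_yd_extE v a : free_yd_ext (v \ot a : free_yd V) = yact M (f v) a.
Proof. exact: (@free_ext_funE k H V (yd_rmod M) f). Qed.

Lemma free_yd_ext_ydlin : ydlin free_yd_ext.
Proof. exact: (@free_ext_mlin k H V (yd_rmod M) f). Qed.

End FreeExtension.

Definition free_unit V : comod_hom V (free_yd V).
Proof.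
apply: (@mk_comod_hom k H V (free_yd V) (fun v => v \ot 1)); first by lin_tac.
move=> v; rewrite [LHS]coact_freeE; apply: eq_tlift => v0 v1.
by rewrite sw3_one ?antipode1 ?mul1r ?mulr1 //; lin_tac.
Defined.

Lemma free_yd_hom_ext V M (f g : comod_hom (free_yd V) M) : ydlin f -> ydlin g ->
  (forall v, f (v \ot 1 : free_yd V) = g (v \ot 1 : free_yd V)) -> forall t, f t = g t.
Proof.
move=> fl gl fg; apply: tens_lin_ext => [||v a]; try exact: linearP.
have <- : yact (free_yd V) (v \ot 1) a = v \ot a by rewrite yact_freeE mul1r.
by rewrite fl gl fg.
Qed.

Section CofreeComod.
Variable W : lmodType k.

Definition cofree_coact (t : W \ox H) : (W \ox H) \ox H :=
  tlift (fun w x => tlift (fun x1 x2 => (w \ot x1) \ot x2) (Delta x)) t.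

Lemma cofree_coact_lin : lin cofree_coact.
Proof. by rewrite /cofree_coact; lin_tac. Qed.

Lemma cofree_coactE w x :
  cofree_coact (w \ot x) = tlift (fun x1 x2 => (w \ot x1) \ot x2) (Delta x).
Proof. by rewrite /cofree_coact tliftE //; lin_tac. Qed.

Definition cofree_coactl : {linear W \ox H -> (W \ox H) \ox H} := mk_linear
    cofree_coact_lin.

Lemma cofree_coactA t :
  tassoc (tmap cofree_coactl idfun (cofree_coactl t)) = tmap idfun Delta (cofree_coactl
      t).
Proof.
move: t; apply: tens_lin_ext; [by lin_tac | by lin_tac |] => w x.
rewrite mk_linearE cofree_coactE.
rewrite (@lin_tlift _ _ _ _ _ (fun t => tassoc (tmap cofree_coactl idfun t))); last by
    lin_tac.
rewrite [RHS](@lin_tlift _ _ _ _ _ (tmap idfun Delta)); last by lin_tac.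
transitivity (tlift (fun x1 x2 => tlift (fun y1 y2 => (w \ot y1) \ot (y2 \ot x2)) (Delta
    x1)) (Delta x)).
  apply: eq_tlift => x1 x2; rewrite tmapE mk_linearE cofree_coactE.
  rewrite (@lin_tlift _ _ _ _ _ (fun t => tassoc (t \ot _))); last by lin_tac.
  by apply: eq_tlift => y1 y2; rewrite tassocE.
rewrite (@comul_assoc _ _ _ (fun y1 y2 x2 => (w \ot y1) \ot (y2 \ot x2))); last by
    lin_tac.
apply: eq_tlift => x1 x2; rewrite tmapE [Delta x2 in RHS]tlift_eta.
by rewrite (@lin_tlift _ _ _ _ _ (tprod _)); last by lin_tac.
Qed.

Lemma cofree_coactu t : trunit (tmap idfun e (cofree_coactl t)) = t.
Proof.
move: t; apply: tens_lin_ext; [by lin_tac | exact: lin_id |] => w x.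
rewrite mk_linearE cofree_coactE.
rewrite (@lin_tlift _ _ _ _ _ (fun t => trunit (tmap idfun e t))); last by lin_tac.
rewrite -[RHS](@comul_counitr _ _ _ (fun x => w \ot x)); last by lin_tac.
by apply: eq_tlift => x1 x2; rewrite tmapE trunitE.
Qed.

Definition cofree_comod : comod H := @Comod k H (W \ox H) cofree_coactl cofree_coactA
    cofree_coactu.

Lemma coact_cofreeE w x :
  coact cofree_comod (w \ot x) = tlift (fun x1 x2 => (w \ot x1) \ot x2) (Delta x).
Proof. exact: cofree_coactE. Qed.

Definition cofree_counit (t : cofree_comod) : W := tlift (fun w x => (e x : k) *: w) t.

Lemma cofree_counit_lin : lin cofree_counit.
Proof. by rewrite /cofree_counit; lin_tac. Qed.

Lemma cofree_counitE w x : cofree_counit (w \ot x) = (e x : k) *: w.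
Proof. by rewrite /cofree_counit tliftE //; lin_tac. Qed.

Definition cofree_ext V (g : {linear V -> W}) : comod_hom V cofree_comod.
Proof.
apply: (@mk_comod_hom k H V cofree_comod (fun v => tlift (fun v0 v1 => g v0 \ot v1)
    (coact V v))).
  by lin_tac.
move=> v; rewrite lin_tlift; last by lin_tac.
under [LHS]eq_tlift => v0 v1 do rewrite coact_cofreeE.
rewrite -(@coact_assoc _ _ _ _ (fun v0 v1 v2 => (g v0 \ot v1) \ot v2)); last by lin_tac.
apply: eq_tlift => v0 v1; rewrite [RHS](@lin_tlift _ _ _ _ _ (fun t => t \ot v1)) //.
by lin_tac.
Defined.

Lemma cofree_extE V (g : {linear V -> W}) v :
  cofree_ext g v = tlift (fun v0 v1 => g v0 \ot v1) (coact V v).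
Proof. by []. Qed.

Lemma cofree_counit_ext V (g : {linear V -> W}) v : cofree_counit (cofree_ext g v) = g v.
Proof.
rewrite cofree_extE lin_tlift; last exact: cofree_counit_lin.
rewrite -[RHS](@coact_counit _ _ V _ g); last by lin_tac.
by apply: eq_tlift => v0 v1; rewrite cofree_counitE.
Qed.

(** Uniqueness in the universal property of W (x) H: a colinear map is determined by its composite
    with the counit. The formula comes from applying the counit to the first leg of the coaction of
    f v. *)
Lemma cofree_hom_eta V (f : comod_hom V cofree_comod) v :
  f v = tlift (fun v0 v1 => cofree_counit (f v0) \ot v1) (coact V v).
Proof.
pose G (t : (W \ox H) \ox H) := tlift (fun y z => cofree_counit y \ot z) t.
have Gb : bil (fun (y : W \ox H) (z : H) => cofree_counit y \ot z).
  by split=> ? /=; [apply: lin_tprodl; apply: cofree_counit_lin | lin_tac].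
have Gl : lin G by apply: tliftP.
transitivity (G (coact cofree_comod (f v))).
  move: (f v); apply: tens_lin_ext; first exact: lin_id.
    by apply: (@lin_comp _ _ _ _ G) => //; lin_tac.
  move=> w x; rewrite coact_cofreeE (@lin_tlift _ _ _ _ _ G) //.
  rewrite -[LHS](@comul_counitl _ _ _ (fun x => w \ot x)); last by lin_tac.
  apply: eq_tlift => x1 x2; rewrite /G tliftE // cofree_counitE.
  by rewrite (@linZ _ _ _ (fun t => t \ot x2)) //; lin_tac.
rewrite coact_hom (@lin_tlift _ _ _ _ _ G) //; apply: eq_tlift => v0 v1.
by rewrite /G tliftE.
Qed.

Lemma cofree_hom_ext V (f g : comod_hom V cofree_comod) :
  (forall v, cofree_counit (f v) = cofree_counit (g v)) -> forall v, f v = g v.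
Proof. by move=> fg v; rewrite [LHS]cofree_hom_eta [RHS]cofree_hom_eta; apply: eq_tlift
    => v0 v1; rewrite fg. Qed.

End CofreeComod.

Section CofreeYD.
Variable N : rmod H.

(** Dual to [free_coact], and forced likewise: by the compatibility condition and by the requirement
    that the counit N (x) H -> N be a module map. *)
Definition cofree_act (t : N \ox H) (a : H) : N \ox H :=
  tlift (fun n x => sw3 (fun a1 a2 a3 => mact N n a2 \ot (S a1 * x * a3)) a) t.

Lemma cofree_act_bil : bil cofree_act.
Proof. by rewrite /cofree_act; lin_tac. Qed.

Lemma cofree_actE n x a :
  cofree_act (n \ot x) a = sw3 (fun a1 a2 a3 => mact N n a2 \ot (S a1 * x * a3)) a.
Proof. by rewrite /cofree_act tliftE //; lin_tac. Qed.

Lemma cofree_act1 t : cofree_act t 1 = t.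
Proof.
move: t; apply: tens_lin_ext => [||n x]; [exact: cofree_act_bil.1 | exact: lin_id |].
by rewrite cofree_actE sw3_one ?mact1 ?antipode1 ?mul1r ?mulr1 //; lin_tac.
Qed.

Lemma cofree_actM t a b : cofree_act t (a * b) = cofree_act (cofree_act t a) b.
Proof.
move: t; apply: tens_lin_ext => [||n x]; first exact: cofree_act_bil.1.
  exact: (@lin_comp _ _ _ _ (fun t => cofree_act t b) _ (cofree_act_bil.1 b)
      (cofree_act_bil.1 a)).
rewrite !cofree_actE sw3M; last by lin_tac.
rewrite [RHS](@lin_sw3 _ _ _ _ (fun t => cofree_act t b)); last exact: cofree_act_bil.1.
apply: eq_sw3 => a1 a2 a3; rewrite cofree_actE; apply: eq_sw3 => b1 b2 b3.
by rewrite mactM antipodeM !mulrA.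
Qed.

(** Both sides equal the sum of (n a_3 (x) S(a_2) x_1 a_4) (x) S(a_1) x_2 a_5. *)
Lemma cofree_actP (t : cofree_comod N) a : coact (cofree_comod N) (cofree_act t a) =
  tlift (fun t0 t1 => sw3 (fun a1 a2 a3 =>
    cofree_act t0 a2 \ot (S a1 * t1 * a3)) a) (coact (cofree_comod N) t).
Proof.
have cb := cofree_act_bil.
have rb : bil (fun (t0 : N \ox H) t1 => sw3 (fun a1 a2 a3 => cofree_act t0 a2 \ot (S a1 *
    t1 * a3)) a).
  by split=> ? /=; apply: lin_sw3_body => ? ? ?; [apply: lin_tprodl; apply: cb.1 |
      lin_tac].
move: t; apply: tens_lin_ext => [||n x].
- by apply: lin_app; apply: cb.1.
- by apply: lin_tlift_arg => //; lin_tac.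
rewrite cofree_actE coact_cofreeE [RHS](@lin_tlift _ _ _ _ _ (tlift _)); last exact:
    tliftP.
rewrite [LHS]lin_sw3; last by lin_tac.
pose F x1 x2 a1 a2 a3 a4 a5 : (N \ox H) \ox H :=
  (mact N n a3 \ot (S a2 * x1 * a4)) \ot (S a1 * x2 * a5).
transitivity (tlift (fun x1 x2 => sw3 (fun b1 b2 b3 => sw3 (fun c1 c2 c3 =>
    F x1 x2 b1 c1 c2 c3 b3) b2) a) (Delta x)); last first.
  apply: eq_tlift => x1 x2; rewrite tliftE //; apply: eq_sw3 => b1 b2 b3.
  rewrite cofree_actE [RHS](@lin_sw3 _ _ _ _ (fun t => t \ot _)); last by lin_tac.
  exact: eq_sw3.
under [RHS]eq_tlift => x1 x2 do (rewrite (@sw5 _ _ _ (fun y1 y2 y3 y4 y5 => F x1 x2 y1 y2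
    y3 y4 y5)); last by rewrite /F; lin_tac).
rewrite sw3_tlift; apply: eq_sw3 => a1 a2 a3.
rewrite coact_cofreeE tlift_conj; last by lin_tac.
by rewrite [RHS]tlift_exchange.
Qed.

Definition cofree_yd : yd H :=
  @Yd k H (cofree_comod N) (mk_bil cofree_act_bil) cofree_act1 cofree_actM cofree_actP.

Lemma yact_cofreeE n x a : yact cofree_yd (n \ot x) a =
  sw3 (fun a1 a2 a3 => mact N n a2 \ot (S a1 * x * a3)) a.
Proof. exact: cofree_actE. Qed.

Lemma cofree_ext_ydlin M (g : {linear M -> N}) : @mlin _ _ (yd_rmod M) N g ->
  @ydlin _ _ M cofree_yd (cofree_ext g).
Proof.
move=> gl m a; rewrite !cofree_extE [coact _ _]yactP.
rewrite (@lin_tlift _ _ _ _ _ (tlift _)); last by apply: tliftP; lin_tac.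
rewrite [RHS](@lin_tlift _ _ _ _ _ (fun t => yact cofree_yd t a)); last by lin_tac.
apply: eq_tlift => m0 m1; rewrite yact_cofreeE lin_sw3; last by apply: tliftP; lin_tac.
by apply: eq_sw3 => a1 a2 a3; rewrite tliftE ?gl //; lin_tac.
Qed.

Lemma cofree_counit_mlin t a : cofree_counit (yact cofree_yd t a) = mact N (cofree_counit
    t) a.
Proof.
move: t; apply: tens_lin_ext => [||n x].
- by apply: (@lin_comp _ _ _ _ (@cofree_counit N)); [exact: cofree_counit_lin | lin_tac].
- by apply: lin_bilinl; apply: cofree_counit_lin.
rewrite yact_cofreeE lin_sw3; last exact: cofree_counit_lin.
rewrite cofree_counitE (@linZ _ _ _ (fun t => mact N t a)); last by lin_tac.
rewrite -(@comul_counitl _ _ _ (fun a => (e x : k) *: mact N n a)); last by lin_tac.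
apply: eq_tlift => a1 z.
rewrite -[in RHS](@comul_counitr _ _ _ (fun z => (e x : k) *: mact N n z)); last by
    lin_tac.
rewrite lin_tlift; last by lin_tac.
apply: eq_tlift => a2 a3; rewrite cofree_counitE !counitM counit_antipode !scalerA.
by rewrite mulrAC.
Qed.

End CofreeYD.

Section FreeIsCofree.
Hypothesis S_bij : bijective S.
Variable W : lmodType k.

Let Fr := free_yd (cofree_comod W).
Let Co := cofree_yd (free_rmod H W).

Lemma theta_lin : lin (fun t : W \ox H => tlift (fun w x => (w \ot 1) \ot x : Co) t).
Proof. by lin_tac. Qed.

Lemma theta_colin (t : cofree_comod W) :
  coact Co (tlift (fun w x => (w \ot 1) \ot x : Co) t) =
  tlift (fun t0 t1 => tlift (fun w x => (w \ot 1) \ot x : Co) t0 \ot t1) (coact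
      (cofree_comod W) t).
Proof.
move: t; apply: tens_lin_ext; [by lin_tac | by lin_tac |] => w x.
rewrite coact_cofreeE tliftE; last by lin_tac.
rewrite [LHS]coact_cofreeE [RHS](@lin_tlift _ _ _ _ _ (tlift _)); last by apply: tliftP;
    lin_tac.
apply: eq_tlift => x1 x2; rewrite tliftE; last by lin_tac.
by rewrite tliftE; lin_tac.
Qed.

Definition theta : comod_hom Fr Co :=
  free_yd_ext (@mk_comod_hom _ _ (cofree_comod W) Co _ theta_lin theta_colin).

Lemma theta_ydlin : ydlin theta.
Proof. exact: free_yd_ext_ydlin. Qed.

Lemma thetaE w x a : theta ((w \ot x) \ot a : Fr) =
  sw3 (fun a1 a2 a3 => (w \ot a2) \ot (S a1 * x * a3)) a.
Proof.
rewrite [LHS]free_yd_extE mk_linearE tliftE; last by lin_tac.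
by rewrite yact_cofreeE; apply: eq_sw3 => a1 a2 a3; rewrite free_rmod_mactE mul1r.
Qed.

(** [theta] moves a into the module factor while conjugating x into S(a_1) x a_3. Its inverse undoes
    this by S^2 on the left and by the inverse antipode on the right. *)
Lemma theta_inverse : exists t : comod_hom Co Fr,
  [/\ ydlin t, cancel theta t & cancel t theta].
Proof.
case: S_bij => S' SK S'K.
have S'lin : lin S' by move=> c x y; apply: (can_inj SK); rewrite linearP /= !S'K.
pose Si := mk_linear S'lin.
have SiK x : S (Si x) = x by apply: S'K.
have SKi x : Si (S x) = x by apply: SK.
have SiM x y : Si (x * y) = Si y * Si x.
  by apply: (can_inj SK); rewrite antipodeM !SiK.
have Si1 : Si 1 = 1 by rewrite -[in LHS](antipode1 H) SKi.
(* Four cancellation rules, obtained by applying the antimultiplicative maps S and S^(-1) to the two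
   antipode axioms. *)
have cancelS2l (U : lmodType k) (f : H -> U) a : lin f ->
    tlift (fun u w => f (S w * S (S u))) (Delta a) = (e a : k) *: f 1.
  move=> fl; rewrite -(antipode1 H) -(@cancel_Sl _ _ _ (fun x => f (S x))); last first.
    by apply: lin_comp fl _; lin_tac.
  by apply: eq_tlift => u w; rewrite antipodeM.
have cancelS2r (U : lmodType k) (f : H -> U) a : lin f ->
    tlift (fun u w => f (S (S w) * S u)) (Delta a) = (e a : k) *: f 1.
  move=> fl; rewrite -(antipode1 H) -(@cancel_Sr _ _ _ (fun x => f (S x))); last first.
    by apply: lin_comp fl _; lin_tac.
  by apply: eq_tlift => u w; rewrite antipodeM.
have cancelSil (U : lmodType k) (f : H -> U) a : lin f ->
    tlift (fun u w => f (Si w * u)) (Delta a) = (e a : k) *: f 1.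
  move=> fl; rewrite -Si1 -(@cancel_Sl _ _ _ (fun x => f (Si x))); last first.
    by apply: lin_comp fl _; lin_tac.
  by apply: eq_tlift => u w; rewrite SiM SKi.
have cancelSir (U : lmodType k) (f : H -> U) a : lin f ->
    tlift (fun u w => f (w * Si u)) (Delta a) = (e a : k) *: f 1.
  move=> fl; rewrite -Si1 -(@cancel_Sr _ _ _ (fun x => f (Si x))); last first.
    by apply: lin_comp fl _; lin_tac.
  by apply: eq_tlift => u w; rewrite SiM SKi.
(* Since S(b_2) S^2(b_1) and S^(-1)(b_2) b_1 both reduce to the counit, x has to be sent to S^2(b_1)
   x S^(-1)(b_3). *)
pose T0 (wb : W \ox H) (x : H) : Fr := tlift (fun w b => sw3 (fun b1 b2 b3 =>
  (w \ot (S (S b1) * x * Si b3)) \ot b2) b) wb.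
have T0b : bil T0 by rewrite /T0; lin_tac.
pose T (t : Co) : Fr := tlift T0 t.
have Tlin : lin T by apply: tliftP.
have TE w b x : T ((w \ot b) \ot x) =
    sw3 (fun b1 b2 b3 => (w \ot (S (S b1) * x * Si b3)) \ot b2) b.
  by rewrite /T tliftE // /T0 tliftE //; lin_tac.
have epsE (U : lmodType k) (f : H -> U) a : lin f ->
    sw3 (fun a1 a2 a3 => (e a3 : k) *: ((e a1 : k) *: f a2)) a = f a.
  move=> fl; rewrite -[RHS](@comul_counitl _ _ _ f) //; apply: eq_tlift => a1 z.
  rewrite -[in RHS](@comul_counitr _ _ _ f) // [RHS](@lin_tlift _ _ _ _ _ ( *:%R _));
      last by lin_tac.
  by apply: eq_tlift => a2 a3; rewrite !scalerA mulrC.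
have thetaT : cancel T theta.
  move=> t; move: t; apply: tens_lin_ext; [by lin_tac | exact: lin_id |] => wb x.
  move: wb; apply: tens_lin_ext; [| by lin_tac |].
    by apply: lin_app; apply: (@lin_comp _ _ _ _ T) => //; lin_tac.
  move=> w b; rewrite TE (@lin_sw3 _ _ _ _ theta); last exact: linearP.
  transitivity (sw3 (fun b1 b2 b3 => sw3 (fun c1 c2 c3 =>
      (w \ot c2) \ot (S c1 * (S (S b1) * x * Si b3) * c3)) b2) b).
    by apply: eq_sw3 => b1 b2 b3; rewrite thetaE.
  (* After regrouping, the two leftmost and the two rightmost of the five factors form coproducts of
     their own; the left pair cancels by [cancelS2l], the right one by [cancelSil]. *)
  rewrite (@sw5 _ _ _ (fun b1 c1 c2 c3 b3 => (w \ot c2) \ot (S c1 * (S (S b1) * x * Si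
      b3) * c3))); last by lin_tac.
  rewrite -[RHS](@epsE _ (fun b => (w \ot b) \ot x)); last by lin_tac.
  apply: eq_sw3 => b1 b2 b3.
  transitivity (tlift (fun c1 c2 => (e b3 : k) *: ((w \ot b2) \ot (S c2 * S (S c1) * x *
      1))) (Delta b1)).
    apply: eq_tlift => c1 c2.
    rewrite -(@cancelSil _ (fun y => (w \ot b2) \ot (S c2 * S (S c1) * x * y))); last by
        lin_tac.
    by apply: eq_tlift => d1 d2; rewrite !mulrA.
  rewrite (@cancelS2l _ (fun y => (e b3 : k) *: ((w \ot b2) \ot (y * x * 1)))); last by
      lin_tac.
  by rewrite mul1r mulr1 !scalerA mulrC.
have Ttheta : cancel theta T.
  move=> t; move: t; apply: tens_lin_ext; [| exact: lin_id |] => [|wx a].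
    by apply: (@lin_comp _ _ _ _ T) => //; lin_tac.
  move: wx; apply: tens_lin_ext; [| by lin_tac |].
    by apply: (@lin_comp _ _ _ _ T) => //; lin_tac.
  move=> w x; rewrite thetaE (@lin_sw3 _ _ _ _ T) //.
  transitivity (sw3 (fun b1 b2 b3 => sw3 (fun c1 c2 c3 =>
      (w \ot (S (S c1) * (S b1 * x * b3) * Si c3)) \ot c2) b2) a).
    by apply: eq_sw3 => b1 b2 b3; rewrite TE.
  rewrite (@sw5 _ _ _ (fun b1 c1 c2 c3 b3 => (w \ot (S (S c1) * (S b1 * x * b3) * Si c3))
      \ot c2)); last by lin_tac.
  rewrite -[RHS](@epsE _ (fun b => (w \ot x) \ot b)); last by lin_tac.
  apply: eq_sw3 => b1 b2 b3.
  transitivity (tlift (fun c1 c2 => (e b3 : k) *: ((w \ot (S (S c2) * S c1 * x * 1)) \ot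
      b2)) (Delta b1)).
    apply: eq_tlift => c1 c2.
    rewrite -(@cancelSir _ (fun y => (w \ot (S (S c2) * S c1 * x * y)) \ot b2)); last by
        lin_tac.
    by apply: eq_tlift => d1 d2; rewrite !mulrA.
  rewrite (@cancelS2r _ (fun y => (e b3 : k) *: ((w \ot (y * x * 1)) \ot b2))); last by
      lin_tac.
  by rewrite mul1r mulr1 !scalerA mulrC.
have Tcolin t : coact Fr (T t) = tlift (fun t0 t1 => T t0 \ot t1) (coact Co t).
  rewrite -[t in RHS]thetaT coact_hom.
  rewrite (@lin_tlift _ _ _ _ _ (tlift _)); last first.
    apply: tliftP; split=> ? /=; last by lin_tac.
    by apply: lin_tprodl.
  rewrite [LHS]tlift_eta; apply: eq_tlift => t0 t1; rewrite tliftE ?Ttheta //.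
  by split=> ? /=; [apply: lin_tprodl | lin_tac].
exists (mk_comod_hom Tlin Tcolin); split=> // t a.
apply: (can_inj Ttheta).
exact: etrans (thetaT _) (esym (etrans (theta_ydlin _ _) (congr1 (fun u => yact Co u a)
    (thetaT t)))).
Qed.

End FreeIsCofree.
End Cofree.

(** * Resolutions of the unit Yetter-Drinfeld module *)

Section YDResolutions.
Variables (k : fieldType) (H : hopfAlg k).
Implicit Types (V W : comod H) (M N P Q : yd H).
Notation S := (@antipode k H).
Notation e := (@counit k H).
Notation Delta := (@comul k H).

Lemma comod_hom0E V W x : (0 : comod_hom V W) x = 0.
Proof. by []. Qed.
Lemma comod_homDE V W (f g : comod_hom V W) x : (f + g) x = f x + g x.
Proof. by []. Qed.
Lemma comod_homBE V W (f g : comod_hom V W) x : (f - g) x = f x - g x.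
Proof. by rewrite -scaleN1r. Qed.

Lemma ydlin_id M : ydlin (comod_id M).
Proof. by []. Qed.

Lemma ydlin_comp M N P (f : comod_hom N P) (g : comod_hom M N) :
  ydlin f -> ydlin g -> ydlin (comod_comp f g).
Proof. by move=> fl gl m a /=; rewrite gl fl. Qed.

Lemma ydlinB M N (f g : comod_hom M N) : ydlin f -> ydlin g -> ydlin (f - g).
Proof. by move=> fl gl m a; rewrite !comod_homBE fl gl linearBl. Qed.

Definition yd_iso M N : Prop :=
  exists (f : comod_hom M N) (g : comod_hom N M),
    [/\ ydlin f, ydlin g, comod_comp g f = comod_id M & comod_comp f g = comod_id N].

(** Projectivity relative to the Yetter-Drinfeld morphisms [p] having a section [s] that is colinear
    but need not respect the actions. *)
Definition relproj P : Prop :=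
  forall M N (p : comod_hom M N) (s : comod_hom N M) (f : comod_hom P N),
    ydlin p -> comod_comp p s = comod_id N -> ydlin f ->
    exists2 g : comod_hom P M, ydlin g & comod_comp p g = f.

(** A colinear splitting is asked of embeddings into Yetter-Drinfeld modules only. This keeps the
    notion within the data that a [yd_equiv] transports. *)
Definition relinj Q : Prop :=
  forall M (i : comod_hom Q M), ydlin i -> injective i ->
  exists r : comod_hom M Q, comod_comp r i = comod_id Q.

Lemma free_relproj V : relproj (free_yd V).
Proof.
move=> M N p s f pl ps fl.
pose g := free_yd_ext (comod_comp s (comod_comp f (free_unit V))).
exists g; first exact: free_yd_ext_ydlin.
apply: comod_hom_ext; apply: free_yd_hom_ext => //.
  by apply: ydlin_comp => //; apply: free_yd_ext_ydlin.
move=> v; rewrite -[LHS]/(p (g (v \ot 1 : free_yd V))) free_yd_extE yact1.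
exact: (congr1 (fun h : comod_hom N N => h (f (v \ot 1 : free_yd V))) ps).
Qed.

Definition free_counit M : comod_hom (free_yd M) M := free_yd_ext (comod_id M).

Lemma free_counit_ydlin M : ydlin (free_counit M).
Proof. exact: free_yd_ext_ydlin. Qed.

Lemma free_counit_unit M : comod_comp (free_counit M) (free_unit M) = comod_id M.
Proof.
apply: comod_hom_ext => m.
by rewrite -[LHS]/(free_counit M (m \ot 1 : free_yd M)) free_yd_extE yact1.
Qed.

Definition free_map V W (f : comod_hom V W) : comod_hom (free_yd V) (free_yd W) :=
  free_yd_ext (comod_comp (free_unit W) f).

Lemma free_map_ydlin V W (f : comod_hom V W) : ydlin (free_map f).
Proof. exact: free_yd_ext_ydlin. Qed.

Lemma free_map1 V W (f : comod_hom V W) v :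
  free_map f (v \ot 1 : free_yd V) = (f v \ot 1 : free_yd W).
Proof. by rewrite [LHS]free_yd_extE yact1. Qed.

Lemma free_map_section V W (f : comod_hom V W) (g : comod_hom W V) :
  comod_comp g f = comod_id V ->
  comod_comp (free_map g) (free_map f) = comod_id (free_yd V).
Proof.
move=> gf; apply: comod_hom_ext; apply: free_yd_hom_ext => //.
  by apply: ydlin_comp; apply: free_map_ydlin.
move=> v; rewrite -[LHS]/(free_map g (free_map f (v \ot 1 : free_yd V))) !free_map1.
by have /(congr1 (fun h : comod_hom V V => h v)) /= -> := gf.
Qed.

Lemma relproj_retract P : relproj P ->
  exists2 i : comod_hom P (free_yd P), ydlin i & comod_comp (free_counit P) i = comod_id
      P.
Proof.
move=> projP; apply: projP (free_counit_unit P) _; last exact: ydlin_id.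
exact: free_counit_ydlin.
Qed.

Definition ucomod_act (c : k^o) (a : H) : k^o := (e a : k) *: c.

Lemma ucomod_act_bil : bil ucomod_act.
Proof.
by rewrite /ucomod_act; split=> ?; [apply: lin_scaler | apply: lin_scalel; lin_tac].
Qed.

Definition unit_yd : yd H.
Proof.
refine (@Yd k H (ucomod H) (mk_bil ucomod_act_bil) _ _ _).
- by move=> c; rewrite /= /ucomod_act counit1 scale1r.
- by move=> c a b; rewrite /= /ucomod_act counitM scalerA mulrC.
- move=> c a; rewrite -[LHS]/(((e a : k) *: c) \ot 1) -[coact _ _]/(c \ot 1) tliftE; last
    first.
    split=> ? /=; apply: lin_sw3_body => ? ? ?; last by lin_tac.
    by apply: lin_tprodl; apply: ucomod_act_bil.1.
  transitivity (tlift (fun a1 z => c \ot (S a1 * z)) (Delta a)).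
    rewrite (@cancel_Sl _ _ _ (fun x => c \ot x)); last by lin_tac.
    by rewrite linearZl_LR.
  apply: eq_tlift => a1 z; rewrite -[LHS](@comul_counitl _ _ _ (fun z => c \ot (S a1 *
      z))); last by lin_tac.
  by apply: eq_tlift => a2 a3; rewrite /= /ucomod_act mulr1 linearZl_LR.
Defined.

(** The resolved unit object sits in index 0, so homological degree m is index m + 1. The
    contraction [yr_h] is colinear, which makes it survive an equivalence that respects colinear
    maps. *)
Record yd_res := YdRes {
  yr : nat -> yd H;
  yr_d : forall i, comod_hom (yr i.+1) (yr i);
  yr_h : forall i, comod_hom (yr i) (yr i.+1);
  yr_unit : yd_iso (yr 0) unit_yd;
  yr_relproj : forall i, relproj (yr i.+1);
  yr_ydlin : forall i, ydlin (yr_d i);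
  yr_dh0 : comod_comp (yr_d 0) (yr_h 0) = comod_id _;
  yr_dh : forall i, comod_comp (yr_d i.+1) (yr_h i.+1) + comod_comp (yr_h i) (yr_d i) =
      comod_id _;
  yr_dd : forall i, comod_comp (yr_d i) (yr_d i.+1) = 0
}.

Fixpoint bar i : yd H := if i is j.+1 then free_yd (bar j) else unit_yd.

(** On generators d (v (x) 1) = v - d v (x) 1, that is, d h = 1 - h d for the unit h: the
    differential is the Yetter-Drinfeld map for which h is a contraction. *)
Fixpoint bar_d i : comod_hom (bar i.+1) (bar i) :=
  match i return comod_hom (bar i.+1) (bar i) with
  | 0 => free_counit (bar 0)
  | j.+1 => free_counit (bar j.+1) - free_map (bar_d j)
  end.

Definition bar_h i : comod_hom (bar i) (bar i.+1) := free_unit (bar i).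

Lemma bar_d_ydlin i : ydlin (bar_d i).
Proof.
case: i => [|i]; first exact: free_counit_ydlin.
by apply: ydlinB; [exact: free_counit_ydlin | exact: free_map_ydlin].
Qed.

Lemma bar_dh0 : comod_comp (bar_d 0) (bar_h 0) = comod_id _.
Proof. exact: free_counit_unit. Qed.

Lemma bar_d1 i v : bar_d i.+1 (v \ot 1 : bar i.+2) = v - ((bar_d i v \ot 1) : bar i.+1).
Proof.
rewrite [LHS]comod_homBE free_map1; congr (_ - _).
by rewrite [LHS]free_yd_extE yact1.
Qed.

Lemma bar_dh i :
  comod_comp (bar_d i.+1) (bar_h i.+1) + comod_comp (bar_h i) (bar_d i) = comod_id _.
Proof.
by apply: comod_hom_ext => v; rewrite [LHS]comod_homDE [X in X + _]bar_d1 subrK.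
Qed.

(* On the generators v (x) 1 this reads d v - d h (d v), which vanishes because
   d h = 1 - h d and, by induction, d (d v) = 0. *)
Lemma bar_dd i : comod_comp (bar_d i) (bar_d i.+1) = 0.
Proof.
have ddl j : ydlin (comod_comp (bar_d j) (bar_d j.+1)).
  by apply: (@ydlin_comp (bar j.+2) (bar j.+1)); apply: bar_d_ydlin.
have ext j M (f : comod_hom (bar j.+1) M) : ydlin f ->
    (forall v : bar j, f (v \ot 1 : bar j.+1) = 0) -> f = 0.
  move=> fl f1; apply: comod_hom_ext; apply: (@free_yd_hom_ext _ _ (bar j) M f 0) => //.
  by move=> m a; rewrite !comod_hom0E linear0l.
elim: i => [|i IHi]; apply: ext (ddl _) _.
- move=> v; rewrite -[LHS]/(bar_d 0 (bar_d 1 (v \ot 1 : bar 2))) bar_d1 linearB.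
  have /(congr1 (fun h : comod_hom _ _ => h (bar_d 0 v))) := bar_dh0.
  by rewrite /= -/bar => ->; rewrite subrr.
- move=> v; rewrite -[LHS]/(bar_d i.+1 (bar_d i.+2 (v \ot 1 : bar i.+3))) bar_d1 linearB.
  have /(congr1 (fun h : comod_hom _ _ => h (bar_d i.+1 v))) := bar_dh i.
  have /(congr1 (fun h : comod_hom _ _ => h v)) := IHi.
  rewrite -[X in X = _ -> _]/(bar_d i (bar_d i.+1 v)) comod_hom0E.
  rewrite [X in _ -> X = _ -> _]comod_homDE -[X in _ -> _ + X = _ -> _]/(bar_h i (bar_d i
      (bar_d i.+1 v))).
  move=> ->; rewrite linear0 addr0 => E.
  rewrite -[X in _ - X]/(comod_comp (bar_d i.+1) (bar_h i.+1) (bar_d i.+1 v)) E.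
  by rewrite subrr.
Qed.

Definition bar_res : yd_res.
Proof.
apply: (@YdRes bar bar_d bar_h _ _ (@bar_d_ydlin) bar_dh0 bar_dh bar_dd).
- exists (comod_id unit_yd), (comod_id unit_yd).
  by split=> //; apply: comod_hom_ext.
- by move=> i; apply: free_relproj.
Defined.

End YDResolutions.

(** * Kernels of Yetter-Drinfeld morphisms *)

Section YDKernel.
Variables (k : fieldType) (H : hopfAlg k) (M N : yd H) (f : comod_hom M N).
Hypothesis fl : ydlin f.
Notation S := (@antipode k H).

(* For a generalized inverse g of f, 1 - g f is a linear projection onto the
   kernel K of f, along which the coaction of M is pushed to K (x) H. *)
Lemma yd_kernel : exists (K : yd H) (i : comod_hom K M),
  [/\ ydlin i, comod_comp f i = 0 & forall x, f x = 0 -> exists y, i y = x].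
Proof.
have [g gP] := generalized_inverse f.
pose i := ker_incl f.
have i_inj : injective i by move=> x y; apply: ker_ext.
have fi x : f (i x) = 0 by apply: ker_valP.
have p0 x : f (x - g (f x)) = 0 by rewrite linearB /= gP subrr.
have plin : lin (fun x => ker_in (p0 x)).
  move=> c u v; apply: i_inj; rewrite [RHS]linearP.
  suff: lin (fun x => x - g (f x)) by apply.
  by lin_tac.
pose p := mk_linear plin.
have ip x : i (p x) = x - g (f x) by [].
have pi x : p (i x) = x by apply: i_inj; rewrite ip fi linear0 subr0.
(* The coaction of M maps the kernel K into K (x) H: as f is colinear, f x_0 (x) x_1 vanishes for x
   in K, so replacing x_0 by its projection x_0 - g (f x_0) changes nothing. *)
have ipE (U : lmodType k) (F : M -> H -> U) x : bil F ->
    tlift (fun x0 x1 => F (i (p x0)) x1) (coact M (i x)) = tlift F (coact M (i x)).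
  move=> Fb; have [F1 F2] := Fb.
  pose G (t : N \ox H) := tlift (fun y z => F (g y) z) t.
  have Gl : lin G.
    by apply: tliftP; split=> ? /=; [apply: lin_comp (F1 _) _; lin_tac | apply: F2].
  have : G (coact N (f (i x))) = 0 by rewrite fi linear0 -(mk_linearE Gl) linear0.
  rewrite coact_hom (@lin_tlift _ _ _ _ _ G) // => G0.
  rewrite -[RHS]subr0 -[X in _ - X]G0 /tlift /tens_sum -sumrB; apply: eq_bigr => q _.
  rewrite ip /G tliftE; last by split=> ? /=; [apply: lin_comp (F1 _) _; lin_tac | apply:
      F2].
  by rewrite -[F (_ - _) _]/(mk_linear (F1 _) (_ - _)) linearB.
pose c x := tlift (fun x0 x1 => p x0 \ot x1) (coact M (i x)).
have clin : lin c by rewrite /c; lin_tac.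
pose cl := mk_linear clin.
have cE (U : lmodType k) (F : ker f -> H -> U) x : bil F ->
    tlift F (cl x) = tlift (fun x0 x1 => F (p x0) x1) (coact M (i x)).
  move=> Fb; rewrite mk_linearE /c (@lin_tlift _ _ _ _ _ (tlift F)); last exact: tliftP.
  by apply: eq_tlift => x0 x1; rewrite tliftE.
have cA x : tassoc (tmap cl idfun (cl x)) = tmap idfun (@comul k H) (cl x).
  rewrite !tmap_tlift (@lin_tlift _ _ _ _ _ (@tassoc _ _ _ _)); last exact: linearP.
  rewrite [RHS]cE ?[LHS]cE; try by lin_tac.
  rewrite [RHS](_ : _ = tlift (fun x0 z => tlift (fun x1 x2 => p x0 \ot (x1 \ot x2))
      (@comul k H z)) (coact M (i x))); last first.
    apply: eq_tlift => x0 z; rewrite /= {1}[@comul k H z]tlift_eta.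
    by rewrite (@lin_tlift _ _ _ _ _ (tprod _)); lin_tac.
  rewrite -(@coact_assoc _ _ _ _ (fun x0 x1 x2 => p x0 \ot (x1 \ot x2))); last by lin_tac.
  rewrite -(@ipE _ (fun y z => tlift (fun x0 x1 => p x0 \ot (x1 \ot z)) (coact M y)));
      last by lin_tac.
  apply: eq_tlift => x0 x1; rewrite mk_linearE /c.
  rewrite (@lin_tlift _ _ _ _ _ (fun t => tassoc (t \ot _))); last by lin_tac.
  by apply: eq_tlift => y0 y1; rewrite tassocE.
have cu x : trunit (tmap idfun (@counit k H) (cl x)) = x.
  rewrite !tmap_tlift (@lin_tlift _ _ _ _ _ (@trunit _ _)); last exact: linearP.
  rewrite cE; last by lin_tac.
  rewrite -[RHS]pi -[RHS](@coact_counit _ _ M _ p); last by lin_tac.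
  by apply: eq_tlift => x0 x1; rewrite trunitE.
pose KC := Comod cA cu.
have a0 x a : f (yact M (i x) a) = 0 by rewrite fl fi linear0l.
pose act (x : KC) a : KC := ker_in (a0 x a).
have actE x a : i (act x a) = yact M (i x) a by [].
have actb : bil act.
  by split=> [a|x] u v w; apply: i_inj; rewrite [RHS]linearP /= (linearPl, linearPr).
have [actl actlE] : exists actl : {bilinear KC -> H -> KC},
    forall x a, i (actl x a) = yact M (i x) a by exists (mk_bil actb).
have act1 (x : KC) : actl x 1 = x by apply: i_inj; rewrite actlE yact1.
have actM (x : KC) a b : actl x (a * b) = actl (actl x a) b.
  by apply: i_inj; rewrite !actlE yactM.
have actP (x : KC) a : coact KC (actl x a) = tlift (fun x0 x1 => sw3 (fun a1 a2 a3 =>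
    actl x0 a2 \ot (S a1 * x1 * a3)) a) (coact KC x).
  rewrite [RHS]cE; last by lin_tac.
  rewrite -[LHS]/(c (actl x a)) /c actlE yactP (@lin_tlift _ _ _ _ _ (tlift _)); last by
      apply: tliftP; lin_tac.
  rewrite -(@ipE _ (fun y z => tlift (fun x0 x1 => p x0 \ot x1) (sw3 (fun a1 a2 a3 =>
    yact M y a2 \ot (S a1 * z * a3)) a))); last by split=> ? /=; apply: lin_tlift_arg;
        lin_tac.
  apply: eq_tlift => x0 x1; rewrite lin_sw3; last by apply: tliftP; lin_tac.
  apply: eq_sw3 => a1 a2 a3; rewrite tliftE; last by lin_tac.
  by rewrite -actlE pi.
pose K := Yd act1 actM actP.
have ilin : lin (fun x : K => i x) by move=> *; apply: linearP.
have icolin (x : K) : coact M (i x) = tlift (fun x0 x1 => i x0 \ot x1) (coact K x).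
  rewrite [RHS]cE; last by lin_tac.
  rewrite (@ipE _ (fun y z => y \ot z)); last by lin_tac.
  exact: tlift_eta.
exists K, (@mk_comod_hom _ _ K M _ ilin icolin); split.
- by move=> x a; apply: actlE.
- by apply: comod_hom_ext => x; apply: fi.
- by move=> x fx; exists (ker_in fx).
Qed.

End YDKernel.

(** * Splitting properties that characterise retracts of cofree modules *)

Section CofreeTarget.
Variables (k : fieldType) (H : hopfAlg k).
Implicit Types (M N P Q : yd H).

(** A linear retraction of [i], followed by the counit, extends to a colinear map into the cofree
    comodule. It is a retraction because colinear maps there are tested on the counit. *)
Lemma cofree_relinj (N : rmod H) : relinj (cofree_yd N).
Proof.
move=> M i _ i_inj; have [g gP] := generalized_inverse i.
have gK x : g (i x) = x by apply: i_inj; rewrite gP.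
have glin : lin (fun m => cofree_counit (g m)).
  by apply: (@lin_comp _ _ _ _ (@cofree_counit _ _ N)); [exact: cofree_counit_lin |
      lin_tac].
exists (cofree_ext (mk_linear glin)); apply: comod_hom_ext.
apply: (@cofree_hom_ext _ _ N (cofree_yd N) _ (comod_id _)) => t.
by rewrite [LHS](cofree_counit_ext (V := M)) mk_linearE gK.
Qed.

Lemma cofree_free_relproj (W : lmodType k) :
  bijective (@antipode k H) -> relproj (cofree_yd (free_rmod H W)).
Proof.
move=> S_bij M N p s f pl ps fl; have [t [tl thK tK]] := theta_inverse S_bij W.
have thl := @theta_ydlin k H W.
have [g gl pg] := free_relproj pl ps (ydlin_comp fl thl).
exists (comod_comp g t); first exact: ydlin_comp gl tl.
apply: comod_hom_ext => x.
exact: etrans (congr1 (fun h : comod_hom _ _ => h (t x)) pg) (congr1 f (tK x)).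
Qed.

(** The coaction [eta] embeds Q into C(Q), with a retraction [r] that is only colinear. Freeness
    turns it into a Yetter-Drinfeld retraction of L(Q) -> L(Q (x) H), whose target is C(Q (x) H) by
    [theta]; and Q is a retract of L(Q) by relative projectivity. *)
Lemma retract_of_cofree Q : bijective (@antipode k H) -> relproj Q -> relinj Q ->
  exists (N : rmod H) (i : comod_hom Q (cofree_yd N)) (r : comod_hom (cofree_yd N) Q),
    [/\ ydlin i, ydlin r & comod_comp r i = comod_id Q].
Proof.
move=> S_bij projQ injQ.
pose eta : comod_hom Q (cofree_yd (yd_rmod Q)) := @cofree_ext k H Q Q (mk_linear (@lin_id
    k Q)).
have etal : ydlin eta by apply: (@cofree_ext_ydlin k H (yd_rmod Q) Q (mk_linear (@lin_id
    k Q))).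
have eta_inj : injective eta.
  by move=> x y /(congr1 (@cofree_counit k H Q)); rewrite !cofree_counit_ext.
have [r rK] := injQ _ _ etal eta_inj.
have [s sl sK] := relproj_retract projQ.
have [t [tl thK tK]] := theta_inverse S_bij Q.
(* The target is now a mere comodule, as [free_map] and [theta] require. *)
pose eta' : comod_hom Q (cofree_comod H Q) := eta.
pose r' : comod_hom (cofree_comod H Q) Q := r.
exists (free_rmod H Q), (comod_comp (theta H Q) (comod_comp (free_map eta') s)),
  (comod_comp (free_counit Q) (comod_comp (free_map r') t)); split.
- apply: (@ydlin_comp _ _ _ (free_yd (cofree_comod H Q))); first exact: theta_ydlin.
  by apply: ydlin_comp sl; apply: free_map_ydlin.
- apply: (@ydlin_comp _ _ _ (free_yd Q)); first exact: free_counit_ydlin.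
  by apply: (@ydlin_comp _ _ _ (free_yd (cofree_comod H Q))) tl; apply: free_map_ydlin.
- apply: comod_hom_ext => x.
  rewrite -[LHS]/(free_counit Q (free_map r' (t (theta H Q (free_map eta' (s x)))))) thK.
  have /(congr1 (fun h : comod_hom _ _ => h (s x))) := free_map_section (f := eta') (g :=
      r') rK.
  rewrite -[LHS]/(free_map r' (free_map eta' (s x))) => ->.
  by have /(congr1 (fun h : comod_hom _ _ => h x)) := sK.
Qed.

End CofreeTarget.

(** * Cocycles of the induced resolutions *)

Section Resolution.
Variables (k : fieldType) (H : hopfAlg k).
Notation S := (@antipode k H).
Notation e := (@counit k H).
Notation Delta := (@comul k H).

Lemma bimod_hom_ad (M N : bimod H) (f : bimod_hom M N) m a :
  f (ad_act m a) = ad_act (f m) a.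
Proof.
rewrite /ad_act lin_tlift; last exact: linearP.
by apply: eq_tlift => a1 a2; rewrite bimod_homr bimod_homl.
Qed.

Section IndMap.
Variables (N N' : rmod H) (f : {linear N -> N'}) (fP : @mlin _ _ N N' f).

Lemma ind_map_lin : lin (fun n => 1 \ot f n : ind N').
Proof. by lin_tac. Qed.

Lemma ind_map_ad n a :
  mk_linear ind_map_lin (mact N n a) = ad_act (mk_linear ind_map_lin n) a.
Proof. by rewrite !mk_linearE ind_ad fP. Qed.

Definition ind_map : bimod_hom (ind N) (ind N') := ind_ext ind_map_ad.

Lemma ind_map1 n : ind_map (1 \ot n : ind N) = (1 \ot f n : ind N').
Proof. by rewrite [LHS]ind_extE. Qed.

Lemma ind_mapE (t : ind N) : ind_map t = tmap idfun f t.
Proof.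
move: t; apply: tens_lin_ext; [by lin_tac | by lin_tac |] => x n.
by rewrite -ind_lact1 bimod_homl ind_map1 !ind_lact1 tmapE.
Qed.

End IndMap.

Definition ind_counit (N : rmod H) (t : ind N) : N := tlift (fun x n => (e x : k) *: n) t.

Lemma ind_counit_lin N : lin (@ind_counit N).
Proof. by rewrite /ind_counit; lin_tac. Qed.

Lemma ind_counitE (N : rmod H) x (n : N) : ind_counit (x \ot n : ind N) = (e x : k) *: n.
Proof. by rewrite /ind_counit tliftE //; lin_tac. Qed.

(** With [ind_ad] this makes N a module retract of [ad (ind N)], so that cocycles with values in N
    can be studied in the bimodule [ind N]. *)
Lemma ind_counit_ad (N : rmod H) (t : ind N) a :
  ind_counit (ad_act t a) = mact N (ind_counit t) a.
Proof.
have il := @ind_counit_lin N.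
move: t; apply: tens_lin_ext => [||x n].
- apply: (@lin_comp _ _ _ _ (@ind_counit N)) => //; exact: (ad_act_bil (ind N)).1.
- by apply: lin_bilinl.
rewrite /ad_act lin_tlift // ind_counitE (@linZ _ _ _ (fun t => mact N t a)); last by
    lin_tac.
rewrite -(@comul_counitl _ _ _ (fun a => (e x : k) *: mact N n a)); last by lin_tac.
apply: eq_tlift => a1 z; rewrite lact_indE ract_indE lin_tlift //.
rewrite -[in RHS](@comul_counitl _ _ _ (fun z => (e x : k) *: mact N n z)); last by
    lin_tac.
rewrite [RHS]lin_tlift; last by lin_tac.
apply: eq_tlift => a2 a3; rewrite ind_counitE !counitM counit_antipode !scalerA.
by rewrite mulrAC.
Qed.

Section OfYDRes.
Variable R : yd_res H.

Definition ires i : bimod H := ind (yd_rmod (yr R i)).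
Definition ires_d i : bimod_hom (ires i.+1) (ires i) :=
  @ind_map (yd_rmod (yr R i.+1)) (yd_rmod (yr R i)) (yr_d R i) (@yr_ydlin _ _ R i).

Lemma ires_exact0 (x : ires 0) : exists y, ires_d 0 y = x.
Proof.
exists (tmap idfun (yr_h R 0) x); rewrite ind_mapE.
rewrite -(tmap_comp (f'' := idfun) (g'' := comod_id (yr R 0))) //; first exact: tmap_id.
by move=> y; rewrite -(yr_dh0 R).
Qed.

(** The contraction of [R], tensored with H, is a linear contraction of the complex of bimodules. *)
Lemma ires_exact i (x : ires i.+1) : ires_d i x = 0 <-> exists y, ires_d i.+1 y = x.
Proof.
split=> [dx|[y <-]].
  have E t : tmap (@idfun H) (yr_d R i.+1) (tmap idfun (yr_h R i.+1) t) +
      tmap idfun (yr_h R i) (tmap idfun (yr_d R i) t) = t.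
    move: t; apply: tens_lin_ext; [by lin_tac | exact: lin_id |] => a y.
    rewrite !tmapE -linearDr.
    congr (a \ot _); exact: (congr1 (fun h : comod_hom _ _ => h y) (yr_dh R i)).
  exists (tmap idfun (yr_h R i.+1) x); rewrite ind_mapE -[RHS]E.
  have dx0 : tmap idfun (yr_d R i) x = 0 := etrans (esym (ind_mapE _ _)) dx.
  by rewrite dx0 linear0 addr0.
rewrite !ind_mapE -(tmap_comp (f'' := idfun) (g'' := (0 : comod_hom (yr R i.+2) (yr R
    i)))) //.
  move: y; apply: (@tens_lin_ext _ _ _ _ _ (fun=> 0)); [by lin_tac | by move=> ? ? ?;
      rewrite scaler0 addr0 |].
  by move=> a y; rewrite tmapE linear0r.
by move=> z; rewrite -(yr_dd R i).
Qed.

Definition unit_iso := cid (yr_unit R).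
Definition yr_aug : comod_hom (yr R 0) (unit_yd H) := sval unit_iso.

Lemma yr_aug_ydlin : ydlin yr_aug.
Proof. by have [j' []] := svalP unit_iso. Qed.

Lemma yr_aug_bij : bijective yr_aug.
Proof.
have [j' [_ _ j'j jj']] := svalP unit_iso; exists j' => x.
  exact: (congr1 (fun h : comod_hom _ _ => h x) j'j).
exact: (congr1 (fun h : comod_hom _ _ => h x) jj').
Qed.

Lemma ires_unit_lin : lin (fun y : yr R 0 => (yr_aug y : k) *: (1 : regular_bimod H)).
Proof. by apply: lin_scalel; lin_tac. Qed.

Lemma ires_unit_ad y a : mk_linear ires_unit_lin (mact (yd_rmod (yr R 0)) y a) =
  ad_act (mk_linear ires_unit_lin y) a.
Proof.
rewrite !mk_linearE [yr_aug _]yr_aug_ydlin.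
rewrite (@linZ _ _ _ (fun m : regular_bimod H => ad_act m a)); last exact: (ad_act_bil
    _).1.
rewrite -scalerA [X in _ = _ *: X](_ : _ = (e a : k) *: 1); last first.
  by rewrite -antipodelE; apply: eq_tlift => a1 a2; rewrite /= mulr1.
by rewrite !scalerA mulrC.
Qed.

Definition ires_unit : bimod_hom (ires 0) (regular_bimod H) := ind_ext ires_unit_ad.

Lemma ires_unitE x y : ires_unit (x \ot y : ires 0) = (yr_aug y : k) *: x.
Proof.
by rewrite [LHS]ind_ext_funE mk_linearE linearZr_LR /= mulr1.
Qed.

Lemma ires_unit_inj (t : ires 0) : ires_unit t = 0 -> t = 0.
Proof.
have [j' jK j'K] := yr_aug_bij.
suff E (s : ires 0) : s = (ires_unit s : H) \ot j' 1.
  by move=> t0; rewrite (E t) t0 linear0l.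
move: s; apply: tens_lin_ext; [exact: lin_id | by lin_tac |] => x y.
rewrite ires_unitE linearZl_LR -linearZr_LR; congr (_ \ot _).
apply: (can_inj jK); rewrite linearZ /= j'K [RHS]mulr1 //.
Qed.

Lemma ires_unit_surj (x : H) : exists t, ires_unit t = x.
Proof.
have [j' jK j'K] := yr_aug_bij.
by exists (x \ot j' 1); rewrite ires_unitE j'K scale1r.
Qed.

Lemma ires_projective i : projective (ires i.+1).
Proof.
have [s sl sK] := relproj_retract (@yr_relproj _ _ R i).
pose P := yr R i.+1.
pose S' := @ind_map (yd_rmod P) (yd_rmod (free_yd P)) s sl.
pose C' := @ind_map (yd_rmod (free_yd P)) (yd_rmod P) (free_counit P) (@free_counit_ydlin
    _ _ P).
apply: (@projective_retract _ _ _ _ S' C'); last exact: ind_free_projective.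
move=> x; rewrite !ind_mapE -(tmap_comp (f'' := idfun) (g'' := comod_id P)) //; first
    exact: tmap_id.
by move=> y; rewrite -sK.
Qed.

(** Degrees drop by one relative to [R]: the term of index 0 is H (x) k = H, the module being
    resolved, and the augmentation is the differential [ires_d 0] followed by this
    identification. *)
Definition resolution_of : proj_resolution (regular_bimod H).
Proof.
apply: (@ProjResolution _ _ _ (fun i => ires i.+1) (fun i => ires_d i.+1)
  (bcomp ires_unit (ires_d 0))).
- by move=> i; apply: ires_projective.
- move=> m; have [t tm] := ires_unit_surj m; have [s st] := ires_exact0 t.
  by exists s; rewrite -tm -st.
- move=> x; rewrite -ires_exact; split=> [|dx]; first exact: ires_unit_inj.
  by rewrite -[LHS]/(ires_unit (ires_d 0 x)) dx linear0.
- by move=> i x; apply: ires_exact.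
Defined.

(** Vanishing of Ext^(m+1)(k, N) over H, computed on [R]; the shift of the index is that of
    [resolution_of]. *)
Definition mod_coboundaries_at m (N : rmod H) : Prop :=
  forall f : {linear yr R m.+2 -> N}, @mlin _ _ (yd_rmod (yr R m.+2)) N f ->
  (forall x, f (yr_d R m.+2 x) = 0) ->
  exists2 g : {linear yr R m.+1 -> N}, @mlin _ _ (yd_rmod (yr R m.+1)) N g &
    forall x, f x = g (yr_d R m.+1 x).

(** A module cocycle f induces the bimodule cocycle [ind_map] of f, with values in [ind N]. A
    cochain G bounding it there gives back a module map by restriction to 1 (x) y and the counit of
    [ind N]. *)
Lemma mod_coboundaries_above n m N : proj_dim_le (regular_bimod H) n -> (n <= m)%N ->
  mod_coboundaries_at m N.
Proof.
move=> [P Pn] nm f fl f0.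
have [x|G GP] := @coboundaries_above_length _ _ _ resolution_of P (ind N) n m Pn nm
  (@ind_map (yd_rmod (yr R m.+2)) N f fl).
  move: x; apply: (@tens_lin_ext _ _ _ _ _ (fun=> 0)); [by lin_tac | by move=> ? ? ?;
      rewrite scaler0 addr0 |].
  move=> a y; rewrite [X in ind_map _ X]ind_mapE !ind_mapE !tmapE.
  by rewrite f0 linear0r.
have glin : lin (fun y : yr R m.+1 => ind_counit (G (1 \ot y : ires m.+1))).
  by apply: (@lin_comp _ _ _ _ (@ind_counit N)); [exact: ind_counit_lin | lin_tac].
exists (mk_linear glin).
  move=> y a; rewrite !mk_linearE -ind_counit_ad -bimod_hom_ad.
  by rewrite (@ind_ad _ _ (yd_rmod (yr R m.+1))).
move=> x; have := congr1 (@ind_counit N) (GP (1 \ot x)).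
rewrite [X in ind_counit X]ind_map1 ind_counitE counit1 scale1r => ->.
by rewrite mk_linearE; congr (ind_counit (G _)); rewrite [LHS]ind_map1.
Qed.

End OfYDRes.
End Resolution.

(** * Adjoint modules of projective bimodules *)

Section AdProjective.
Variables (k : fieldType) (H : hopfAlg k).
Notation S := (@antipode k H).
Notation e := (@counit k H).
Notation Delta := (@comul k H).

Section FreeBimod.
Variable V : lmodType k.

Definition free_lact (b : H) (t : (H \ox V) \ox H) : (H \ox V) \ox H :=
  tlift (fun w y => tlift (fun x v => ((b * x) \ot v) \ot y) w) t.

Lemma free_lact_bil : bil free_lact.
Proof. by rewrite /free_lact; lin_tac. Qed.

Lemma free_lactE b x v y : free_lact b ((x \ot v) \ot y) = ((b * x) \ot v) \ot y.
Proof. by rewrite /free_lact !tliftE //; lin_tac. Qed.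

Lemma tens3_lin_ext (U : lmodType k) (f g : (H \ox V) \ox H -> U) : lin f -> lin g ->
  (forall x v y, f ((x \ot v) \ot y) = g ((x \ot v) \ot y)) -> f =1 g.
Proof.
move=> fl gl fg; apply: tens_lin_ext => // w y; move: w.
apply: (@tens_lin_ext _ _ _ _ (fun w => f (w \ot y)) (fun w => g (w \ot y))) => //.
  by apply: (@lin_comp _ _ _ _ f) => //; lin_tac.
by apply: (@lin_comp _ _ _ _ g) => //; lin_tac.
Qed.

Definition free_bimod : bimod H.
Proof.
refine (@Bimod k H ((H \ox V) \ox H) (mk_bil free_lact_bil) (mact (free_rmod H (H \ox V)))
  _ _ (@mact1 _ _ (free_rmod H (H \ox V))) (@mactM _ _ (free_rmod H (H \ox V))) _).
- apply: tens3_lin_ext; [exact: free_lact_bil.2 | exact: lin_id |] => x v y.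
  by rewrite [LHS]free_lactE mul1r.
- move=> a b; apply: tens3_lin_ext; [exact: free_lact_bil.2 | by apply: (@lin_comp _ _ _
    _ (free_lact a)); apply: free_lact_bil.2 |].
  by move=> x v y; rewrite [LHS]free_lactE [RHS](congr1 (free_lact a) (free_lactE _ _ _
      _)) free_lactE mulrA.
- move=> a m b; move: m; apply: tens3_lin_ext.
  + by apply: lin_bilinl; apply: free_lact_bil.2.
  + by apply: (@lin_comp _ _ _ _ (free_lact a)); [apply: free_lact_bil.2 | lin_tac].
  move=> x v y; rewrite -[LHS]/(mact (free_rmod H (H \ox V)) (free_lact a ((x \ot v) \ot
      y)) b).
  rewrite -[RHS]/(free_lact a (mact (free_rmod H (H \ox V)) ((x \ot v) \ot y) b)).
  by rewrite free_lactE !free_rmod_mactE free_lactE.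
Defined.

Lemma lact_freeE b (x : H) (v : V) (y : H) : lact free_bimod b ((x \ot v) \ot y) = ((b *
    x) \ot v) \ot y.
Proof. exact: free_lactE. Qed.
Lemma ract_freeE (w : H \ox V) (y : H) a : ract free_bimod (w \ot y) a = w \ot (y * a).
Proof. exact: free_rmod_mactE. Qed.

(** Straightens the adjoint action on a free bimodule into right multiplication on the last factor:
    S^2(y_1) becomes S^2(y_1) S^2(a_2) S(a_1), and S^2(a_2) S(a_1) = S(a_1 S(a_2)) reduces to the
    counit. *)
Definition ad_free_fun (t : free_bimod) : free_rmod H (H \ox V) :=
  tlift (fun w y => tlift (fun x v => tlift (fun y1 y2 =>
    ((S (S y1) * x) \ot v) \ot y2) (Delta y)) w) t.

Lemma ad_free_lin : lin ad_free_fun.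
Proof. by rewrite /ad_free_fun; lin_tac. Qed.

Lemma ad_freeE (x : H) (v : V) (y : H) : ad_free_fun ((x \ot v) \ot y) =
  tlift (fun y1 y2 => ((S (S y1) * x) \ot v) \ot y2) (Delta y).
Proof. by rewrite /ad_free_fun !tliftE //; lin_tac. Qed.

Lemma ad_free_mlin (t : free_bimod) a :
  ad_free_fun (ad_act t a) = mact (free_rmod H (H \ox V)) (ad_free_fun t) a.
Proof.
have fl := ad_free_lin; move: t; apply: tens3_lin_ext => [||x v y].
- apply: (@lin_comp _ _ _ _ ad_free_fun) => //; exact: (ad_act_bil free_bimod).1.
- by apply: lin_bilinl.
rewrite /ad_act lin_tlift // ad_freeE.
rewrite [RHS](@lin_tlift _ _ _ _ _ (fun t => mact _ t a)); last by lin_tac.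
transitivity (tlift (fun a1 a' => tlift (fun y1 y2 => tlift (fun a2 a3 =>
   ((S (S y1) * (S (S a2) * S a1) * x) \ot v) \ot (y2 * a3)) (Delta a')) (Delta y))
       (Delta a)).
  apply: eq_tlift => a1 a'; rewrite lact_freeE ract_freeE ad_freeE.
  rewrite tlift_comulM; last by lin_tac.
  by apply: eq_tlift => y1 y2; apply: eq_tlift => a2 a3; rewrite !antipodeM !mulrA.
rewrite tlift_exchange; apply: eq_tlift => y1 y2; rewrite free_rmod_mactE.
rewrite -(@comul_assoc _ _ _ (fun a1 a2 a3 => ((S (S y1) * (S (S a2) * S a1) * x) \ot v)
    \ot (y2 * a3))); last by lin_tac.
rewrite -[RHS](@comul_counitl _ _ _ (fun a => ((S (S y1) * x) \ot v) \ot (y2 * a))); last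
    by lin_tac.
apply: eq_tlift => b a3.
transitivity (tlift (fun a1 a2 => ((S (S y1) * S (a1 * S a2) * x) \ot v) \ot (y2 * a3))
    (Delta b)).
  by apply: eq_tlift => a1 a2; rewrite antipodeM.
rewrite (@cancel_Sr _ _ _ (fun z => ((S (S y1) * S z * x) \ot v) \ot (y2 * a3))); last by
    lin_tac.
by rewrite antipode1 mulr1.
Qed.

End FreeBimod.

Section Retract.
Variable P : bimod H.

Definition free_mul_fun (t : free_bimod P) : P :=
  tlift (fun w y => tlift (fun x p => ract P (lact P x p) y) w) t.

Lemma free_mul_lin : lin free_mul_fun.
Proof. by rewrite /free_mul_fun; lin_tac. Qed.

Lemma free_mulE (x : H) (p : P) (y : H) : free_mul_fun ((x \ot p) \ot y) = ract P (lact P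
    x p) y.
Proof. by rewrite /free_mul_fun !tliftE //; lin_tac. Qed.

Definition free_mul : bimod_hom (free_bimod P) P.
Proof.
exists (mk_linear free_mul_lin).
- move=> a; apply: tens3_lin_ext; [by lin_tac | by lin_tac |] => x p y.
  by rewrite lact_freeE !mk_linearE !free_mulE lactM lractA.
- move=> m a; move: m; apply: tens3_lin_ext; [by lin_tac | by lin_tac |] => x p y.
  by rewrite ract_freeE !mk_linearE !free_mulE ractM.
Defined.

Lemma free_mul_surj p : exists t, free_mul t = p.
Proof. by exists ((1 \ot p) \ot 1); rewrite mk_linearE free_mulE lact1 ract1. Qed.

Lemma lact_fun_lin : lin (fun t : H \ox P => tlift (fun x p => lact P x p) t).
Proof. by lin_tac. Qed.

Definition ad_mul : (H \ox P) \ox H -> P := free_ext_fun (N := ad P) (mk_linear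
    lact_fun_lin).

Lemma ad_mul_lin : lin ad_mul.
Proof. exact: (@free_ext_lin _ _ _ (ad P) (mk_linear lact_fun_lin)). Qed.

Lemma ad_mulE (x : H) (p : P) (y : H) : ad_mul ((x \ot p) \ot y) = ad_act (lact P x p) y.
Proof. by rewrite [LHS]free_ext_funE mk_linearE tliftE //; lin_tac. Qed.

(** After straightening, the multiplication of P factors through a module map from a free module to
    [ad P]. A bimodule section of the multiplication therefore exhibits [ad P] as a retract of that
    free module. *)
Lemma ad_mul_free (t : free_bimod P) : ad_mul (ad_free_fun t) = free_mul t.
Proof.
have al := ad_mul_lin.
move: t; apply: tens3_lin_ext => [||x p y].
- by apply: (@lin_comp _ _ _ _ ad_mul) => //; apply: ad_free_lin.
- by lin_tac.
rewrite ad_freeE lin_tlift // mk_linearE free_mulE.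
transitivity (tlift (fun y1 z => tlift (fun y2 y3 =>
    ract P (lact P (S (S y1 * y2) * x) p) y3) (Delta z)) (Delta y)).
  apply: eq_tlift => y1 z; rewrite ad_mulE; apply: eq_tlift => y2 y3.
  by rewrite -lactM antipodeM mulrA.
rewrite (@cancel_Sl_left _ _ _ (fun u w => ract P (lact P (S u * x) p) w)); last by
    lin_tac.
by rewrite antipode1 mul1r.
Qed.

Lemma ad_projective : projective P ->
  exists (s : {linear P -> (H \ox P) \ox H}) (r : {linear (H \ox P) \ox H -> P}),
  [/\ @mlin _ _ (ad P) (free_rmod H (H \ox P)) s, @mlin _ _ (free_rmod H (H \ox P)) (ad
      P) r
    & cancel s r].
Proof.
move=> projP; have [i iK] := projP _ _ free_mul (bid P) free_mul_surj.
have sl : lin (fun p : P => ad_free_fun (i p)).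
  by apply: (@lin_comp _ _ _ _ (@ad_free_fun P)); [exact: ad_free_lin | lin_tac].
have rl := ad_mul_lin.
exists (mk_linear sl), (mk_linear rl); split.
- move=> p a; rewrite !mk_linearE -ad_free_mlin; congr ad_free_fun.
  exact: bimod_hom_ad.
- exact: (@free_ext_mlin _ _ _ (ad P)).
- by move=> p; rewrite !mk_linearE ad_mul_free; apply: iK.
Qed.

End Retract.

(** * Cocycles with values in Yetter-Drinfeld modules and in projective bimodules *)

Section Cocycles.
Variable R : yd_res H.

Definition yd_coboundaries_at m (Q : yd H) : Prop :=
  forall f : comod_hom (yr R m.+2) Q, ydlin f -> comod_comp f (yr_d R m.+2) = 0 ->
  exists2 g : comod_hom (yr R m.+1) Q, ydlin g & f = comod_comp g (yr_d R m.+1).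

(** [cofree_yd] is right adjoint to the functor forgetting the coaction, so the two cochain
    complexes are isomorphic. *)
Lemma yd_coboundaries_cofree m (N : rmod H) :
  mod_coboundaries_at R m N <-> yd_coboundaries_at m (cofree_yd N).
Proof.
have cl := @cofree_counit_lin k H N.
split=> [cob f fl f0|cob f fl f0].
  have fl' : lin (fun x => cofree_counit (f x)).
    by apply: (@lin_comp _ _ _ _ (@cofree_counit _ _ N)) => //; lin_tac.
  have [||g gl fg] := cob (mk_linear fl').
  - by move=> y a; rewrite !mk_linearE [f _]fl cofree_counit_mlin.
  - move=> x; rewrite mk_linearE.
    have -> : f (yr_d R m.+2 x) = 0 := congr1 (fun h : comod_hom _ _ => h x) f0.
    by rewrite -(mk_linearE cl) linear0.
  exists (cofree_ext g); first exact: cofree_ext_ydlin.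
  apply: comod_hom_ext; apply: cofree_hom_ext => x.
  rewrite -[comod_comp _ _ x]/(cofree_ext g (yr_d R m.+1 x)).
  by rewrite cofree_counit_ext -fg.
have [||g gl fg] := cob (cofree_ext f).
- exact: cofree_ext_ydlin.
- apply: comod_hom_ext; apply: cofree_hom_ext => x.
  rewrite -[comod_comp _ _ x]/(cofree_ext f (yr_d R m.+2 x)) cofree_counit_ext f0.
  by rewrite comod_hom0E -(mk_linearE cl) linear0.
have gl' : lin (fun x => cofree_counit (g x)).
  by apply: (@lin_comp _ _ _ _ (@cofree_counit _ _ N)) => //; lin_tac.
exists (mk_linear gl').
  by move=> y a; rewrite !mk_linearE [g _]gl cofree_counit_mlin.
move=> x; rewrite mk_linearE -(cofree_counit_ext f); congr cofree_counit.
exact: (congr1 (fun h : comod_hom _ _ => h x) fg).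
Qed.

Lemma yd_coboundaries_retract m (P Q : yd H) (i : comod_hom P Q) (r : comod_hom Q P) :
  ydlin i -> ydlin r -> comod_comp r i = comod_id P ->
  yd_coboundaries_at m Q -> yd_coboundaries_at m P.
Proof.
move=> il rl ri cob f fl f0; have [||g gl fg] := cob (comod_comp i f).
- exact: ydlin_comp.
- apply: comod_hom_ext => x.
  rewrite -[LHS]/(i (comod_comp f (yr_d R m.+2) x)) f0 comod_hom0E; exact: linear0.
exists (comod_comp r g); first exact: ydlin_comp.
apply: comod_hom_ext => x.
rewrite -[LHS](congr1 (fun h : comod_hom _ _ => h (f x)) ri).
by rewrite -[LHS]/(r (comod_comp i f x)) fg.
Qed.

(** Restriction to 1 (x) n turns a bimodule cocycle with values in P into a module cocycle with
    values in [ad P], a retract of a free module. The cochain found there is pushed back by [r] and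
    extended by [ind_ext]. *)
Lemma coboundaries_projective m (P : bimod H) :
  (forall W : lmodType k, mod_coboundaries_at R m (free_rmod H W)) ->
  projective P -> coboundaries_at (resolution_of R) P m.
Proof.
move=> cob projP f f0; have [s [r [sl rl sK]]] := ad_projective projP.
pose Y i := yd_rmod (yr R i).
have philin : lin (fun n : yr R m.+2 => s (f (1 \ot n : ind (Y m.+2)))) by lin_tac.
have [||g gl fg] := cob _ (mk_linear philin).
- move=> n a; rewrite !mk_linearE -sl; congr (s _).
  by rewrite -[RHS]bimod_hom_ad [in RHS]ind_ad.
- move=> n; rewrite mk_linearE.
  have <- : res_d (resolution_of R) m.+1 (1 \ot n : ind (Y m.+3)) = 1 \ot yr_d R m.+2 n.
    exact: ind_map1.
  by rewrite f0 linear0.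
have psilin : lin (fun n : yr R m.+1 => r (g n)) by lin_tac.
have psiad (n : Y m.+1) a : mk_linear psilin (mact (Y m.+1) n a) = ad_act (mk_linear
    psilin n) a.
  by rewrite !mk_linearE gl [LHS]rl.
exists (ind_ext psiad) => x.
apply: (@ind_hom_ext _ _ (Y m.+2) P f (bcomp (ind_ext psiad) (res_d (resolution_of R)
    m))) => n.
have := fg n; rewrite mk_linearE => /(congr1 r); rewrite sK => ->.
rewrite -[RHS]/(ind_ext psiad (res_d (resolution_of R) m (1 \ot n : ind (Y m.+2)))).
have -> : res_d (resolution_of R) m (1 \ot n : ind (Y m.+2)) = (1 \ot yr_d R m.+1 n : ind
    (Y m.+1)).
  exact: ind_map1.
by rewrite ind_extE.
Qed.

End Cocycles.

(** Truncating the finite resolution [P] asks for cocycles with values in its own terms, which are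
    projective bimodules. *)
Lemma cd_le_of_coboundaries (R : yd_res H) n : smooth H ->
  (forall m (W : lmodType k), (n <= m)%N -> mod_coboundaries_at R m (free_rmod H W)) ->
  proj_dim_le (regular_bimod H) n.
Proof.
move=> [P [[r Pr] _]] cob; apply: (truncation Pr) => m nm.
apply: (coboundaries_at_indep (Q := resolution_of R)).
apply: coboundaries_projective => [W|]; first exact: cob.
exact: res_proj.
Qed.

End AdProjective.

(** * Equivalences of Yetter-Drinfeld modules *)

(* A k-linear equivalence between the categories with Yetter-Drinfeld modules as
   objects and colinear maps as morphisms, which preserves and reflects the
   Yetter-Drinfeld morphisms and the unit object. *)
Record yd_equiv (k : fieldType) (A B : hopfAlg k) := YdEquiv {
  yo : yd A -> yd B;
  ym : forall M N : yd A, comod_hom M N -> comod_hom (yo M) (yo N);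
  ymD : forall (M N : yd A) (f g : comod_hom M N), ym (f + g) = ym f + ym g;
  ym_id : forall M : yd A, ym (comod_id M) = comod_id (yo M);
  ym_comp : forall (M N P : yd A) (f : comod_hom N P) (g : comod_hom M N),
    ym (comod_comp f g) = comod_comp (ym f) (ym g);
  ym_inj : forall M N : yd A, injective (@ym M N);
  ym_surj : forall (M N : yd A) (g : comod_hom (yo M) (yo N)), exists f, ym f = g;
  ym_ydlin : forall (M N : yd A) (f : comod_hom M N), ydlin f <-> ydlin (ym f);
  yo_surj : forall N : yd B, exists M : yd A, yd_iso (yo M) N;
  yo_unit : yd_iso (yo (unit_yd A)) (unit_yd B)
}.

Section YDIso.
Variables (k : fieldType) (H : hopfAlg k).
Implicit Types M N P : yd H.

Lemma comod_compA (U V W X : comod H) (f : comod_hom W X) (g : comod_hom V W) (h :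
    comod_hom U V) :
  comod_comp f (comod_comp g h) = comod_comp (comod_comp f g) h.
Proof. exact: comod_hom_ext. Qed.

Lemma comod_comp1l (V W : comod H) (f : comod_hom V W) : comod_comp (comod_id W) f = f.
Proof. exact: comod_hom_ext. Qed.

Lemma comod_comp1r (V W : comod H) (f : comod_hom V W) : comod_comp f (comod_id V) = f.
Proof. exact: comod_hom_ext. Qed.

Lemma comod_compDl (U V W : comod H) (f f' : comod_hom V W) (g : comod_hom U V) :
  comod_comp (f + f') g = comod_comp f g + comod_comp f' g.
Proof. exact: comod_hom_ext. Qed.

Lemma comod_compDr (U V W : comod H) (f : comod_hom V W) (g g' : comod_hom U V) :
  comod_comp f (g + g') = comod_comp f g + comod_comp f g'.
Proof. by apply: comod_hom_ext => x; apply: linearD. Qed.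

Lemma yd_iso_sym M N : yd_iso M N -> yd_iso N M.
Proof. by move=> [f [g [fl gl gf fg]]]; exists g, f. Qed.

Lemma yd_iso_trans M N P : yd_iso M N -> yd_iso N P -> yd_iso M P.
Proof.
move=> [f [g [fl gl gf fg]]] [f' [g' [fl' gl' gf' fg']]].
exists (comod_comp f' f), (comod_comp g g'); split; try exact: ydlin_comp.
  by rewrite comod_compA -(comod_compA g) gf' comod_comp1r.
by rewrite comod_compA -(comod_compA f') fg comod_comp1r.
Qed.

End YDIso.

Section Symmetry.
Variables (k : fieldType) (A B : hopfAlg k) (E : yd_equiv A B).

Lemma ym0 (M N : yd A) : ym E (0 : comod_hom M N) = 0.
Proof. by apply: (addrI (ym E 0)); rewrite -ymD !addr0. Qed.

Lemma yd_iso_lift (M N : yd A) : yd_iso (yo E M) (yo E N) -> yd_iso M N.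
Proof.
move=> [f [g [fl gl gf fg]]].
have [f' f'f] := ym_surj f; have [g' g'g] := ym_surj g.
exists f', g'; split; try by apply/(ym_ydlin E); rewrite ?f'f ?g'g.
  by apply: (@ym_inj _ _ _ E); rewrite ym_comp f'f g'g gf ym_id.
by apply: (@ym_inj _ _ _ E); rewrite ym_comp f'f g'g fg ym_id.
Qed.

Definition inv_yo (N : yd B) : yd A := sval (cid (yo_surj E N)).
Definition inv_iso (N : yd B) : yd_iso (yo E (inv_yo N)) N := svalP (cid (yo_surj E N)).
Definition inv_to (N : yd B) : comod_hom (yo E (inv_yo N)) N := sval (cid (inv_iso N)).
Definition inv_from (N : yd B) : comod_hom N (yo E (inv_yo N)) :=
  sval (cid (svalP (cid (inv_iso N)))).

Lemma inv_toP (N : yd B) : [/\ ydlin (inv_to N), ydlin (inv_from N),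
  comod_comp (inv_from N) (inv_to N) = comod_id _ &
  comod_comp (inv_to N) (inv_from N) = comod_id _].
Proof. exact: svalP (cid (svalP (cid (inv_iso N)))). Qed.

Definition inv_conj (M N : yd B) (f : comod_hom M N) : comod_hom (yo E (inv_yo M)) (yo E
    (inv_yo N)) :=
  comod_comp (inv_from N) (comod_comp f (inv_to M)).
Definition inv_ym (M N : yd B) (f : comod_hom M N) : comod_hom (inv_yo M) (inv_yo N) :=
  sval (cid (ym_surj (inv_conj f))).

Lemma inv_ymE (M N : yd B) (f : comod_hom M N) : ym E (inv_ym f) = inv_conj f.
Proof. exact: svalP (cid (ym_surj (inv_conj f))). Qed.

Lemma inv_conjK (M N : yd B) (f : comod_hom M N) :
  comod_comp (inv_to N) (comod_comp (inv_conj f) (inv_from M)) = f.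
Proof.
have [_ _ _ tfM] := inv_toP M; have [_ _ _ tfN] := inv_toP N.
by rewrite /inv_conj !comod_compA tfN comod_comp1l -comod_compA tfM comod_comp1r.
Qed.

(** The comparison of dimensions is proved as an inequality in one direction; the quasi-inverse, on
    objects chosen by essential surjectivity, supplies the other. *)
Definition yd_equiv_sym : yd_equiv B A.
Proof.
apply: (@YdEquiv _ _ _ inv_yo inv_ym).
- move=> M N f g; apply: (@ym_inj _ _ _ E).
  by rewrite ymD !inv_ymE /inv_conj comod_compDl comod_compDr.
- move=> M; apply: (@ym_inj _ _ _ E); have [_ _ ft _] := inv_toP M.
  by rewrite ym_id inv_ymE /inv_conj comod_comp1l ft.
- move=> M N P f g; apply: (@ym_inj _ _ _ E); have [_ _ _ tf] := inv_toP N.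
  rewrite ym_comp !inv_ymE /inv_conj !comod_compA; congr (comod_comp (comod_comp _ g) _).
  by rewrite -!comod_compA tf comod_comp1r.
- move=> M N f g fg; rewrite -(inv_conjK f) -(inv_conjK g).
  by rewrite -!inv_ymE fg.
- move=> M N g.
  exists (comod_comp (inv_to N) (comod_comp (ym E g) (inv_from M))).
  apply: (@ym_inj _ _ _ E); rewrite inv_ymE /inv_conj.
  have [_ _ ftM _] := inv_toP M; have [_ _ ftN _] := inv_toP N.
  by rewrite !comod_compA ftN comod_comp1l -comod_compA ftM comod_comp1r.
- move=> M N f; rewrite (ym_ydlin E) inv_ymE.
  have [tMl fMl _ _] := inv_toP M; have [tNl fNl _ _] := inv_toP N.
  split=> fl; first by do 2 apply: ydlin_comp => //.
  by rewrite -(inv_conjK f); do 2 apply: ydlin_comp => //.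
- move=> M; exists (yo E M); apply: yd_iso_lift; exact: inv_iso.
- apply: yd_iso_lift; apply: yd_iso_trans (inv_iso _) (yd_iso_sym (yo_unit E)).
Defined.

End Symmetry.

(** * Transport of splitting properties and cocycles *)

Section Transport.
Variables (k : fieldType) (A B : hopfAlg k) (E : yd_equiv A B).

(** The lifting problem is moved back to A, its objects being replaced by isomorphic images; its
    data are Yetter-Drinfeld morphisms and one colinear section, all of which pull back. *)
Lemma yo_relproj P : relproj P -> relproj (yo E P).
Proof.
move=> projP M N p s f pl ps fl.
have [M' [u [v [ul vl vu uv]]]] := yo_surj E M.
have [N' [u' [v' [ul' vl' vu' uv']]]] := yo_surj E N.
have [p' p'E] := ym_surj (comod_comp v' (comod_comp p u)).
have [s' s'E] := ym_surj (comod_comp v (comod_comp s u')).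
have [f' f'E] := ym_surj (comod_comp v' f).
have [||| g gl gf] := projP M' N' p' s' f'.
- by apply/(ym_ydlin E); rewrite p'E; do 2 apply: ydlin_comp => //.
- apply: (@ym_inj _ _ _ E); rewrite ym_comp p'E s'E ym_id !comod_compA.
  rewrite -(comod_compA _ u) uv comod_comp1r -(comod_compA _ p) ps comod_comp1r.
  exact: vu'.
- by apply/(ym_ydlin E); rewrite f'E; apply: ydlin_comp.
exists (comod_comp u (ym E g)); first by apply: ydlin_comp => //; apply/(ym_ydlin E).
have /(congr1 (comod_comp u')) : comod_comp v' (comod_comp p (comod_comp u (ym E g))) =
    comod_comp v' f.
  by rewrite -f'E -gf ym_comp p'E !comod_compA.
by rewrite !comod_compA uv' !comod_comp1l -comod_compA.
Qed.

(** Injectivity of the underlying function is not visibly preserved by E. It is tested on the kernel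
    instead: if t is the kernel inclusion of j, then j t = 0 gives i (E t) = 0 over B, whence E t =
    0 and t = 0. *)
Lemma yo_relinj Q : relinj Q -> relinj (yo E Q).
Proof.
move=> injQ M i il i_inj.
have [M' [u [v [ul vl vu uv]]]] := yo_surj E M.
have [j jE] := ym_surj (comod_comp v i).
have jl : ydlin j by apply/(ym_ydlin E); rewrite jE; apply: ydlin_comp.
have v_inj : injective v.
  by move=> x y xy; rewrite -[x](congr1 (fun h : comod_hom _ _ => h x) uv)
    -[RHS](congr1 (fun h : comod_hom _ _ => h y) uv) /= xy.
have j_inj : injective j.
  have [K [t [tl jt tP]]] := yd_kernel jl.
  suff t0 : t = 0.
    move=> x y xy; apply/eqP; rewrite -subr_eq0; apply/eqP.
    have [|z <-] := tP (x - y); first by rewrite linearB /= xy subrr.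
    by rewrite t0.
  apply: (@ym_inj _ _ _ E); rewrite ym0; apply: comod_hom_ext => z.
  apply: i_inj; apply: v_inj; rewrite comod_hom0E !linear0.
  have := congr1 (fun h : comod_hom _ _ => h z) (congr1 (fun h : comod_hom K M' => ym E
      h) jt).
  by rewrite ym_comp jE ym0.
have [r rj] := injQ _ _ jl j_inj.
exists (comod_comp (ym E r) v); rewrite -comod_compA -jE -ym_comp rj; exact: ym_id.
Qed.

Definition yo_res (R : yd_res A) : yd_res B.
Proof.
apply: (@YdRes _ _ (fun i => yo E (yr R i)) (fun i => ym E (yr_d R i)) (fun i => ym E
    (yr_h R i))).
- have [f [g [fl gl gf fg]]] := yr_unit R.
  apply: yd_iso_trans _ (yo_unit E).
  exists (ym E f), (ym E g); split; [exact/(ym_ydlin E) | exact/(ym_ydlin E) | |].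
    by rewrite -ym_comp gf ym_id.
  by rewrite -ym_comp fg ym_id.
- by move=> i; apply: yo_relproj; apply: yr_relproj.
- by move=> i; apply/(ym_ydlin E)/yr_ydlin.
- by rewrite -ym_comp yr_dh0 ym_id.
- by move=> i; rewrite -!ym_comp -ymD yr_dh ym_id.
- by move=> i; rewrite -ym_comp yr_dd ym0.
Defined.

Lemma yo_coboundaries (R : yd_res A) m Q :
  yd_coboundaries_at (yo_res R) m (yo E Q) -> yd_coboundaries_at R m Q.
Proof.
move=> cob f fl f0; have [||g gl fg] := cob (ym E f).
- exact/(ym_ydlin E).
- by rewrite -ym_comp f0 ym0.
have [g' g'E] := ym_surj g; exists g'; first by apply/(ym_ydlin E); rewrite g'E.
by apply: (@ym_inj _ _ _ E); rewrite ym_comp g'E.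
Qed.

(** The bar resolution of A and its image over B carry the same cocycles. Those with values in C(W
    (x) A) are solved over B, where the image of this module is a retract of a cofree one. *)
Lemma cd_le_transport n : bijective (@antipode k A) -> bijective (@antipode k B) ->
  smooth A -> proj_dim_le (regular_bimod B) n -> proj_dim_le (regular_bimod A) n.
Proof.
move=> bijA bijB smA Bn; apply: (cd_le_of_coboundaries (R := bar_res A)) => // m W nm.
apply/yd_coboundaries_cofree; apply: yo_coboundaries.
have [||N [i [r [il rl ri]]]] := @retract_of_cofree _ B (yo E (cofree_yd (free_rmod A
    W))) bijB.
- by apply: yo_relproj; apply: cofree_free_relproj.
- by apply: yo_relinj; apply: cofree_relinj.
apply: yd_coboundaries_retract il rl ri _.
by apply/yd_coboundaries_cofree; apply: mod_coboundaries_above Bn nm.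
Qed.

End Transport.

Lemma proj_dim_eq (k : fieldType) (A B : algType k) (M : bimod A) (N : bimod B) :
  (forall n, proj_dim_le M n <-> proj_dim_le N n) -> proj_dim M = proj_dim N.
Proof.
move=> MN; rewrite /proj_dim; case: pselect => [exM|nexM]; case: pselect => [exN|nexN] //.
- case: ex_minnP => m /asboolP Mm minM; case: ex_minnP => n /asboolP Nn minN.
  by congr Some; apply/eqP; rewrite eqn_leq minM ?minN //; apply/asboolP; apply/MN.
- by case: nexN; have [n /asboolP Mn] := exM; exists n; apply/asboolP; apply/MN.
- by case: nexM; have [n /asboolP Nn] := exN; exists n; apply/asboolP; apply/MN.
Qed.

Lemma cd_eq_of_yd_equiv (k : fieldType) (A B : hopfAlg k) (E : yd_equiv A B) :
  smooth A -> smooth B -> bijective (@antipode k A) -> bijective (@antipode k B) ->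
  cd A = cd B.
Proof.
move=> smA smB bijA bijB; apply: proj_dim_eq => n; split; last exact: (cd_le_transport E).
exact: (cd_le_transport (yd_equiv_sym E)).
Qed.

(** * Half-braidings *)

Section LinCat.
Variables (k : fieldType) (C : linCat k).

Lemma iso_mono (X Y Z : C) (f : hom Y Z) (g h : hom X Y) :
  is_iso f -> f \cc g = f \cc h -> g = h.
Proof. by move=> [f' [f'f _]] /(congr1 (compm f')); rewrite !compmA f'f !comp1m. Qed.

Lemma iso_epi (X Y Z : C) (f : hom X Y) (g h : hom Y Z) :
  is_iso f -> g \cc f = h \cc f -> g = h.
Proof. by move=> [f' [_ ff']] /(congr1 (fun x => x \cc f')); rewrite -!compmA ff'
    !compm1. Qed.

Lemma iso_comp (X Y Z : C) (f : hom Y Z) (g : hom X Y) : is_iso f -> is_iso g -> is_iso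
    (f \cc g).
Proof.
move=> [f' [f'f ff']] [g' [g'g gg']]; exists (g' \cc f'); split.
  by rewrite compmA -(compmA g') f'f compm1.
by rewrite compmA -(compmA f) gg' compm1.
Qed.

Lemma iso_id (X : C) : is_iso (idm X).
Proof. by exists (idm X); rewrite comp1m. Qed.

End LinCat.

Section Equivalence.
Variables (k : fieldType) (C D : linCat k) (F : linFunctor C D).

Lemma fun_iso (X Y : C) (f : hom X Y) : is_iso f -> is_iso (fun_hom F f).
Proof. by move=> [g [gf fg]]; exists (fun_hom F g); rewrite -!fun_comp gf fg !fun_id. Qed.

Lemma nat_iso_faithful (G : linFunctor D C) : nat_iso (comp_functor G F) (id_functor C) ->
  forall (X Y : C) (f g : hom X Y), fun_hom F f = fun_hom F g -> f = g.
Proof.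
move=> [t [tiso tnat]] X Y f g fg.
by apply: (iso_epi (tiso X)); have := tnat _ _ f; rewrite /= fg -(tnat _ _ g).
Qed.

Hypothesis F_eqv : is_equivalence F.

Lemma equivalence_faithful (X Y : C) (f g : hom X Y) : fun_hom F f = fun_hom F g -> f = g.
Proof. by have [G [GF _]] := F_eqv; apply: (nat_iso_faithful GF). Qed.

Lemma equivalence_surj (Y : D) : exists (X : C) (t : hom (F X) Y), is_iso t.
Proof. by have [G [_ [t [tiso _]]]] := F_eqv; exists (G Y), (t Y); apply: tiso. Qed.

End Equivalence.

(** The preimage is G h conjugated by the isomorphisms G F X = X; that F sends it to h is checked
    after applying G, which is faithful because F G is isomorphic to the identity. *)
Lemma equivalence_full (k : fieldType) (C D : linCat k) (F : linFunctor C D) :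
  is_equivalence F -> forall (X Y : C) (h : hom (F X) (F Y)), exists f : hom X Y, fun_hom
      F f = h.
Proof.
move=> [G [[t [tiso tnat]] FG]] X Y h; have [t' [t't tt']] := tiso X.
exists (t Y \cc fun_hom G h \cc t'); apply: (nat_iso_faithful FG).
apply: (iso_mono (tiso Y)); rewrite -[LHS](tnat _ _ (t Y \cc fun_hom G h \cc t')) /=.
by rewrite -!compmA t't compm1.
Qed.

Section MonCat.
Variables (k : fieldType) (C : linMonCat k).
Implicit Types X Y Z V W : C.

Lemma thom_compl X X' X'' Y (f' : hom X' X'') (f : hom X X') :
  thom (f' \cc f) (idm Y) = thom f' (idm Y) \cc thom f (idm Y).
Proof. by rewrite -thom_comp comp1m. Qed.

Lemma thom_compr X X' X'' Y (f' : hom X' X'') (f : hom X X') :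
  thom (idm Y) (f' \cc f) = thom (idm Y) f' \cc thom (idm Y) f.
Proof. by rewrite -thom_comp comp1m. Qed.

Lemma thom_lr X X' Y Y' (f : hom X X') (g : hom Y Y') :
  thom f (idm Y') \cc thom (idm X) g = thom f g.
Proof. by rewrite -thom_comp comp1m compm1. Qed.

Lemma thom_rl X X' Y Y' (f : hom X X') (g : hom Y Y') :
  thom (idm X') g \cc thom f (idm Y) = thom f g.
Proof. by rewrite -thom_comp comp1m compm1. Qed.

Lemma thom_iso X X' Y Y' (f : hom X X') (g : hom Y Y') :
  is_iso f -> is_iso g -> is_iso (thom f g).
Proof.
move=> [f' [f'f ff']] [g' [g'g gg']]; exists (thom f' g').
by rewrite -!thom_comp f'f ff' g'g gg' !thom1.
Qed.

Definition hexagon_at V (c : forall X, hom (tob V X) (tob X V)) X Y : Prop :=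
  assoc X Y V \cc c (tob X Y) \cc assoc V X Y =
  thom (idm X) (c Y) \cc assoc X V Y \cc thom (c X) (idm Y).

(** The structure records the unit law in place of invertibility: under the correspondence with
    actions it becomes v 1 = v. *)
Record hbraid V := HBraid {
  hb :> forall X, hom (tob V X) (tob X V);
  hb_nat : forall X X' (f : hom X X'),
    hb X' \cc thom (idm V) f = thom f (idm V) \cc hb X;
  hb_hex : forall X Y, hexagon_at hb X Y;
  hb_unit : lunit V \cc hb uob = runit V
}.

End MonCat.

(** * Half-braidings along a monoidal equivalence *)

Section MonFunctor.
Variables (k : fieldType) (C D : linMonCat k) (F : monFunctor C D).
Hypothesis F_eqv : is_equivalence F.
Implicit Types (X Y V : C) (W : D).
Local Notation phi := (phi2 F).

(* e is the family c seen through the monoidal structure of F. *)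
Definition braid_rel V (c : forall X, hom (tob V X) (tob X V))
    (e : forall X, hom (tob (F V) (F X)) (tob (F X) (F V))) : Prop :=
  forall X, fun_hom F (c X) \cc phi V X = phi X V \cc e X.

Definition phiL X Y V := phi X (tob Y V) \cc thom (idm (F X)) (phi Y V).
Definition phiR V X Y := phi (tob V X) Y \cc thom (phi V X) (idm (F Y)).

Lemma phiL_iso X Y V : is_iso (phiL X Y V).
Proof. by apply: iso_comp; [|apply: thom_iso; [exact: iso_id|]]; apply: phi2_iso. Qed.

Lemma phiR_iso V X Y : is_iso (phiR V X Y).
Proof. by apply: iso_comp; [|apply: thom_iso; [|exact: iso_id]]; apply: phi2_iso. Qed.

Section Hexagon.
Variables (V : C) (c : forall X, hom (tob V X) (tob X V)).
Variable e : forall X, hom (tob (F V) (F X)) (tob (F X) (F V)).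
Hypothesis ce : braid_rel c e.

Lemma hexagon_right X Y :
  fun_hom F (thom (idm X) (c Y) \cc assoc X V Y \cc thom (c X) (idm Y)) \cc phiR V X Y =
  phiL X Y V \cc (thom (idm (F X)) (e Y) \cc assoc (F X) (F V) (F Y) \cc thom (e X) (idm
      (F Y))).
Proof.
rewrite /phiL /phiR !fun_comp -!compmA.
rewrite [fun_hom F (thom (c X) _) \cc _]compmA phi2_nat fun_id -!compmA -thom_compl ce.
rewrite thom_compl.
rewrite [phi (tob X V) Y \cc _]compmA [fun_hom F (assoc X V Y) \cc _]compmA.
rewrite [fun_hom F (assoc X V Y) \cc _]compmA phi2_assoc -!compmA.
rewrite [fun_hom F (thom _ (c Y)) \cc _]compmA phi2_nat fun_id -!compmA.
congr (phi _ _ \cc _); rewrite !compmA; congr (_ \cc _ \cc _).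
by rewrite -!thom_compr ce.
Qed.

(** Companion of [hexagon_right]. The hexagon at F X, F Y needs a component at F X (x) F Y, whereas
    [e] has components only at objects F Z; [e'] is that component, tied to [e] by naturality along
    [phi2]. *)
Lemma hexagon_left X Y (e' : hom (tob (F V) (tob (F X) (F Y))) (tob (tob (F X) (F Y)) (F
    V))) :
  e (tob X Y) \cc thom (idm (F V)) (phi X Y) = thom (phi X Y) (idm (F V)) \cc e' ->
  fun_hom F (assoc X Y V \cc c (tob X Y) \cc assoc V X Y) \cc phiR V X Y =
  phiL X Y V \cc (assoc (F X) (F Y) (F V) \cc e' \cc assoc (F V) (F X) (F Y)).
Proof.
move=> ee'; rewrite /phiL /phiR !fun_comp -!compmA.
rewrite [fun_hom F (assoc V X Y) \cc _]compmA phi2_assoc -!compmA.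
rewrite [fun_hom F (c _) \cc _]compmA ce -!compmA.
rewrite [e (tob X Y) \cc _]compmA ee' -!compmA.
rewrite [phi (tob X Y) V \cc _]compmA [fun_hom F (assoc X Y V) \cc _]compmA.
by rewrite [fun_hom F (assoc X Y V) \cc _]compmA phi2_assoc -!compmA.
Qed.

End Hexagon.

Lemma braid_relP V (c : forall X, hom (tob V X) (tob X V)) :
  exists e : forall X, hom (tob (F V) (F X)) (tob (F X) (F V)), braid_rel c e.
Proof.
have ex X : exists eX, fun_hom F (c X) \cc phi V X = phi X V \cc eX.
  have [psi [_ phipsi]] := phi2_iso F X V.
  by exists (psi \cc fun_hom F (c X) \cc phi V X); rewrite !compmA phipsi comp1m.
by exists (fun X => sval (cid (ex X))) => X; apply: svalP (cid (ex X)).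
Qed.

Lemma phi_lunitE X : fun_hom F (lunit X) \cc (phi uob X \cc thom (phi0 F) (idm (F X))) =
    lunit (F X).
Proof. by rewrite compmA phi_lunit. Qed.

Lemma phi_runitE X : fun_hom F (runit X) \cc (phi X uob \cc thom (idm (F X)) (phi0 F)) =
    runit (F X).
Proof. by rewrite compmA phi_runit. Qed.

Lemma braid_rel_nat V (c : hbraid V) e : braid_rel c e -> forall X X' (f : hom X X'),
  e X' \cc thom (idm (F V)) (fun_hom F f) = thom (fun_hom F f) (idm (F V)) \cc e X.
Proof.
move=> ce X X' f; apply: (iso_mono (phi2_iso F X' V)).
rewrite compmA -ce -compmA -fun_id -phi2_nat compmA -fun_comp hb_nat fun_comp.
by rewrite -compmA ce compmA phi2_nat fun_id compmA.
Qed.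

(** The monoidal structure of F determines the new braiding on the objects F X. It is extended to
    every Y through the isomorphism [s Y] from F (G Y) to Y, and the hexagon, first proved on
    images, spreads by naturality. *)
Lemma push_braid V (c : hbraid V) : exists d : hbraid (F V), braid_rel c (fun X => d (F
    X)).
Proof.
have [e ce] := braid_relP c; have enat := braid_rel_nat ce.
have [G [_ [s [siso snat]]]] := F_eqv.
rewrite /= in s siso snat.
pose s' (Y : D) : hom Y (F (G Y)) := sval (cid (siso Y)).
have s's (Y : D) : s' Y \cc s Y = idm (F (G Y)) by case: (svalP (cid (siso Y))).
have ss' (Y : D) : s Y \cc s' Y = idm Y by case: (svalP (cid (siso Y))).
pose d (Y : D) : hom (tob (F V) Y) (tob Y (F V)) := thom (s Y) (idm (F V)) \cc e (G Y)
    \cc thom (idm (F V)) (s' Y).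
have dnat (Y Y' : D) (h : hom Y Y') : d Y' \cc thom (idm (F V)) h = thom h (idm (F V))
    \cc d Y.
  have sh : s' Y' \cc h = fun_hom F (fun_hom G h) \cc s' Y.
    have /= := snat _ _ h => /(congr1 (fun x => s' Y' \cc x \cc s' Y)).
    by rewrite !compmA s's comp1m -!compmA ss' compm1.
  rewrite /d -compmA -thom_compr sh thom_compr compmA -[X in X \cc _]compmA enat.
  by rewrite !compmA -!thom_compl snat.
(* The isomorphism from F X to F (G (F X)) comes from a morphism of C by fullness, so naturality of
   [e] applies to it. *)
have dF X : d (F X) = e X.
  have [j jE] := equivalence_full F_eqv (s' (F X)).
  by rewrite /d -jE -compmA enat jE compmA -thom_compl ss' thom1 comp1m.
have dce : braid_rel c (fun X => d (F X)) by move=> X; rewrite dF ce.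
have hexF X Y : hexagon_at d (F X) (F Y).
  apply: (iso_mono (phiL_iso X Y V)).
  rewrite -(hexagon_right dce) -(hexagon_left dce); last exact: dnat.
  by rewrite hb_hex.
have hexd (Y Y' : D) : hexagon_at d Y Y'.
  have [X [t tiso]] := equivalence_surj F_eqv Y; have [X' [t' t'iso]] := equivalence_surj
      F_eqv Y'.
  apply: (@iso_epi _ _ _ _ _ (thom (thom (idm (F V)) t) t')).
    by do ?apply: thom_iso => //; apply: iso_id.
  rewrite /hexagon_at in hexF.
  have -> : assoc Y Y' (F V) \cc d (tob Y Y') \cc assoc (F V) Y Y' \cc thom (thom (idm (F
      V)) t) t' =
      thom t (thom t' (idm (F V))) \cc
      (assoc (F X) (F X') (F V) \cc d (tob (F X) (F X')) \cc assoc (F V) (F X) (F X')).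
    rewrite -compmA assoc_nat compmA -[X in X \cc _]compmA dnat compmA assoc_nat.
    by rewrite !compmA.
  rewrite hexF -[RHS]compmA.
  have -> : thom (d Y) (idm Y') \cc thom (thom (idm (F V)) t) t' =
      thom (thom t (idm (F V))) t' \cc thom (d (F X)) (idm (F X')).
    by rewrite -!thom_comp dnat comp1m compm1.
  rewrite [RHS]compmA -[X in _ = X \cc _]compmA assoc_nat [X in _ = X \cc _]compmA.
  have -> : thom (idm Y) (d Y') \cc thom t (thom (idm (F V)) t') =
      thom t (thom t' (idm (F V))) \cc thom (idm (F X)) (d (F X')).
    by rewrite -!thom_comp dnat comp1m compm1.
  by rewrite !compmA.
have dunit : lunit (F V) \cc d uob = runit (F V).
  rewrite -phi_lunitE -phi_runitE -!compmA -dnat [in LHS](compmA (phi _ _)) -dce.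
  by rewrite !compmA -[X in X \cc _ \cc _]fun_comp hb_unit.
by exists (HBraid dnat hexd dunit).
Qed.

(* Every half-braiding on W restricts to a half-braiding on an object V with
   F V isomorphic to W, because F is fully faithful. *)
Lemma pull_braid V (W : D) (t : hom (F V) W) (d : hbraid W) : is_iso t ->
  exists c : hbraid V, forall e, braid_rel c e ->
    forall X, d (F X) \cc thom t (idm (F X)) = thom (idm (F X)) t \cc e X.
Proof.
move=> [t' [t't tt']].
pose e X := thom (idm (F X)) t' \cc d (F X) \cc thom t (idm (F X)).
have ex X : exists cX : hom (tob V X) (tob X V), fun_hom F cX \cc phi V X = phi X V \cc e
    X.
  have [psi [psiphi _]] := phi2_iso F V X.
  have [cX cXE] := equivalence_full F_eqv (phi X V \cc e X \cc psi).
  by exists cX; rewrite cXE -compmA psiphi compm1.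
pose c X := sval (cid (ex X)).
have ce : braid_rel c e by move=> X; apply: svalP (cid (ex X)).
(* The source Y is arbitrary because this is applied to F X (x) F Y and to the unit of D, which need
   not be objects F Z. *)
have enat X (Y : D) (h : hom Y (F X)) : e X \cc thom (idm (F V)) h =
    thom h (idm (F V)) \cc (thom (idm Y) t' \cc d Y \cc thom t (idm Y)).
  rewrite /e -compmA thom_lr -(thom_rl t h) compmA -[X in X \cc thom t _ = _]compmA
      hb_nat.
  by rewrite !compmA thom_rl -(thom_lr h t').
have cnat X X' (f : hom X X') : c X' \cc thom (idm V) f = thom f (idm V) \cc c X.
  apply: (equivalence_faithful F_eqv); apply: (iso_epi (phi2_iso F V X)).
  rewrite !fun_comp -compmA phi2_nat fun_id compmA ce -compmA enat.
  by rewrite -[RHS]compmA ce [RHS]compmA phi2_nat fun_id !compmA.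
have chex X Y : hexagon_at c X Y.
  apply: (equivalence_faithful F_eqv); apply: (iso_epi (phiR_iso V X Y)).
  rewrite (hexagon_right ce) (hexagon_left ce (enat _ _ _)); congr (_ \cc _).
  have aL : assoc (F X) (F Y) (F V) \cc thom (idm _) t' =
      thom (idm _) (thom (idm _) t') \cc assoc (F X) (F Y) W by rewrite -assoc_nat thom1.
  have aR : thom t (idm _) \cc assoc (F V) (F X) (F Y) =
      assoc W (F X) (F Y) \cc thom (thom t (idm _)) (idm _) by rewrite assoc_nat thom1.
  have mid : thom (idm _) (thom t (idm _)) \cc (assoc (F X) (F V) (F Y) \cc
      thom (thom (idm _) t') (idm _)) = assoc (F X) W (F Y).
    by rewrite assoc_nat compmA -thom_compr -thom_compl tt' !thom1 comp1m.
  transitivity (thom (idm (F X)) (thom (idm (F Y)) t') \cc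
      (assoc (F X) (F Y) W \cc d (tob (F X) (F Y)) \cc assoc W (F X) (F Y)) \cc
      thom (thom t (idm _)) (idm _)).
    by rewrite -!compmA -aR !compmA aL.
  rewrite (hb_hex d (F X) (F Y)) /e !thom_compr !thom_compl -mid.
  by rewrite !compmA.
have cunit : lunit V \cc c uob = runit V.
  apply: (equivalence_faithful F_eqv).
  apply: (@iso_epi _ _ _ _ _ (phi V uob \cc thom (idm _) (phi0 F))).
    apply: iso_comp; first exact: phi2_iso.
    by apply: thom_iso; [exact: iso_id | exact: phi0_iso].
  rewrite phi_runitE fun_comp -compmA [X in _ \cc X]compmA ce -compmA enat.
  rewrite [X in _ \cc X]compmA compmA phi_lunitE !compmA lunit_nat.
  by rewrite -(compmA t') hb_unit -compmA runit_nat compmA t't comp1m.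
exists (HBraid cnat chex cunit) => e' ce' X.
have -> : e' X = e X.
  by apply: (iso_mono (phi2_iso F X V)); rewrite -ce -ce'.
by rewrite /e !compmA -thom_compr tt' thom1 comp1m.
Qed.

End MonFunctor.

(** * Yetter-Drinfeld structures as half-braidings *)

Section YDBraid.
Variables (k : fieldType) (H : hopfAlg k).
Notation S := (@antipode k H).
Notation e := (@counit k H).
Notation Delta := (@comul k H).

Lemma coact_tcomodE (V W : comod H) v w : coact (tcomod V W) (v \ot w) =
  tlift (fun v0 v1 => tlift (fun w0 w1 => (v0 \ot w0) \ot (v1 * w1)) (coact W w)) (coact
      V v).
Proof.
rewrite [LHS]tcoactE tinter_tlift lin_tlift; last by lin_tac.
apply: eq_tlift => v0 v1; rewrite lin_tlift; last by lin_tac.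
by apply: eq_tlift => w0 w1; rewrite tmapE /= amulE.
Qed.

Section OfYD.
Variable M : yd H.

(** The compatibility condition with S(a_1) moved to the other side. In this form it expresses the
    colinearity of v (x) x |-> x_0 (x) v x_1. *)
Lemma yact_coact (U : lmodType k) (F : M -> H -> U) v a : bil F ->
  tlift (fun a1 a' => tlift (fun m0 m1 => F m0 (a1 * m1)) (coact M (yact M v a'))) (Delta
      a) =
  tlift (fun v0 v1 => tlift (fun a1 a2 => F (yact M v0 a1) (v1 * a2)) (Delta a)) (coact M
      v).
Proof.
move=> Fb; rewrite -[F]/(mk_bil Fb : M -> H -> U); move: (mk_bil Fb) => {Fb}F.
transitivity (tlift (fun a1 a' => tlift (fun v0 v1 => tlift (fun b1 z => tlift (fun b2 b3
    =>
    F (yact M v0 b2) (a1 * S b1 * v1 * b3)) (Delta z)) (Delta a')) (coact M v)) (Delta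
        a)).
  apply: eq_tlift => a1 a'; rewrite yactP.
  rewrite (@lin_tlift _ _ _ _ _ (tlift _)); last by apply: tliftP; lin_tac.
  apply: eq_tlift => v0 v1.
  rewrite (@lin_sw3 _ _ _ _ (tlift _)); last by apply: tliftP; lin_tac.
  rewrite -[RHS]/(sw3 (fun b1 b2 b3 => F (yact M v0 b2) (a1 * S b1 * v1 * b3)) a').
  apply: eq_sw3 => b1 b2 b3; rewrite tliftE; last by lin_tac.
  by rewrite !mulrA.
rewrite tlift_exchange; apply: eq_tlift => v0 v1.
rewrite (@cancel_Sr_left _ _ _ (fun u z => tlift (fun b2 b3 => F (yact M v0 b2) (u * v1 *
    b3)) (Delta z))).
  by apply: eq_tlift => a1 a2; rewrite mul1r.
by lin_tac.
Qed.

Definition yd_braid_fun (X : comod H) (t : M \ox X) : X \ox M :=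
  tlift (fun v x => tlift (fun x0 x1 => x0 \ot yact M v x1) (coact X x)) t.

Lemma yd_braid_lin X : lin (@yd_braid_fun X).
Proof. by rewrite /yd_braid_fun; lin_tac. Qed.

Lemma yd_braid_funE (X : comod H) v x :
  yd_braid_fun (v \ot x) = tlift (fun x0 x1 => x0 \ot yact M v x1) (coact X x).
Proof. by rewrite /yd_braid_fun tliftE //; lin_tac. Qed.

Lemma yd_braid_colin (X : comod H) (t : tcomod M X) :
  coact (tcomod X M) (yd_braid_fun t) =
  tlift (fun t0 t1 => yd_braid_fun t0 \ot t1) (coact (tcomod M X) t).
Proof.
have bl := @yd_braid_lin X.
have Tb : bil (fun (t0 : M \ox X) (t1 : H) => yd_braid_fun t0 \ot t1).
  by split=> ? /=; [apply: lin_tprodl | lin_tac].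
move: t; apply: tens_lin_ext => [||v x].
- by apply: lin_app.
- by apply: lin_tlift_arg => //; lin_tac.
rewrite yd_braid_funE coact_tcomodE (@lin_tlift _ _ _ _ _ (coact (tcomod X M))); last by
    lin_tac.
transitivity (tlift (fun x0 z => tlift (fun x1 x2 => tlift (fun m0 m1 =>
    (x0 \ot m0) \ot (x1 * m1)) (coact M (yact M v x2))) (Delta z)) (coact X x)).
  rewrite -(@coact_assoc _ _ _ _ (fun x0 x1 x2 => tlift (fun m0 m1 =>
    (x0 \ot m0) \ot (x1 * m1)) (coact M (yact M v x2)))); last by lin_tac.
  by apply: eq_tlift => x0 x1; rewrite coact_tcomodE.
rewrite [RHS](@lin_tlift _ _ _ _ _ (tlift _)); last exact: tliftP.
transitivity (tlift (fun v0 v1 => tlift (fun x0 z => tlift (fun x1 x2 =>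
    (x0 \ot yact M v0 x1) \ot (v1 * x2)) (Delta z)) (coact X x)) (coact M v)).
  rewrite tlift_exchange; apply: eq_tlift => x0 z.
  by rewrite (@yact_coact _ (fun m h => (x0 \ot m) \ot h)); lin_tac.
apply: eq_tlift => v0 v1.
rewrite -(@coact_assoc _ _ _ _ (fun x0 x1 x2 => (x0 \ot yact M v0 x1) \ot (v1 * x2)));
    last by lin_tac.
rewrite [RHS](@lin_tlift _ _ _ _ _ (tlift _)); last exact: tliftP.
apply: eq_tlift => x0 x1; rewrite tliftE // yd_braid_funE [RHS](@lin_tlift _ _ _ _ _ (fun
    t => t \ot _)) //.
by lin_tac.
Qed.

Definition yd_braid (X : comod H) : comod_hom (tcomod M X) (tcomod X M) :=
  @mk_comod_hom k H (tcomod M X) (tcomod X M) _ (@yd_braid_lin X) (@yd_braid_colin X).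

Lemma yd_braidE (X : comod H) v x :
  yd_braid X (v \ot x : tcomod M X) = tlift (fun x0 x1 => x0 \ot yact M v x1) (coact X x).
Proof. exact: yd_braid_funE. Qed.

(** The hexagon holds by associativity of the action and the unit law by v 1 = v; naturality is
    colinearity of the maps X -> X'. *)
Definition yd_hbraid : hbraid (M : comod_moncat H).
Proof.
apply: (@HBraid k (comod_moncat H) M yd_braid).
- move=> X X' f; apply: comod_hom_ext.
  apply: tens_lin_ext; [by lin_tac | by lin_tac |] => v x.
  rewrite -[LHS]/(yd_braid X' (tmap idfun f (v \ot x))) -[RHS]/(tmap f idfun (yd_braid X
      (v \ot x : tcomod M X))).
  rewrite tmapE !yd_braidE coact_hom (@lin_tlift _ _ _ _ _ (tlift _)); last by apply:
      tliftP; lin_tac.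
  rewrite [RHS]lin_tlift; last by lin_tac.
  by apply: eq_tlift => x0 x1; rewrite tmapE tliftE //; lin_tac.
- move=> X Y; apply: comod_hom_ext; apply: tens_ext3l => v x y.
  rewrite -[LHS]/(@tassoc k X Y M (yd_braid (tcomod X Y) (@tassoc k M X Y ((v \ot x) \ot
      y)))).
  rewrite -[RHS]/(tmap idfun (yd_braid Y) (@tassoc k X M Y (tmap (yd_braid X) idfun ((v
      \ot x) \ot y)))).
  rewrite tassocE yd_braidE coact_tcomodE tmapE yd_braidE.
  rewrite (@lin_tlift _ _ _ _ _ (tlift _)); last by apply: tliftP; lin_tac.
  rewrite lin_tlift; last by lin_tac.
  rewrite [RHS](@lin_tlift _ _ _ _ _ (fun t => tmap idfun (yd_braid Y) (tassoc (t \ot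
      idfun y)))); last by lin_tac.
  apply: eq_tlift => x0 x1; rewrite tassocE tmapE yd_braidE.
  rewrite (@lin_tlift _ _ _ _ _ (tlift _)); last by apply: tliftP; lin_tac.
  rewrite lin_tlift; last by lin_tac.
  rewrite [RHS]lin_tlift; last by lin_tac.
  apply: eq_tlift => y0 y1; rewrite tliftE; last by lin_tac.
  by rewrite tassocE yactM.
- apply: comod_hom_ext; apply: tens_lin_ext; [by lin_tac | by lin_tac |] => v c.
  rewrite -[LHS]/(@tlunit k M (yd_braid (ucomod H) (v \ot c : tcomod M (ucomod H)))).
  rewrite yd_braidE -[RHS]/(@trunit k M (v \ot c)) trunitE.
  rewrite -[coact _ _]/(c \ot 1) tliftE; last by lin_tac.
  by rewrite tlunitE yact1.
Defined.

End OfYD.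

Section OfBraid.
Variables (V : comod H) (c : hbraid (V : comod_moncat H)).

(** Inverts v (x) x |-> x_0 (x) v x_1: evaluated at the regular comodule, the braiding yields a_1
    (x) v a_2, and the counit leaves v a. *)
Definition braid_act (v : V) (a : H) : V :=
  tlift (fun (x : H) (w : V) => (e x : k) *: w)
    ((c (regular_comod H) : comod_hom _ _) (v \ot a : tcomod V (regular_comod H))).

Lemma braid_act_bil : bil braid_act.
Proof. by rewrite /braid_act; split=> ?; apply: lin_tlift_arg; lin_tac. Qed.

(** Every comodule X embeds by its coaction [rho] into X (x) H, and X (x) H receives a colinear map
    [lam x0] from H for each x0. Naturality along both reduces [c X] to the component at H; [KV] is
    a left inverse of the embedding. *)
Lemma braidE (X : comod H) v x :
  (c X : comod_hom _ _) (v \ot x : tcomod V X) =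
  tlift (fun x0 x1 => x0 \ot braid_act v x1) (coact X x).
Proof.
pose K : X \ox H -> X := @cofree_counit k H X.
have Kl : lin K by apply: cofree_counit_lin.
pose KV (t : (X \ox H) \ox V) : X \ox V := tlift (fun y w => K y \ot w) t.
have KVb : bil (fun (y : X \ox H) (w : V) => K y \ot w).
  by split=> ?; [apply: lin_tprodl | lin_tac].
have KVl : lin KV by apply: tliftP.
pose rho : comod_hom X (cofree_comod H X) := cofree_ext (mk_linear (@lin_id k X)).
have lam_lin (x0 : X) : lin (fun a : H => x0 \ot a) by lin_tac.
have lam_colin (x0 : X) (a : regular_comod H) : coact (cofree_comod H X) (x0 \ot a) =
    tlift (fun a0 a1 => (x0 \ot a0) \ot a1) (coact (regular_comod H) a).
  by rewrite coact_cofreeE.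
pose lam (x0 : X) : comod_hom (regular_comod H) (cofree_comod H X) :=
  @mk_comod_hom k H (regular_comod H) (cofree_comod H X) _ (@lam_lin x0) (@lam_colin x0).
have c_rho : (c (cofree_comod H X) : comod_hom _ _) (v \ot rho x : tcomod V (cofree_comod
    H X)) =
    tmap rho idfun ((c X : comod_hom _ _) (v \ot x : tcomod V X)).
  have := congr1 (fun h : comod_hom _ _ => h (v \ot x : tcomod V X)) (hb_nat c (rho : hom
      (X : comod_moncat H) (cofree_comod H X))).
  by rewrite /= tmapE.
have c_lam x0 a : (c (cofree_comod H X) : comod_hom _ _) (v \ot (x0 \ot a) : tcomod V
    (cofree_comod H X)) =
    tmap (lam x0) idfun ((c (regular_comod H) : comod_hom _ _) (v \ot a : tcomod V
        (regular_comod H))).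
  have := congr1 (fun h : comod_hom _ _ => h (v \ot a : tcomod V (regular_comod H)))
    (hb_nat c (lam x0 : hom (regular_comod H : comod_moncat H) (cofree_comod H X))).
  by rewrite /= tmapE.
have KVrho (t : X \ox V) : KV (tmap rho idfun t) = t.
  move: t; apply: tens_lin_ext; [| exact: lin_id |].
    by apply: (@lin_comp _ _ _ _ KV) => //; lin_tac.
  move=> y w; rewrite tmapE /KV (tliftE _ _ KVb).
  by rewrite [K _]cofree_counit_ext.
have KVlam x0 (t : H \ox V) : KV (tmap (lam x0) idfun t) = x0 \ot tlift (fun a w => (e a
    : k) *: w) t.
  move: t; apply: tens_lin_ext; [| by lin_tac |].
    by apply: (@lin_comp _ _ _ _ KV) => //; lin_tac.
  move=> a w; rewrite tmapE /KV (tliftE _ _ KVb).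
  rewrite tliftE; last by lin_tac.
  by rewrite mk_linearE [K _]cofree_counitE linearZl_LR linearZr_LR.
rewrite -[LHS]KVrho -c_rho cofree_extE.
rewrite (@lin_tlift _ _ _ _ _ (fun t => KV ((c (cofree_comod H X) : comod_hom _ _) (v \ot
    t : tcomod V (cofree_comod H X))))); last first.
  by apply: (@lin_comp _ _ _ _ KV) => //; lin_tac.
by apply: eq_tlift => x0 x1; rewrite mk_linearE c_lam KVlam.
Qed.

Lemma braid_act1 v : braid_act v 1 = v.
Proof.
have := congr1 (fun h : comod_hom _ _ => h (v \ot (1 : k^o) : tcomod V (ucomod H)))
    (hb_unit c).
rewrite -[X in X = _ -> _]/(@tlunit k V ((c (ucomod H) : comod_hom _ _) (v \ot (1 : k^o)
    : tcomod V (ucomod H)))).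
rewrite -[X in _ = X -> _]/(@trunit k V (v \ot (1 : k^o))) trunitE scale1r braidE.
have ab := braid_act_bil.
rewrite -[coact _ _]/((1 : k^o) \ot 1) tliftE ?tlunitE ?scale1r //.
by split=> ? /=; [lin_tac | apply: lin_tprodr; apply: ab.2].
Qed.

(** The hexagon at H, H, followed by the counit on both copies of H. *)
Lemma braid_actM v a b : braid_act v (a * b) = braid_act (braid_act v a) b.
Proof.
have ab := braid_act_bil; pose ac := mk_bil ab.
have acE w x : braid_act w x = ac w x by [].
pose R := regular_comod H; pose cR : comod_hom (tcomod V R) (tcomod R V) := c R.
pose G (t : H \ox (H \ox V)) : V :=
  tlift (fun x s => (e x : k) *: tlift (fun y w => (e y : k) *: w) s) t.
have Gl : lin G by apply: tliftP; lin_tac.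
have GE x y w : G (x \ot (y \ot w)) = (e x : k) *: ((e y : k) *: w).
  by rewrite /G tliftE ?tliftE //; lin_tac.
have := congr1 (fun h : comod_hom _ _ => h ((v \ot a) \ot b : tcomod (tcomod V R) R))
    (hb_hex c R R).
rewrite -[X in X = _ -> _]/(@tassoc k R R V ((c (tcomod R R) : comod_hom _ _) (@tassoc k
    V R R ((v \ot a) \ot b)))).
rewrite -[X in _ = X -> _]/(tmap idfun cR (@tassoc k R V R (tmap cR idfun ((v \ot a) \ot
    b)))).
rewrite tassocE braidE coact_tcomodE tmapE [cR _]braidE => /(congr1 G) E.
transitivity (G (tlift (fun a1 a2 => tlift (fun b1 b2 => a1 \ot (b1 \ot ac v (a2 * b2)))
    (Delta b)) (Delta a))).
  rewrite (@lin_tlift _ _ _ _ _ G) // -[LHS](@comul_counitl _ _ _ (fun a => ac v (a *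
      b))); last by lin_tac.
  apply: eq_tlift => a1 a2; rewrite (@lin_tlift _ _ _ _ _ G) //.
  rewrite -(@comul_counitl _ _ _ (fun b => ac v (a2 * b))); last by lin_tac.
  rewrite lin_tlift; last by lin_tac.
  by apply: eq_tlift => b1 b2; rewrite GE.
transitivity (G (tlift (fun a1 a2 => tlift (fun b1 b2 => a1 \ot (b1 \ot ac (ac v a2) b2))
    (Delta b)) (Delta a))).
  transitivity (G (tassoc (tlift (fun x0 x1 => x0 \ot braid_act v x1)
    (tlift (fun v0 v1 => tlift (fun w0 w1 => (v0 \ot w0) \ot (v1 * w1)) (coact R b))
        (coact R a))))).
    congr G; rewrite (@lin_tlift _ _ _ _ _ (fun t => tassoc (tlift _ t))); last first.
      by apply: lin_app; apply: (@tliftP _ _ _ _ (fun x0 x1 => x0 \ot ac v x1)); lin_tac.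
    apply: eq_tlift => a1 a2; rewrite (@lin_tlift _ _ _ _ _ (fun t => tassoc (tlift _
        t))); last first.
      by apply: lin_app; apply: (@tliftP _ _ _ _ (fun x0 x1 => x0 \ot ac v x1)); lin_tac.
    apply: eq_tlift => b1 b2; rewrite (@tliftE _ _ _ _ (fun x0 x1 => x0 \ot ac v x1));
        last by lin_tac.
    by rewrite tassocE.
  rewrite E; congr G.
  rewrite (@lin_tlift _ _ _ _ _ (fun t => tmap idfun cR (tassoc (t \ot _)))); last by
      lin_tac.
  apply: eq_tlift => a1 a2; rewrite tassocE tmapE [cR _]braidE.
  by rewrite lin_tlift; lin_tac.
rewrite (@lin_tlift _ _ _ _ _ G) // -[RHS](@comul_counitl _ _ _ (fun a => ac (ac v a)
    b)); last by lin_tac.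
apply: eq_tlift => a1 a2; rewrite (@lin_tlift _ _ _ _ _ G) //.
rewrite -(@comul_counitl _ _ _ (fun b => ac (ac v a2) b)); last by lin_tac.
rewrite [RHS]lin_tlift; last by lin_tac.
by apply: eq_tlift => b1 b2; rewrite GE.
Qed.

(** Colinearity of the component at H, followed by the counit on H; this is the form of the
    compatibility found in [yact_coact]. *)
Lemma braid_act_coact v a :
  tlift (fun a1 a' => tlift (fun w0 w1 => w0 \ot (a1 * w1)) (coact V (braid_act v a')))
      (Delta a) =
  tlift (fun v0 v1 => tlift (fun a1 a2 => braid_act v0 a1 \ot (v1 * a2)) (Delta a))
      (coact V v).
Proof.
have ab := braid_act_bil; pose ac := mk_bil ab.
have acE w x : braid_act w x = ac w x by [].
pose R := regular_comod H; pose cR : comod_hom (tcomod V R) (tcomod R V) := c R.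
pose G (t : (H \ox V) \ox H) : V \ox H :=
  tlift (fun s h => tlift (fun x w => (e x : k) *: w) s \ot h) t.
have Gl : lin G by apply: tliftP; lin_tac.
have GE x w h : G ((x \ot w) \ot h) = (e x : k) *: (w \ot h).
  by rewrite /G tliftE ?tliftE ?linearZl_LR //; lin_tac.
have := coact_hom cR (v \ot a); rewrite [cR _]braidE => /(congr1 G) E.
transitivity (G (coact (tcomod R V) (tlift (fun x0 x1 => x0 \ot braid_act v x1) (coact R
    a)))).
  rewrite (@lin_tlift _ _ _ _ _ (fun t => G (coact (tcomod R V) t))); last first.
    by apply: (@lin_comp _ _ _ _ G) => //; lin_tac.
  transitivity (tlift (fun a1 a' => tlift (fun b1 b2 => (e b1 : k) *:
      tlift (fun w0 w1 => w0 \ot (b2 * w1)) (coact V (ac v a'))) (Delta a1)) (Delta a)).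
    apply: eq_tlift => a1 a'.
    by rewrite (@comul_counitl _ _ _ (fun b2 => tlift (fun w0 w1 => w0 \ot (b2 * w1))
        (coact V (ac v a')))); last by lin_tac.
  apply: eq_tlift => a1 a'; rewrite coact_tcomodE (@lin_tlift _ _ _ _ _ G) //.
  apply: eq_tlift => b1 b2; rewrite (@lin_tlift _ _ _ _ _ G) // lin_tlift; last by
      lin_tac.
  by apply: eq_tlift => w0 w1; rewrite GE.
rewrite E coact_tcomodE (@lin_tlift _ _ _ _ _ (fun t => G (tlift _ t))); last first.
  apply: (@lin_comp _ _ _ _ G) => //; apply: (@tliftP _ _ _ _ (fun v0 v1 => cR v0 \ot
      v1)); lin_tac.
apply: eq_tlift => v0 v1; rewrite (@lin_tlift _ _ _ _ _ (fun t => G (tlift _ t))); last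
    first.
  apply: (@lin_comp _ _ _ _ G) => //; apply: (@tliftP _ _ _ _ (fun v0 v1 => cR v0 \ot
      v1)); lin_tac.
apply: eq_tlift => a1 a2; rewrite (@tliftE _ _ _ _ (fun v0 v1 => cR v0 \ot v1)); last by
    lin_tac.
rewrite [cR _]braidE (@lin_tlift _ _ _ _ _ (fun t => G (t \ot _))); last first.
  by apply: (@lin_comp _ _ _ _ G) => //; lin_tac.
transitivity (tlift (fun x0 x1 => (e x0 : k) *: (ac v0 x1 \ot (v1 * a2))) (Delta a1)).
  by apply: eq_tlift => x0 x1; rewrite GE.
by rewrite (@comul_counitl _ _ _ (fun x => ac v0 x \ot (v1 * a2))); last by lin_tac.
Qed.

(** Multiplying [braid_act_coact] by S(a_1) on the left cancels the factor in front of the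
    coaction. *)
Lemma braid_actP v a : coact V (mk_bil braid_act_bil v a) =
  tlift (fun v0 v1 => sw3 (fun a1 a2 a3 =>
    mk_bil braid_act_bil v0 a2 \ot (S a1 * v1 * a3)) a) (coact V v).
Proof.
pose ac := mk_bil braid_act_bil; rewrite -/ac.
rewrite /sw3 tlift_exchange.
transitivity (tlift (fun a1 z => tlift (fun w h => w \ot (S a1 * h))
   (tlift (fun v0 v1 => tlift (fun z1 z2 => ac v0 z1 \ot (v1 * z2)) (Delta z)) (coact V
       v))) (Delta a)); last first.
  apply: eq_tlift => a1 z; rewrite (@lin_tlift _ _ _ _ _ (tlift _)); last by apply:
      tliftP; lin_tac.
  apply: eq_tlift => v0 v1; rewrite (@lin_tlift _ _ _ _ _ (tlift _)); last by apply:
      tliftP; lin_tac.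
  by apply: eq_tlift => z1 z2; rewrite tliftE ?mulrA; lin_tac.
transitivity (tlift (fun a1 z => tlift (fun z1 z' => tlift (fun w0 w1 => w0 \ot (S a1 *
    z1 * w1))
   (coact V (ac v z'))) (Delta z)) (Delta a)).
  rewrite (@cancel_Sl_left _ _ _ (fun u y => tlift (fun w0 w1 => w0 \ot (u * w1)) (coact
      V (ac v y)))); last by lin_tac.
  rewrite [LHS]tlift_eta; apply: eq_tlift => w0 w1; by rewrite mul1r.
apply: eq_tlift => a1 z; have E := braid_act_coact v z.
rewrite -[in RHS]E.
rewrite (@lin_tlift _ _ _ _ _ (tlift _)); last by apply: tliftP; lin_tac.
apply: eq_tlift => z1 z'; rewrite (@lin_tlift _ _ _ _ _ (tlift _)); last by apply:
    tliftP; lin_tac.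
by apply: eq_tlift => w0 w1; rewrite tliftE ?mulrA; lin_tac.
Qed.

Definition braid_yd : yd H := @Yd k H V (mk_bil braid_act_bil) braid_act1 braid_actM
    braid_actP.

Lemma braid_ydE X : yd_hbraid braid_yd X = c X.
Proof.
apply: comod_hom_ext; apply: tens_lin_ext; [by lin_tac | by lin_tac |] => v x.
by rewrite braidE [LHS]yd_braidE.
Qed.

End OfBraid.

(** For the converse, the component at the regular comodule followed by the counit recovers the two
    actions. *)
Lemma ydlin_braid (M N : yd H) (f : comod_hom M N) : ydlin f <->
  forall X : comod_moncat H, yd_hbraid N X \cc thom (f : hom (M : comod_moncat H) N) (idm
      X) =
    thom (idm X) (f : hom (M : comod_moncat H) N) \cc yd_hbraid M X.
Proof.
split=> [fl X|fX].
  apply: comod_hom_ext; apply: tens_lin_ext; [by lin_tac | by lin_tac |] => v x.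
  rewrite -[LHS]/(yd_braid N X (tmap f idfun (v \ot x))) -[RHS]/(tmap idfun f (yd_braid M
      X (v \ot x : tcomod M X))).
  rewrite tmapE !yd_braidE [RHS]lin_tlift; last by lin_tac.
  by apply: eq_tlift => x0 x1; rewrite tmapE fl.
move=> v a; pose R := regular_comod H.
have := congr1 (fun h : comod_hom _ _ => h (v \ot a : tcomod M R)) (fX R).
rewrite -[X in X = _ -> _]/(yd_braid N R (tmap f idfun (v \ot a))).
rewrite -[X in _ = X -> _]/(tmap idfun f (yd_braid M R (v \ot a : tcomod M R))).
rewrite tmapE !yd_braidE lin_tlift; last by lin_tac.
move=> /(congr1 (tlift (fun (x : H) (w : N) => (e x : k) *: w))).
rewrite (@lin_tlift _ _ _ _ _ (tlift _)); last by apply: tliftP; lin_tac.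
rewrite [X in _ = X -> _](@lin_tlift _ _ _ _ _ (tlift _)); last by apply: tliftP; lin_tac.
have -> : tlift (fun x0 x1 => tlift (fun (x : H) (w : N) => (e x : k) *: w) (x0 \ot yact
    N (f v) x1)) (coact R a) = yact N (f v) a.
  rewrite -[RHS](@comul_counitl _ _ _ (yact N (f v))); last by lin_tac.
  by apply: eq_tlift => x0 x1; rewrite tliftE //; lin_tac.
move=> ->; rewrite -[LHS](@comul_counitl _ _ _ (fun a => f (yact M v a))); last by
    lin_tac.
by apply: eq_tlift => x0 x1; rewrite tmapE tliftE //; lin_tac.
Qed.

(** Characterises the braiding of the unit by coherence morphisms alone, hence in terms that a
    monoidal functor respects. *)
Lemma unit_yd_braid X : runit X \cc yd_hbraid (unit_yd H) X = lunit X.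
Proof.
apply: comod_hom_ext; apply: tens_lin_ext; [by lin_tac | by lin_tac |] => v x.
rewrite -[LHS]/(@trunit k X (yd_braid (unit_yd H) X (v \ot x : tcomod (unit_yd H) X))).
rewrite -[RHS]/(@tlunit k X (v \ot x)) tlunitE yd_braidE lin_tlift; last by lin_tac.
rewrite -[RHS](@coact_counit _ _ X _ (fun x => (v : k) *: x)); last by lin_tac.
by apply: eq_tlift => x0 x1; rewrite trunitE -scalerA.
Qed.

End YDBraid.

(** * Morphisms of half-braidings along the equivalence *)

Section BraidMorphisms.
Variables (k : fieldType) (C D : linMonCat k) (F : monFunctor C D).
Hypothesis F_eqv : is_equivalence F.

Lemma braid_rel_morphism (V V' : C) (c : hbraid V) (c' : hbraid V')
    (d : hbraid (F V)) (d' : hbraid (F V')) (f : hom V V') :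
  braid_rel c (fun X => d (F X)) -> braid_rel c' (fun X => d' (F X)) ->
  (forall X, c' X \cc thom f (idm X) = thom (idm X) f \cc c X) <->
  (forall X : C, d' (F X) \cc thom (fun_hom F f) (idm (F X)) =
    thom (idm (F X)) (fun_hom F f) \cc d (F X)).
Proof.
move=> cd cd'; have left X : fun_hom F (c' X \cc thom f (idm X)) \cc phi2 F V X =
    phi2 F X V' \cc (d' (F X) \cc thom (fun_hom F f) (idm (F X))).
  by rewrite fun_comp -compmA phi2_nat fun_id compmA cd' compmA.
have right X : fun_hom F (thom (idm X) f \cc c X) \cc phi2 F V X =
    phi2 F X V' \cc (thom (idm (F X)) (fun_hom F f) \cc d (F X)).
  by rewrite fun_comp -compmA cd compmA phi2_nat fun_id compmA.
split=> comm X.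
  by apply: (iso_mono (phi2_iso F X V')); rewrite -left -right comm.
apply: (equivalence_faithful F_eqv); apply: (iso_epi (phi2_iso F V X)).
by rewrite left right comm.
Qed.

(** Compatibility with half-braidings propagates from the objects F X to all objects by naturality
    along isomorphisms F X -> Y. *)
Lemma braid_morphism_image (W W' : D) (d : hbraid W) (d' : hbraid W') (g : hom W W') :
  (forall X : C, d' (F X) \cc thom g (idm (F X)) = thom (idm (F X)) g \cc d (F X)) ->
  forall Y, d' Y \cc thom g (idm Y) = thom (idm Y) g \cc d Y.
Proof.
move=> comm Y; have [X [t tiso]] := equivalence_surj F_eqv Y.
apply: (iso_epi (f := thom (idm W) t)); first by apply: thom_iso => //; apply: iso_id.
rewrite -[RHS]compmA hb_nat -compmA thom_lr -(thom_rl g t) compmA hb_nat -compmA comm.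
by rewrite !compmA thom_rl thom_lr.
Qed.

(** Says that [phi0] is compatible with the braidings, so that the image of the unit Yetter-Drinfeld
    module is again the unit, not merely as a comodule. *)
Lemma braid_rel_unit (c : hbraid (uob : C)) (d : hbraid (F uob)) (d0 : hbraid (uob : D)) :
  braid_rel c (fun X => d (F X)) ->
  (forall X, runit X \cc c X = lunit X) -> (forall Y, runit Y \cc d0 Y = lunit Y) ->
  forall X : C, d (F X) \cc thom (phi0 F) (idm (F X)) = thom (idm (F X)) (phi0 F) \cc d0
      (F X).
Proof.
move=> cd cu du X.
apply: (iso_mono (f := fun_hom F (runit X) \cc phi2 F X uob)).
  by apply: iso_comp (phi2_iso F _ _); apply: fun_iso; apply: runit_iso.
rewrite [RHS]compmA phi_runit du compmA -(compmA (fun_hom F (runit X))) -cd.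
by rewrite (compmA (fun_hom F (runit X))) -fun_comp cu phi_lunit.
Qed.

End BraidMorphisms.

(** * The equivalence of Yetter-Drinfeld modules *)

Section YDTransport.
Variables (k : fieldType) (A B : hopfAlg k) (F : monFunctor (comod_moncat A)
    (comod_moncat B)).
Hypothesis F_eqv : is_equivalence F.

Definition push_yd_braid (M : yd A) : hbraid (F M) := sval (cid (push_braid F_eqv
    (yd_hbraid M))).

(** The underlying comodule is F M itself, so colinear maps are transported by F on morphisms, and
    fullness and faithfulness are inherited. *)
Definition push_yd (M : yd A) : yd B := braid_yd (push_yd_braid M).

Lemma push_ydP (M : yd A) :
  braid_rel (F := F) (yd_hbraid M) (fun X => yd_hbraid (push_yd M) (F X)).
Proof.
move=> X; rewrite [yd_hbraid (push_yd M) _]braid_ydE.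
exact: (svalP (cid (push_braid F_eqv (yd_hbraid M)))).
Qed.

Definition push_hom (M N : yd A) (f : comod_hom M N) : comod_hom (push_yd M) (push_yd N)
    :=
  fun_hom F (f : hom (M : comod_moncat A) N).

Lemma push_ydlin (M N : yd A) (f : comod_hom M N) : ydlin f <-> ydlin (push_hom f).
Proof.
rewrite !ydlin_braid; have rel := braid_rel_morphism F_eqv f (push_ydP M) (push_ydP N).
split=> comm; last by apply/rel => X; apply: comm.
by apply: (braid_morphism_image F_eqv); apply/rel.
Qed.

Lemma ydlin_inv (H : hopfAlg k) (M N : yd H) (f : comod_hom M N) (g : comod_hom N M) :
  comod_comp g f = comod_id M -> comod_comp f g = comod_id N -> ydlin f -> ydlin g.
Proof.
move=> gf fg fl n a.
have fK x : g (f x) = x := congr1 (fun h : comod_hom _ _ => h x) gf.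
have gK x : f (g x) = x := congr1 (fun h : comod_hom _ _ => h x) fg.
by apply: (can_inj fK); rewrite fl !gK.
Qed.

Lemma push_yd_surj (N : yd B) : exists M : yd A, yd_iso (push_yd M) N.
Proof.
have [V [t tiso]] := equivalence_surj F_eqv (N : comod_moncat B).
have [c cP] := pull_braid F_eqv (yd_hbraid N) tiso.
exists (braid_yd c); have [t' [t't tt']] := tiso.
have tl : @ydlin _ _ (push_yd (braid_yd c)) N t.
  apply/ydlin_braid; apply: (braid_morphism_image F_eqv); apply: cP => X.
  by rewrite -(braid_ydE c); apply: (@push_ydP (braid_yd c) X).
exists t, t'; split=> //; exact: ydlin_inv tl.
Qed.

Lemma push_yd_unit : yd_iso (push_yd (unit_yd A)) (unit_yd B).
Proof.
apply: yd_iso_sym; have [t' [t't tt']] := phi0_iso F.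
have tl : @ydlin _ _ (unit_yd B) (push_yd (unit_yd A)) (phi0 F).
  apply/ydlin_braid; apply: (braid_morphism_image F_eqv).
  by apply: braid_rel_unit (push_ydP (unit_yd A)) _ _ => X; apply: unit_yd_braid.
exists (phi0 F), t'; split=> //; exact: ydlin_inv tl.
Qed.

Definition mon_yd_equiv : yd_equiv A B.
Proof.
apply: (@YdEquiv _ _ _ push_yd push_hom).
- move=> M N f g; have := fun_lin F (X := M) (Y := N) 1 f g.
  by rewrite !scale1r.
- by move=> M; apply: (fun_id F (M : comod_moncat A)).
- move=> M N P f g.
  exact: (@fun_comp _ _ _ F (M : comod_moncat A) (N : comod_moncat A) (P : comod_moncat
      A)).
- by move=> M N f g; apply: (equivalence_faithful F_eqv).
- by move=> M N g; apply: (equivalence_full F_eqv).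
- exact: push_ydlin.
- exact: push_yd_surj.
- exact: push_yd_unit.
Defined.

End YDTransport.

Theorem theorem2p5 (k : closedFieldType) (A B : hopfAlg k) :
  mon_equivalent (comod_moncat A) (comod_moncat B) ->
  smooth A -> smooth B ->
  bijective (@antipode k A) -> bijective (@antipode k B) ->
  cd A = cd B.
Proof. by move=> [F F_eqv]; apply: cd_eq_of_yd_equiv (mon_yd_equiv F_eqv). Qed.
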